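(* Let $f\in L^1([0,1],r\,dr)$ with $f\ge 0$. There exists a real number $\lambda_c>0$ such that for every $\lambda$ with $0<\lambda<\lambda_c$ the Dirichlet problem $$\frac{1}{r}\left\{ r\left[\frac{1}{r}\left(r u'\right)'\right]'\right\}'=\frac{1}{r}\,u'u''+\lambda f(r),\qquad r\in(0,1),$$ $$u'(0)=0,\qquad u(1)=0,\qquad u'(1)=0,\qquad \lim_{r\to 0} r\,u'''(r)=0,$$ has at least two solutions in $\mathring{W}^{2,2}([0,1],r\,dr)$.
   Context: Here $'=d/dr$, and radial functions on the unit disk of $\mathbb{R}^2$ are identified with functions of $r\in[0,1]$. $L^1([0,1],r\,dr)$ is the space of functions on $[0,1]$ absolutely integrable against $r\,dr$. $W^{2,2}([0,1],r\,dr)$ is the space of radially symmetric $W^{2,2}$ functions on the unit disk, i.e. functions $u:[0,1]\to\mathbb{R}$ such that $u''$ and $u'/r$ are square integrable on $[0,1]$ against $r\,dr$, with norm given by $\|u\|^2=\int_0^1\left[u^2+(u')^2+(u'')^2+(u')^2/r^2\right]r\,dr$. $\mathring{W}^{2,2}([0,1],r\,dr)$ is the closure, in the norm of $W^{2,2}([0,1],r\,dr)$, of the space of radially symmetric smooth functions compactly supported inside the unit ball of $\mathbb{R}^2$ (so its elements satisfy $u(1)=u'(1)=0$). A solution is a function $u\in\mathring{W}^{2,2}([0,1],r\,dr)$ satisfying the differential equation in the weak sense, i.e. $$\int_0^1\left(u''+\frac{u'}{r}\right)\left(\phi''+\frac{\phi'}{r}\right)r\,dr=\int_0^1 u'u''\phi\,dr+\lambda\int_0^1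 f\phi\,r\,dr$$ for every radially symmetric smooth $\phi$ compactly supported inside the unit ball of $\mathbb{R}^2$, together with the listed boundary conditions. *)

(* Defs.v *)
From mathcomp Require Import all_boot all_order all_algebra.
From mathcomp Require Import all_classical all_reals all_analysis.

Set Implicit Arguments.
Unset Strict Implicit.
Unset Printing Implicit Defensive.

Import Order.TTheory GRing.Theory Num.Theory.
Import numFieldNormedType.Exports.

Local Open Scope ring_scope.
Local Open Scope classical_set_scope.


(* C^infinity: all iterated directional derivatives exist everywhere and are
   Frechet differentiable. *)
Definition smooth (R : realType) (V : normedModType R) (F : V -> R) : Prop :=
  forall (vs : seq V) (x : V),
    differentiable (foldr (fun v (G : V -> R) => 'D_v G) F vs) x.

Definition supp (R : realType) (V : normedModType R) (F : V -> R) : set V :=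
  closure [set x | F x != 0].

Definition test_fun (R : realType) (V : normedModType R) (U : set V)
    (F : V -> R) : Prop :=
  [/\ smooth F, compact (supp F) & supp F `<=` U].

(* The library norm on 'rV[R]_2 is the sup norm. *)
Definition enorm (R : realType) (x : 'rV[R]_2) : R :=
  Num.sqrt (\sum_(i < 2) x ord0 i ^+ 2).

(* phi is the radial profile of a radially symmetric test function on the open
   unit disk; only its values on [0, +oo[ matter. *)
Definition radial_test_fun (R : realType) (phi : R -> R) : Prop :=
  test_fun [set x : 'rV[R]_2 | enorm x < 1] (fun x => phi (enorm x)).

(* v is the weak derivative of u on ]0, 1[. *)
Definition weak_derivative (R : realType) (u v : R -> R) : Prop :=
  [/\ locally_integrable (`]0, 1[%classic : set R) u,
      locally_integrable (`]0, 1[%classic : set R) v &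
      forall psi : R -> R, test_fun (`]0, 1[%classic : set R^o) psi ->
        \int[lebesgue_measure]_(r in `]0, 1[) (u r * derive1 psi r) =
        - \int[lebesgue_measure]_(r in `]0, 1[) (v r * psi r)].

(* In what follows functions of W^{2,2}([0,1], r dr) come with their weak
   derivatives: u1 is u' and u2 is u''. *)
Definition W22 (R : realType) (u u1 u2 : R -> R) : Prop :=
  [/\ weak_derivative u u1, weak_derivative u1 u2,
      lebesgue_measure.-integrable `[0, 1] (fun r => (u2 r ^+ 2 * r)%:E) &
      lebesgue_measure.-integrable `[0, 1]
        (fun r => ((u1 r / r) ^+ 2 * r)%:E)].

Definition W22_sqnorm (R : realType) (u u1 u2 : R -> R) : \bar R :=
  (\int[lebesgue_measure]_(r in `[0%R, 1%R])
    ((u r ^+ 2 + u1 r ^+ 2 + u2 r ^+ 2 + u1 r ^+ 2 / r ^+ 2) * r)%:E)%E.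

Definition W22ring (R : realType) (u u1 u2 : R -> R) : Prop :=
  W22 u u1 u2 /\
  forall e : R, 0 < e -> exists2 phi : R -> R, radial_test_fun phi &
    (W22_sqnorm (u \- phi)%R (u1 \- derive1 phi)%R
      (u2 \- derive1n 2 phi)%R < (e ^+ 2)%:E)%E.

Definition weak_equation (R : realType) (lambda : R) (f u1 u2 : R -> R) : Prop :=
  forall phi : R -> R, radial_test_fun phi ->
    \int[lebesgue_measure]_(r in `[0, 1])
      ((u2 r + u1 r / r) * (derive1n 2 phi r + derive1 phi r / r) * r) =
    \int[lebesgue_measure]_(r in `[0, 1]) (u1 r * u2 r * phi r) +
    lambda * \int[lebesgue_measure]_(r in `[0, 1]) (f r * phi r * r).

(* Pointwise conditions make sense for the continuous representative of u; u' at
   the end points is the one-sided derivative, and u''' is the classical third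
   derivative, which has to exist near 0 for the limit to be meaningful. *)
Definition boundary_conditions (R : realType) (u : R -> R) : Prop :=
  [/\ {within `[0, 1], continuous u},
      (u r - u 0) / r @[r --> 0^'+] --> (0 : R),
      u 1 = 0,
      (u r - u 1) / (r - 1) @[r --> 1^'-] --> (0 : R) &
      (forall k, (k < 3)%N -> \forall r \near 0^'+, derivable (derive1n k u) r 1) /\
      r * derive1n 3 u r @[r --> 0^'+] --> (0 : R)].

Definition solution (R : realType) (lambda : R) (f u : R -> R) : Prop :=
  (exists u1 u2 : R -> R, W22ring u u1 u2 /\ weak_equation lambda f u1 u2) /\
  boundary_conditions u.

(* Main.v *)
Require Import Defs.
From mathcomp Require Import all_boot all_order all_algebra.
From mathcomp Require Import all_classical all_reals all_analysis.
From mathcomp Require Import measurable_realfun ring lra.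
Import Order.TTheory GRing.Theory Num.Theory.
Import numFieldNormedType.Exports.
Local Open Scope classical_set_scope.
Local Open Scope ring_scope.

Set Implicit Arguments.
Unset Strict Implicit.
Unset Printing Implicit Defensive.

(* Writing u'(r) = - r s(r), the equation integrates twice to
     s'(r) = - r^-3 J(r),  J(r) = int_0^r t ((t s(t))^2 / 2 + lambda m(t)) dt,
   where m(r) = int_0^r f(t) t dt, i.e. to the Volterra equation s = a + p - D with
   a free parameter a, where p(r) = lambda int_r^1 t^-3 (int_0^t x m(x) dx) dt is
   the contribution of f and D(r) = int_0^r t^-3 (int_0^t x^3 s(x)^2 / 2 dx) dt.
   The Dirichlet condition u'(1) = 0 becomes s(1) = 0.  Picard iteration solves
   the Volterra equation for every a >= 0 when lambda is small, and s(1) depends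
   continuously on a.  It is nonpositive for a = 0 because p(1) = 0, positive for
   a = 1 because D(1) is then at most 1/8 + 1/3, and nonpositive again for large a
   because D grows faster than a.  Hence there are two roots a < b, and the
   parameter is determined by u.
   To put u in the closure of the test functions, approximate it by r |-> h(r^2)
   where h is smooth, vanishes near 1, and 4 r^2 h''(r^2) is close to J(r) / r^2. *)

(** Two obstacles shape the proof. The nonlinearity is quadratic, so the Volterra kernel is given
    the positive part of [a + p - D] instead of its value. As [D >= 0], this part is at most [a + p]
    whatever [D] is, so no iterate can blow up and every [a >= 0] has a solution on all of [[0, 1]].
    At a root the truncation is invisible: [a + p - D] is nonincreasing and vanishes at 1, hence is
    nonnegative. Smallness of [lambda] enters through the bound of [p] by [r^(-1/4)]; it gives
    [r p^2 <= 1] and leaves a positive power of [r] to spare in every limit at 0. The second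
    obstacle is the closure of the test functions. As [s(1) = 0], [u''] takes at 1 the value [J(1)],
    which need not be 0, whereas test functions vanish near 1. Second derivatives therefore cannot
    be matched uniformly: the error is small for [r^2 <= 1 - 2 delta] and merely bounded on the
    remaining layer, whose width is of order [delta], which is enough in the square norm. *)

(** * Derivative rules on the line *)

Section PointwiseDerivatives.
Context {R : realType}.
Implicit Types (f g : R -> R) (x a b : R).

Lemma isd_cst (c x : R) : is_derive x 1 (fun _ : R => c) 0.
Proof. exact: is_derive_cst. Qed.

Lemma isd_id (x : R) : is_derive x 1 (fun y : R => y) 1.
Proof. exact: is_derive_id. Qed.

Lemma isdD f g x a b : is_derive x 1 f a -> is_derive x 1 g b ->
  is_derive x 1 (fun y => f y + g y) (a + b).
Proof. by move=> ? ?; exact: is_deriveD. Qed.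

Lemma isdN f x a : is_derive x 1 f a -> is_derive x 1 (fun y => - f y) (- a).
Proof. by move=> ?; exact: is_deriveN. Qed.

Lemma isdM f g x a b : is_derive x 1 f a -> is_derive x 1 g b ->
  is_derive x 1 (fun y => f y * g y) (a * g x + f x * b).
Proof.
move=> fa gb; have := is_deriveM fa gb; rewrite /GRing.scale/= => h.
by rewrite addrC [a * _]mulrC; exact: h.
Qed.

Lemma isdX f n x a : is_derive x 1 f a ->
  is_derive x 1 (fun y => f y ^+ n) (n%:R * f x ^+ n.-1 * a).
Proof. by move=> fa; have := is_deriveX n fa; rewrite exprfctE. Qed.

Lemma isdV f x a : f x != 0 -> is_derive x 1 f a ->
  is_derive x 1 (fun y => (f y)^-1) (- a / f x ^+ 2).
Proof.
move=> f0 fa; have := is_deriveV f0 fa.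
by rewrite /GRing.scale/= !mulNr mulrC.
Qed.

Lemma isd_comp f g x a b : is_derive x 1 g b -> is_derive (g x) 1 f a ->
  is_derive x 1 (fun y => f (g y)) (a * b).
Proof.
move=> gb fa; have := @is_derive1_comp _ f g x a b fa gb; exact.
Qed.

Lemma isd_exp f x a : is_derive x 1 f a ->
  is_derive x 1 (fun y => expR (f y)) (expR (f x) * a).
Proof. by move=> fa; apply: isd_comp. Qed.

Lemma isd_ln f x a : 0 < f x -> is_derive x 1 f a ->
  is_derive x 1 (fun y => ln (f y)) ((f x)^-1 * a).
Proof. by move=> f0 fa; apply: isd_comp => //; exact: is_derive1_ln. Qed.

Lemma isd_eq f x a b : is_derive x 1 f a -> a = b -> is_derive x 1 f b.
Proof. by move=> ? <-. Qed.

Lemma isd_continuous f x a : is_derive x 1 f a -> {for x, continuous f}.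
Proof.
by move=> [/derivable1_diffP + _]; exact: differentiable_continuous.
Qed.

End PointwiseDerivatives.

(** The derivative is computed from the syntax of the function. What remains is the equation between
    the computed and the announced value, preceded by side conditions such as nonvanishing
    denominators. Derivatives of unknown functions are taken from the context. *)
Ltac isd := notypeclasses refine (isd_eq _ _); [repeat lazymatch goal with
  | |- is_derive _ _ (fun _ => ?c) _ => notypeclasses refine (isd_cst _ _)
  | |- is_derive _ _ (fun y => y) _ => notypeclasses refine (isd_id _)
  | |- is_derive _ _ (fun y => _ + _) _ => notypeclasses refine (isdD _ _)
  | |- is_derive _ _ (fun y => _ * _) _ => notypeclasses refine (isdM _ _)
  | |- is_derive _ _ (fun y => - _) _ => notypeclasses refine (isdN _)
  | |- is_derive _ _ (fun y => _ ^+ _) _ => notypeclasses refine (isdX _ _)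
  | |- is_derive _ _ (fun y => (_)^-1) _ => notypeclasses refine (isdV _ _)
  | |- is_derive _ _ (fun y => expR _) _ => notypeclasses refine (isd_exp _)
  | |- is_derive _ _ (fun y => ln _) _ => notypeclasses refine (isd_ln _ _)
  | |- is_derive _ _ ( *%R ?c) _ => notypeclasses refine (isdM (isd_cst c _) (isd_id _))
  | |- is_derive _ _ GRing.inv _ => notypeclasses refine (isdV _ (isd_id _))
  | |- is_derive _ _ (@ln _) _ => notypeclasses refine (is_derive1_ln _)
  | |- is_derive _ _ (@expR _) _ => notypeclasses refine (is_derive_expR _)
  | H : is_derive _ _ ?f _ |- is_derive _ _ (fun y => ?f y) _ => notypeclasses refine H
  | H : is_derive _ _ ?f _ |- is_derive _ _ ?f _ => notypeclasses refine H
  end|] => /=.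

Ltac isdc := notypeclasses refine (isd_continuous _); isd; try reflexivity.

(** * Integrals over compact intervals *)

Section IntervalCalculus.
Context {R : realType}.
Local Notation mu := (@lebesgue_measure R).
Implicit Types f g F : R -> R.

Lemma continuous_oo_measurable f (a b : R) :
  {in `]a, b[, continuous f} -> measurable_fun `[a, b] f.
Proof.
move=> cf; apply: (@measurable_fun_itv_cc _ _ _ false true).
apply: open_continuous_measurable_fun; first exact: interval_open.
by move=> x; rewrite inE => /cf.
Qed.

Lemma bounded_itv_integrable f (a b M : R) : measurable_fun `[a, b] f ->
  (forall t, t \in `[a, b] -> `|f t| <= M) ->
  mu.-integrable `[a, b] (EFin \o f).
Proof.
move=> mf fM; apply: measurable_bounded_integrable => //.
  by rewrite /= lebesgue_measure_itv /=; case: ifP => // _; rewrite ltry.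
exists M; split; first exact: num_real.
by move=> x Mx t /= tab; apply: (le_trans (fM _ _)) (ltW Mx).
Qed.

Lemma integrable_itvS f (a b c d : R) : a <= c -> d <= b ->
  mu.-integrable `[a, b] (EFin \o f) -> mu.-integrable `[c, d] (EFin \o f).
Proof.
move=> ac db; apply: integrableS => //.
by apply: subset_itv; rewrite bnd_simp.
Qed.

Lemma continuous_itv_integrable f (a b : R) :
  (forall x, a <= x <= b -> {for x, continuous f}) ->
  mu.-integrable `[a, b] (EFin \o f).
Proof.
move=> cf; apply: continuous_compact_integrable; first exact: segment_compact.
apply/subspace_continuousP => x; rewrite /= in_itv/= => /cf.
exact: cvg_within_filter.
Qed.

Lemma integrable_itvD f g (a b : R) :
  mu.-integrable `[a, b] (EFin \o f) -> mu.-integrable `[a, b] (EFin \o g) ->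
  mu.-integrable `[a, b] (EFin \o (fun x => f x + g x)).
Proof. by move=> fi gi; have := integrableD _ fi gi; apply => //; exact: measurable_itv. Qed.

Lemma integrable_itvB f g (a b : R) :
  mu.-integrable `[a, b] (EFin \o f) -> mu.-integrable `[a, b] (EFin \o g) ->
  mu.-integrable `[a, b] (EFin \o (fun x => f x - g x)).
Proof. by move=> fi gi; have := integrableB _ fi gi; apply => //; exact: measurable_itv. Qed.

Lemma Rintegral_itv_split f (a b c : R) : a <= b <= c ->
  mu.-integrable `[a, c] (EFin \o f) ->
  \int[mu]_(t in `[a, c]) f t =
  \int[mu]_(t in `[a, b]) f t + \int[mu]_(t in `[b, c]) f t.
Proof.
move=> /andP[ab bc] intf.
apply/eqP; rewrite addrC -subr_eq; apply/eqP.
rewrite Rintegral_itvB //; try by rewrite bnd_simp.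
rewrite Rintegral_itv_obnd_cbnd //; apply: integrableS intf => //.
by apply: subset_itv; rewrite bnd_simp.
Qed.

Lemma ler_norm_Rintegral_itv f g (a b : R) :
  mu.-integrable `[a, b] (EFin \o f) -> mu.-integrable `[a, b] (EFin \o g) ->
  (forall t, t \in `[a, b] -> `|f t| <= g t) ->
  `|\int[mu]_(t in `[a, b]) f t| <= \int[mu]_(t in `[a, b]) g t.
Proof.
move=> fi gi fg; apply: (le_trans (le_normr_Rintegral _ fi)) => //.
apply: le_Rintegral => //; exact: integrable_norm.
Qed.

Lemma Rintegral_itv_continuous f (a b : R) :
  mu.-integrable `[a, b] (EFin \o f) ->
  {in `]a, b[, continuous (fun x => \int[mu]_(t in `[a, x]) f t)}.
Proof.
move=> fi x xab; have ab : a < b by move: xab; rewrite in_itv/= => /andP[]; exact: lt_trans.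
have /(continuous_within_itvP _ ab)[+ _ _] := parameterized_integral_continuous (ltW ab) fi.
exact.
Qed.

Lemma is_derive_Rintegral_itv f (a b x : R) :
  mu.-integrable `[a, b] (EFin \o f) -> a < x < b -> {for x, continuous f} ->
  is_derive x 1 (fun x => \int[mu]_(t in `[a, x]) f t) (f x).
Proof.
move=> fi /andP[ax xb] cf.
have [df <-] := continuous_FTC1_closed xb fi ax cf.
by rewrite derive1E; exact: derivableP.
Qed.

(** Integrability is asked only away from [a], because [moment t / t ^+ 3] need not be integrable at
    0. A base point [c] between [a] and [x] reduces the claim to a variable upper limit. *)
Lemma is_derive_Rintegral_itv_low f (a b x : R) :
  (forall c, a < c -> mu.-integrable `[c, b] (EFin \o f)) ->
  a < x < b -> {for x, continuous f} ->
  is_derive x 1 (fun x => \int[mu]_(t in `[x, b]) f t) (- f x).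
Proof.
move=> fi /andP[ax xb] cf; pose c := (a + x) / 2.
have ac : a < c by rewrite /c; lra.
have cx : c < x by rewrite /c; lra.
apply: (@near_eq_is_derive _ _ _ (fun y => \int[mu]_(t in `[c, b]) f t -
    \int[mu]_(t in `[c, y]) f t)).
- near=> y; rewrite (@Rintegral_itv_split _ c y b) ?fi //; last first.
    by apply/andP; split; apply/ltW; near: y; [exact: lt_nbhsr|exact: lt_nbhsl].
  by rewrite addrAC subrr add0r.
- have dF := is_derive_Rintegral_itv (fi _ ac) (introT andP (conj cx xb)) cf.
  by rewrite -[- f x]sub0r; apply: is_deriveB.
Unshelve. all: by end_near. Qed.

Lemma Rintegral_FTC2 F f (a b v : R) : a <= b ->
  (forall x, a <= x <= b -> is_derive x 1 F (f x)) ->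
  (forall x, a <= x <= b -> {for x, continuous f}) -> F b - F a = v ->
  \int[mu]_(t in `[a, b]) f t = v.
Proof.
move=> + + + <-; rewrite le_eqVlt => /predU1P[<- _ _|ab dF cf].
  by rewrite set_itv1 Rintegral_set1 subrr.
have cF x : a <= x <= b -> {for x, continuous F}.
  move=> /dF[/derivable1_diffP dFx _].
  exact: differentiable_continuous.
rewrite /Rintegral (@continuous_FTC2 _ f F) //.
- apply/subspace_continuousP => x; rewrite /= in_itv/= => /cf.
  exact: cvg_within_filter.
- split; first by move=> x /[!in_itv]/= /andP[/ltW ax /ltW xb]; have [] := dF x; rewrite ?ax.
  + by apply: cvg_at_right_filter; apply: cF; rewrite lexx ltW.
  + by apply: cvg_at_left_filter; apply: cF; rewrite lexx ltW.
- move=> x /[!in_itv]/= /andP[/ltW ax /ltW xb].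
  by have [_ <-] := dF x (introT andP (conj ax xb)); rewrite derive1E.
Qed.

Lemma Rintegral_monomial (c : R) n (r : R) : 0 <= r ->
  \int[mu]_(t in `[0, r]) (c * t ^+ n) = c * r ^+ n.+1 / n.+1%:R.
Proof.
move=> r0.
refine (@Rintegral_FTC2 (fun x => c * x ^+ n.+1 / n.+1%:R) _ _ _ _ r0 _ _ _).
- by move=> x _; isd; field; rewrite nat1r pnatr_eq0.
- by move=> x _; isdc.
- by rewrite expr0n/= mulr0 mul0r subr0.
Qed.

End IntervalCalculus.

(** * The Volterra operator and its contraction in a weighted norm *)

Section Volterra.
Context {R : realType}.
Local Notation mu := (@lebesgue_measure R).
Variables (p : R -> R) (A : R).
Hypothesis p_cont : {in `]0, 1[, continuous p}.
Hypothesis p_ge0 : forall s : R, 0 < s <= 1 -> 0 <= p s.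
Hypothesis p_le : forall s : R, 0 < s <= 1 -> s * p s ^+ 2 <= 1.
Hypothesis A_ge0 : 0 <= A.

(** Here [x] stands for [D s]. The factor [s ^+ 3] is the weight [t] of the inner integral times the
    square from [(t s(t))^2]. *)
Definition vkernel (a s x : R) : R := s ^+ 3 * Num.max (a + p s - x) 0 ^+ 2 / 2.

Definition vinner (a : R) (D : R -> R) (t : R) : R :=
  \int[mu]_(s in `[0, t]) vkernel a s (D s).

Definition volterra (a : R) (D : R -> R) (r : R) : R :=
  \int[mu]_(t in `[0, r]) (vinner a D t / t ^+ 3).

Definition nonneg_mfun (D : R -> R) :=
  measurable_fun `[0 : R, 1] D /\ forall s : R, 0 <= s <= 1 -> 0 <= D s.

Implicit Types (a b s t r x y : R) (D E : R -> R).

Lemma vkernel_ge0 a s x : 0 <= s -> 0 <= vkernel a s x.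
Proof. move=> s0; apply: divr_ge0 => //.
by apply: mulr_ge0; [exact: exprn_ge0|exact: sqr_ge0]. Qed.

Lemma vkernel0 a x : vkernel a 0 x = 0.
Proof. by rewrite /vkernel expr0n/= !mul0r. Qed.

(** As [x >= 0], the positive part is at most [a + p s], so the bound does not depend on [x]. Then
    [(a + p)^2 <= 2 a^2 + 2 p^2] and one factor [s] absorbs [p s ^+ 2]. *)
Lemma vkernel_le a s x : 0 <= a -> 0 <= s <= 1 -> 0 <= x ->
  vkernel a s x <= a ^+ 2 * s ^+ 3 + s ^+ 2.
Proof.
move=> a0 /andP[]; rewrite le_eqVlt => /predU1P[<- _ _|s0 s1 x0].
  by rewrite vkernel0 !expr0n/= mulr0 addr0.
have ps0 : 0 <= p s by apply: p_ge0; rewrite s0.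
have ps1 : s * p s ^+ 2 <= 1 by apply: p_le; rewrite s0.
have : Num.max (a + p s - x) 0 ^+ 2 <= (a + p s) ^+ 2.
  have ap0 : 0 <= a + p s by exact: addr_ge0.
  by rewrite ler_sqr ?nnegrE ?le_max ?lexx ?orbT // ge_max gerBl x0.
rewrite /vkernel; set m := Num.max _ _ ^+ 2 => mle.
have s3 : 0 <= s ^+ 3 by rewrite exprn_ge0 ?ltW.
have h1 : s ^+ 3 * m <= s ^+ 3 * (2 * a ^+ 2 + 2 * p s ^+ 2).
  apply: ler_wpM2l => //; apply: (le_trans mle).
  have := sqr_ge0 (a - p s); nra.
have : s ^+ 3 * p s ^+ 2 <= s ^+ 2.
  rewrite exprSr -mulrA -[leRHS]mulr1; apply: ler_wpM2l => //; exact: sqr_ge0.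
by nra.
Qed.

(** A difference of squares: the positive part is 1-Lipschitz, the sum of the two positive parts is
    at most [2 (A + p s)], and [s p(s) <= 1] because [(s p)^2 = s (s p^2)]. One factor [s] is spent
    on this and [s ^+ 2] remains. *)
Lemma vkernel_lip a b s x y : 0 <= a <= A -> 0 <= b <= A -> 0 <= s <= 1 ->
  0 <= x -> 0 <= y ->
  `|vkernel a s x - vkernel b s y| <= (A + 1) * s ^+ 2 * (`|a - b| + `|x - y|).
Proof.
move=> /andP[a0 aA] /andP[b0 bA] /andP[].
rewrite le_eqVlt => /predU1P[<- _ _ _|s0 s1 x0 y0].
  by rewrite !vkernel0 subrr normr0 expr0n/= mulr0 mul0r.
have ps0 : 0 <= p s by apply: p_ge0; rewrite s0.
have ps1 : s * p s ^+ 2 <= 1 by apply: p_le; rewrite s0.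
have sp1 : s * p s <= 1.
  rewrite -(@ler_sqr _ _ 1) ?nnegrE ?mulr_ge0 ?(ltW s0)//.
  rewrite exprMn expr1n; apply: le_trans ps1.
  by apply: ler_wpM2r; [exact: sqr_ge0|rewrite expr2 ger_pMl].
rewrite /vkernel.
set m := Num.max _ _; set n := Num.max _ _.
have m0 : 0 <= m by rewrite /m le_max lexx orbT.
have n0 : 0 <= n by rewrite /n le_max lexx orbT.
have ma : m <= A + p s by rewrite /m ge_max; lra.
have nb : n <= A + p s by rewrite /n ge_max; lra.
have mn : `|m - n| <= `|a - b| + `|x - y|.
  apply: (@le_trans _ _ `|(a + p s - x) - (b + p s - y)|).
    move: (a + p s - x) (b + p s - y) @m @n {m0 n0 ma nb} => u v /=.
    have := ler_norm (u - v); have := ler_norm (v - u); rewrite (distrC v u).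
    by case: (leP u 0) => ?; case: (leP v 0) => ? ? ?; rewrite ler_norml; apply/andP; split; lra.
  apply: le_trans (ler_normB _ _); rewrite le_eqVlt; apply/orP; left; apply/eqP.
  by congr `|_|; ring.
have -> : s ^+ 3 * m ^+ 2 / 2 - s ^+ 3 * n ^+ 2 / 2 =
   (m - n) * (s ^+ 2 * (s * (m + n) / 2)) by field.
rewrite normrM mulrC; apply: ler_pM => //.
have s2 : 0 <= s ^+ 2 by exact: sqr_ge0.
rewrite ger0_norm; last by rewrite !mulr_ge0 ?addr_ge0 ?invr_ge0 // ltW.
rewrite mulrC; apply: ler_wpM2r => //.
have : s * (m + n) <= s * (2 * A + 2 * p s) by apply: ler_wpM2l; lra.
by nra.
Qed.

Lemma vkernel_measurable a D : measurable_fun `[0 : R, 1] D ->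
  measurable_fun `[0 : R, 1] (fun s => vkernel a s (D s)).
Proof.
move=> mD; have mp := continuous_oo_measurable p_cont.
apply: measurable_funM => //; apply: measurable_funM.
  exact: (@measurable_funX _ _ _ _ _ 3).
apply: measurable_funX; apply: measurable_maxr => //.
by apply: measurable_funB => //; apply: measurable_funD.
Qed.

Lemma vkernel_integrable a D : 0 <= a -> nonneg_mfun D ->
  mu.-integrable `[0 : R, 1] (EFin \o (fun s => vkernel a s (D s))).
Proof.
move=> a0 [mD D0]; apply: (@bounded_itv_integrable _ _ _ _ (a ^+ 2 + 1)).
  exact: vkernel_measurable.
move=> t; rewrite in_itv/= => t01; have /andP[t0 t1] := t01.
rewrite ger0_norm ?vkernel_ge0//; apply: (le_trans (vkernel_le _ _ _)) => //.
  exact: D0.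
apply: lerD; last by rewrite exprn_ile1.
by rewrite ler_piMr ?sqr_ge0 ?exprn_ile1.
Qed.

Lemma vinner_ge0 a D t : 0 <= t -> 0 <= vinner a D t.
Proof.
move=> t0; apply: Rintegral_ge0 => s /=; rewrite in_itv/= => /andP[s0 _].
exact: vkernel_ge0.
Qed.

Lemma monomial_integrable (c r : R) n :
  mu.-integrable `[0, r] (EFin \o (fun s : R => c * s ^+ n)).
Proof. by apply: continuous_itv_integrable => x _; isdc. Qed.

Lemma vinner_le a D t : 0 <= a -> nonneg_mfun D -> 0 <= t <= 1 ->
  vinner a D t <= a ^+ 2 * t ^+ 4 / 4 + t ^+ 3 / 3.
Proof.
move=> a0 XD /andP[t0 t1]; have [_ D0] := XD.
apply: (@le_trans _ _ (\int[mu]_(s in `[0, t]) (a ^+ 2 * s ^+ 3 + 1 * s ^+ 2))).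
  apply: le_Rintegral => //.
  - exact: (integrable_itvS (lexx 0) t1 (vkernel_integrable a0 XD)).
  - by apply: integrable_itvD; exact: monomial_integrable.
  - move=> s /=; rewrite in_itv/= mul1r => /andP[s0 st].
    have s01 : 0 <= s <= 1 by rewrite s0 (le_trans st).
    by apply: vkernel_le => //; exact: D0.
rewrite RintegralD //; try exact: monomial_integrable.
by rewrite !Rintegral_monomial // mul1r.
Qed.

Lemma vinner_div_ge0 a D t : 0 <= t -> 0 <= vinner a D t / t ^+ 3.
Proof. by move=> t0; apply: divr_ge0; [exact: vinner_ge0|exact: exprn_ge0]. Qed.

Lemma vinner_div_le a D t : 0 <= a -> nonneg_mfun D -> 0 <= t <= 1 ->
  vinner a D t / t ^+ 3 <= a ^+ 2 / 4 * t + 1 / 3.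
Proof.
move=> a0 XD /andP[]; rewrite le_eqVlt => /predU1P[<- _|t0 t1].
  (* At 0 the quotient is 0, since [0^-1 = 0]. *)
  by rewrite expr0n/= invr0 !mulr0 add0r divr_ge0.
rewrite ler_pdivrMr ?exprn_gt0//.
apply: le_trans (vinner_le a0 XD _) _; first by rewrite t1 ltW.
by rewrite le_eqVlt; apply/orP; left; apply/eqP; field.
Qed.

Lemma vinner_continuous a D : 0 <= a -> nonneg_mfun D ->
  {in `]0, 1[, continuous (vinner a D)}.
Proof.
by move=> a0 XD; apply: Rintegral_itv_continuous; exact: vkernel_integrable.
Qed.

Lemma vinner_div_continuous a D : 0 <= a -> nonneg_mfun D ->
  {in `]0, 1[, continuous (fun t => vinner a D t / t ^+ 3)}.
Proof.
move=> a0 XD x x01; have /andP[x0 _] : 0 < x < 1 by move: x01; rewrite in_itv.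
apply: cvgM; first exact: vinner_continuous.
by apply: (@isd_continuous _ (fun y => y ^- 3)); isd; rewrite ?expf_neq0 ?gt_eqF.
Qed.

Lemma vinner_div_integrable a D : 0 <= a -> nonneg_mfun D ->
  mu.-integrable `[0 : R, 1] (EFin \o (fun t => vinner a D t / t ^+ 3)).
Proof.
move=> a0 XD; apply: (@bounded_itv_integrable _ _ _ _ (a ^+ 2 / 4 + 1 / 3)).
  by apply: continuous_oo_measurable; exact: vinner_div_continuous.
move=> t; rewrite in_itv/= => t01; have /andP[t0 t1] := t01.
rewrite ger0_norm ?vinner_div_ge0//; apply: (le_trans (vinner_div_le _ _ _)) => //.
by rewrite lerD2r ler_piMr // divr_ge0 // sqr_ge0.
Qed.

Lemma volterra_ge0 a D r : 0 <= r -> 0 <= volterra a D r.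
Proof.
move=> r0; apply: Rintegral_ge0 => t /=; rewrite in_itv/= => /andP[t0 _].
exact: vinner_div_ge0.
Qed.

Lemma volterra_le a D r : 0 <= a -> nonneg_mfun D -> 0 <= r <= 1 ->
  volterra a D r <= a ^+ 2 * r ^+ 2 / 8 + r / 3.
Proof.
move=> a0 XD /andP[r0 r1].
apply: (@le_trans _ _ (\int[mu]_(t in `[0, r]) (a ^+ 2 / 4 * t ^+ 1 + 1 / 3 * t ^+ 0))).
  apply: le_Rintegral => //.
  - exact: (integrable_itvS (lexx 0) r1 (vinner_div_integrable a0 XD)).
  - by apply: integrable_itvD; exact: monomial_integrable.
  - move=> t /=; rewrite in_itv/= expr1 expr0 mulr1 => /andP[t0 tr].
    by apply: vinner_div_le => //; rewrite t0 (le_trans tr).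
rewrite RintegralD //; try exact: monomial_integrable.
by rewrite !Rintegral_monomial // le_eqVlt; apply/orP; left; apply/eqP; field.
Qed.

Lemma volterra_continuous a D : 0 <= a -> nonneg_mfun D ->
  {in `]0, 1[, continuous (volterra a D)}.
Proof.
by move=> a0 XD; apply: Rintegral_itv_continuous; exact: vinner_div_integrable.
Qed.

Lemma volterra_nonneg_mfun a D : 0 <= a -> nonneg_mfun D ->
  nonneg_mfun (volterra a D).
Proof.
move=> a0 XD; split.
  by apply: continuous_oo_measurable; exact: volterra_continuous.
by move=> s /andP[s0 _]; exact: volterra_ge0.
Qed.

(** The weight is [exp (K r)] with [K = A + 1], the Lipschitz constant of the kernel. The inner
    integral of [K s^2] contributes [K t^3 / 3], the cube is divided out, and integrating
    [K exp (K t)] removes [K]. Hence the contraction factor is [1 / 3] for every [A]. *)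
Lemma volterra_lip a b D E C r : 0 <= a <= A -> 0 <= b <= A ->
  nonneg_mfun D -> nonneg_mfun E -> 0 <= C ->
  (forall s, 0 <= s <= 1 -> `|D s - E s| <= C * expR ((A + 1) * s)) ->
  0 <= r <= 1 ->
  `|volterra a D r - volterra b E r| <= (`|a - b| + C) / 3 * expR ((A + 1) * r).
Proof.
move=> aA bA XD XE C0 DE /andP[r0 r1].
have [a0 _] := andP aA; have [b0 _] := andP bA.
have [_ D0] := XD; have [_ E0] := XE.
set K := A + 1; have K0 : 0 < K by rewrite /K; lra.
set c := `|a - b| + C; have c0 : 0 <= c by rewrite addr_ge0.
have inner t : 0 <= t <= 1 ->
    `|vinner a D t - vinner b E t| <= K * c * expR (K * t) * t ^+ 3 / 3.
  move=> /andP[t0 t1]; rewrite /vinner -RintegralB //; last 2 first.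
  - exact: (integrable_itvS (lexx 0) t1 (vkernel_integrable a0 XD)).
  - exact: (integrable_itvS (lexx 0) t1 (vkernel_integrable b0 XE)).
  rewrite -(@Rintegral_monomial _ _ 2) //; apply: ler_norm_Rintegral_itv.
  - apply: integrable_itvB.
      exact: (integrable_itvS (lexx 0) t1 (vkernel_integrable a0 XD)).
    exact: (integrable_itvS (lexx 0) t1 (vkernel_integrable b0 XE)).
  - exact: monomial_integrable.
  - move=> s; rewrite in_itv/= => /andP[s0 st].
    have s01 : 0 <= s <= 1 by rewrite s0 (le_trans st).
    apply: (le_trans (vkernel_lip aA bA s01 (D0 _ s01) (E0 _ s01))).
    have -> : K * c * expR (K * t) * s ^+ 2 = K * s ^+ 2 * (c * expR (K * t)) by ring.
    apply: ler_wpM2l; first by rewrite mulr_ge0 ?sqr_ge0// ltW.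
    have e1 : 1 <= expR (K * t).
      by rewrite -expR0 ler_expR mulr_ge0 // ltW.
    have e2 : expR (K * s) <= expR (K * t) by rewrite ler_expR ler_wpM2l // ltW.
    rewrite /c mulrDl; apply: lerD; first by rewrite ler_peMr.
    by apply: (le_trans (DE _ s01)); apply: ler_wpM2l.
rewrite /volterra -RintegralB //; last 2 first.
- exact: (integrable_itvS (lexx 0) r1 (vinner_div_integrable a0 XD)).
- exact: (integrable_itvS (lexx 0) r1 (vinner_div_integrable b0 XE)).
apply: (@le_trans _ _ (\int[mu]_(t in `[0, r]) (c / 3 * (K * expR (K * t))))).
  apply: ler_norm_Rintegral_itv.
  - apply: integrable_itvB.
      exact: (integrable_itvS (lexx 0) r1 (vinner_div_integrable a0 XD)).
    exact: (integrable_itvS (lexx 0) r1 (vinner_div_integrable b0 XE)).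
  - by apply: continuous_itv_integrable => x _; isdc.
  - move=> t; rewrite in_itv/= => /andP[]; rewrite le_eqVlt => /predU1P[<- _|t0 tr].
      rewrite expr0n/= invr0 !mulr0 subrr normr0.
      by rewrite !mulr_ge0 ?expR_ge0 // ltW.
    rewrite -mulrBl normrM [X in _ * X]gtr0_norm ?invr_gt0 ?exprn_gt0//.
    rewrite ler_pdivrMr ?exprn_gt0//.
    apply: (le_trans (inner _ _)); first by rewrite ltW // (le_trans tr).
    by rewrite le_eqVlt; apply/orP; left; apply/eqP; field.
apply: (@le_trans _ _ (c / 3 * (expR (K * r) - 1))).
  rewrite le_eqVlt; apply/orP; left; apply/eqP.
  refine (@Rintegral_FTC2 _ (fun t => c / 3 * expR (K * t)) _ _ _ _ r0 _ _ _).
  - by move=> x _; isd; ring.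
  - by move=> x _; isdc.
  - by rewrite mulr0 expR0; ring.
by apply: ler_wpM2l; [rewrite divr_ge0|lra].
Qed.

End Volterra.

(** * Sequences whose steps decrease geometrically *)

Section GeometricConvergence.
Context {R : realType}.
Implicit Types (u : R^nat) (c x : R).

Lemma le0_geometric x c : (forall n, x <= c * (1 / 3) ^+ n) -> x <= 0.
Proof.
move=> xc; have q1 : `|1 / 3 : R| < 1 by rewrite gtr0_norm; lra.
by apply: (@cvgr_to_ge _ _ _ _ _ _ _ (cvg_geometric c q1)); near=> n; exact: xc.
Unshelve. all: by end_near. Qed.

Lemma geometric_step_cvg u c :
  (forall n, `|u n.+1 - u n| <= c * (1 / 3) ^+ n) ->
  cvgn u /\ forall n, `|limn u - u n| <= 3 / 2 * c * (1 / 3) ^+ n.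
Proof.
move=> uc.
have c0 : 0 <= c by have := uc 0%N; rewrite expr0 mulr1; apply: le_trans.
have cu : cvgn u.
  have /normed_cvg : cvgn [normed series (telescope u)].
    apply: (@series_le_cvg _ _ (geometric c (1 / 3))).
    - by move=> n /=.
    - by move=> n /=; rewrite mulr_ge0 ?exprn_ge0 //; lra.
    - by move=> n; exact: uc.
    - by apply: is_cvg_geometric_series; rewrite gtr0_norm; lra.
  rewrite telescopeK => /cvg_ex[l ul].
  apply/cvg_ex; exists (l + u 0%N).
  have h : ([sequence u n - u 0%N]_n + (fun=> u 0%N)) n @[n --> \oo] --> l + u 0%N.
    by apply: cvgD => //; exact: cvg_cst.
  have e : [sequence u n - u 0%N]_n + (fun=> u 0%N) = u.
    by apply/funext => n; rewrite fctE /= subrK.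
  by rewrite e in h.
split=> // n.
(* The subtracted power makes the induction close: the bound is the exact partial sum of the
   geometric series. *)
have step m : `|u (n + m)%N - u n| <= 3 / 2 * c * ((1 / 3) ^+ n - (1 / 3) ^+ (n + m)).
  elim: m => [|m IH]; first by rewrite addn0 !subrr normr0 mulr0.
  rewrite addnS.
  have -> : u (n + m).+1 - u n = (u (n + m).+1 - u (n + m)%N) + (u (n + m)%N - u n) by ring.
  apply: (le_trans (ler_normD _ _)); apply: (le_trans (lerD (uc _) IH)).
  by rewrite exprS; lra.
have cv : `|u m - u n| @[m --> \oo] --> `|limn u - u n|.
  by apply: cvg_norm; apply: cvgB => //; exact: cvg_cst.
apply: (cvgr_to_le cv).
near=> m.
have nm : (n <= m)%N by near: m; exact: nbhs_infty_ge.
rewrite -(subnKC nm); apply: (le_trans (step _)).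
apply: ler_wpM2l; first by apply: mulr_ge0 => //; lra.
by rewrite gerBl exprn_ge0 //; lra.
Unshelve. all: by end_near. Qed.

End GeometricConvergence.

(** * Picard iteration and dependence on the parameter *)

Section VolterraSolution.
Context {R : realType}.
Local Notation mu := (@lebesgue_measure R).
Variables (p : R -> R) (A : R).
Hypothesis p_cont : {in `]0, 1[, continuous p}.
Hypothesis p_ge0 : forall s : R, 0 < s <= 1 -> 0 <= p s.
Hypothesis p_le : forall s : R, 0 < s <= 1 -> s * p s ^+ 2 <= 1.
Hypothesis A_ge0 : 0 <= A.
Implicit Types (a b r : R) (n : nat).

Definition picard a n : R -> R := iter n (volterra p a) (fun _ => 0).

Definition volterra_sol a r : R := limn (fun n => picard a n r).

Lemma picard_nonneg_mfun a n : 0 <= a -> nonneg_mfun (picard a n).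
Proof.
move=> a0; elim: n => [|n IH]; first by split=> // ; exact: measurable_cst.
exact: volterra_nonneg_mfun.
Qed.

Lemma picard_step a n r : 0 <= a <= A -> 0 <= r <= 1 ->
  `|picard a n.+1 r - picard a n r| <=
    (A ^+ 2 + 1) * (1 / 3) ^+ n * expR ((A + 1) * r).
Proof.
move=> aA; have /andP[a0 aA'] := aA.
elim: n r => [|n IH] r r01.
  rewrite /= subr0 expr0 mulr1 ger0_norm; last first.
    by apply: volterra_ge0; case/andP: r01.
  have /andP[r0 r1] := r01.
  apply: (le_trans (volterra_le p_cont p_ge0 p_le a0 (picard_nonneg_mfun 0 a0) r01)).
  apply: (@le_trans _ _ (A ^+ 2 + 1)).
    have : a ^+ 2 <= A ^+ 2 by rewrite ler_sqr.
    have : a ^+ 2 * r ^+ 2 <= a ^+ 2.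
      by rewrite ler_piMr ?sqr_ge0 ?exprn_ile1.
    have := sqr_ge0 a; lra.
  rewrite ler_peMr ?addr_ge0 ?sqr_ge0 // -expR0 ler_expR.
  by rewrite mulr_ge0 // addr_ge0.
have C0 : 0 <= (A ^+ 2 + 1) * (1 / 3) ^+ n.
  by rewrite mulr_ge0 ?addr_ge0 ?sqr_ge0 ?exprn_ge0 //; lra.
apply: (le_trans (volterra_lip p_cont p_ge0 p_le aA aA (picard_nonneg_mfun n.+1 a0)
  (picard_nonneg_mfun n a0) C0 IH r01)).
rewrite subrr normr0 add0r [_ ^+ n.+1]exprS.
by rewrite le_eqVlt; apply/orP; left; apply/eqP; field.
Qed.

Lemma picard_cvg a r : 0 <= a <= A -> 0 <= r <= 1 ->
  picard a n r @[n --> \oo] --> volterra_sol a r.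
Proof.
move=> aA r01.
have [] := @geometric_step_cvg _ (fun n => picard a n r)
  ((A ^+ 2 + 1) * expR ((A + 1) * r)) => //.
by move=> n; rewrite mulrAC; exact: picard_step.
Qed.

Lemma picard_error a n r : 0 <= a <= A -> 0 <= r <= 1 ->
  `|volterra_sol a r - picard a n r| <=
    3 / 2 * (A ^+ 2 + 1) * (1 / 3) ^+ n * expR ((A + 1) * r).
Proof.
move=> aA r01.
have [_ /(_ n)] := @geometric_step_cvg _ (fun n => picard a n r)
  ((A ^+ 2 + 1) * expR ((A + 1) * r)) (fun n => ltac:(rewrite mulrAC; exact: picard_step)).
by move=> h; apply: (le_trans h); rewrite le_eqVlt; apply/orP; left; apply/eqP; ring.
Qed.

Lemma volterra_sol_nonneg_mfun a : 0 <= a <= A -> nonneg_mfun (volterra_sol a).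
Proof.
move=> aA; have /andP[a0 _] := aA; split.
  apply: (@measurable_fun_cvg _ _ _ _ (picard a)).
    by move=> n; have [] := picard_nonneg_mfun n a0.
  by move=> x /=; rewrite in_itv/=; exact: picard_cvg.
move=> r r01; apply: (cvgr_to_ge (picard_cvg aA r01)).
by near=> n; have [_ ->] := picard_nonneg_mfun n a0.
Unshelve. all: by end_near. Qed.

(** Both sides are within a multiple of [(1 / 3) ^+ n] of the iterate [n.+1], one by the contraction
    estimate and one by the error bound. No limit has to be taken under the integral. *)
Lemma volterra_solE a r : 0 <= a <= A -> 0 <= r <= 1 ->
  volterra p a (volterra_sol a) r = volterra_sol a r.
Proof.
move=> aA r01; have /andP[a0 _] := aA.
apply/eqP; rewrite -subr_eq0 -normr_le0.
set K := expR ((A + 1) * r).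
apply: (@le0_geometric _ _ ((A ^+ 2 + 1) * K)) => n.
have C0 : 0 <= 3 / 2 * (A ^+ 2 + 1) * (1 / 3) ^+ n.
  by rewrite !mulr_ge0 ?addr_ge0 ?sqr_ge0 ?exprn_ge0 //; lra.
have h1 := volterra_lip p_cont p_ge0 p_le aA aA (volterra_sol_nonneg_mfun aA)
  (picard_nonneg_mfun n a0) C0 (fun s s01 => picard_error n aA s01) r01.
have h2 := picard_error n.+1 aA r01.
apply: (le_trans (ler_distD (picard a n.+1 r) _ _)).
rewrite (distrC (picard a n.+1 r)).
apply: (le_trans (lerD h1 h2)).
rewrite subrr normr0 add0r -/K [_ ^+ n.+1]exprS.
by rewrite le_eqVlt; apply/orP; left; apply/eqP; field.
Qed.

(** The constant [C = |a - b|] reproduces itself, since [(|a - b| + C) / 3 <= C]. *)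
Lemma picard_lip a b n r : 0 <= a <= A -> 0 <= b <= A -> 0 <= r <= 1 ->
  `|picard a n r - picard b n r| <= `|a - b| * expR ((A + 1) * r).
Proof.
move=> aA bA; have /andP[a0 _] := aA; have /andP[b0 _] := bA.
elim: n r => [|n IH] r r01; first by rewrite /= subrr normr0 mulr_ge0 ?expR_ge0.
have := volterra_lip p_cont p_ge0 p_le aA bA (picard_nonneg_mfun n a0)
  (picard_nonneg_mfun n b0) (normr_ge0 _) IH r01.
move=> h; apply: (le_trans h); rewrite ler_pM2r ?expR_gt0//.
by have := normr_ge0 (a - b); lra.
Qed.

Lemma volterra_sol_lip a b r : 0 <= a <= A -> 0 <= b <= A -> 0 <= r <= 1 ->
  `|volterra_sol a r - volterra_sol b r| <= `|a - b| * expR ((A + 1) * r).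
Proof.
move=> aA bA r01.
have cv : `|picard a n r - picard b n r| @[n --> \oo] -->
    `|volterra_sol a r - volterra_sol b r|.
  by apply: cvg_norm; apply: cvgB; exact: picard_cvg.
by apply: (cvgr_to_le cv); near=> n; exact: picard_lip.
Unshelve. all: by end_near. Qed.

End VolterraSolution.

(** * The shooting function and its two roots *)

Section Shooting.
Context {R : realType}.
Local Notation mu := (@lebesgue_measure R).
Variable p : R -> R.
Hypothesis p_cont : {in `]0, 1[, continuous p}.
Hypothesis p_ge0 : forall s : R, 0 < s <= 1 -> 0 <= p s.
Hypothesis p_le : forall s : R, 0 < s <= 1 -> s * p s ^+ 2 <= 1.
Hypothesis p_nincr : forall r s : R, 0 < r -> r <= s -> s <= 1 -> p s <= p r.
Hypothesis p1 : p 1 = 0.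
Implicit Types (a b r s t : R).

Local Notation D := (volterra_sol p).
Local Notation H a := (vinner p a (D a)).

Definition shoot a r : R := a + p r - D a r.

Lemma volterra_sol_mfun a : 0 <= a -> nonneg_mfun (D a).
Proof.
by move=> a0; apply: (@volterra_sol_nonneg_mfun _ p a) => //; rewrite a0 lexx.
Qed.

Lemma volterra_fix a r : 0 <= a -> 0 <= r <= 1 -> volterra p a (D a) r = D a r.
Proof. by move=> a0; apply: (@volterra_solE _ p a) => //; rewrite a0 lexx. Qed.

Lemma volterra_sol_split a r s : 0 <= a -> 0 <= r -> r <= s -> s <= 1 ->
  D a s = D a r + \int[mu]_(t in `[r, s]) (H a t / t ^+ 3).
Proof.
move=> a0 r0 rs s1; have s0 := le_trans r0 rs; have r1 := le_trans rs s1.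
rewrite -(volterra_fix a0 (introT andP (conj s0 s1))).
rewrite -(volterra_fix a0 (introT andP (conj r0 r1))).
apply: Rintegral_itv_split; first by rewrite r0.
apply: (integrable_itvS (lexx 0) s1); apply: vinner_div_integrable => //.
exact: volterra_sol_mfun.
Qed.

Lemma volterra_sol_bound a r : 0 <= a -> 0 <= r <= 1 ->
  D a r <= a ^+ 2 * r ^+ 2 / 8 + r / 3.
Proof.
move=> a0 r01; rewrite -volterra_fix //.
by apply: volterra_le => //; exact: volterra_sol_mfun.
Qed.

Lemma shoot_nincr a r s : 0 <= a -> 0 < r -> r <= s -> s <= 1 ->
  shoot a s <= shoot a r.
Proof.
move=> a0 r0 rs s1; rewrite /shoot (@volterra_sol_split a r s) ?(ltW r0)//.
have : 0 <= \int[mu]_(t in `[r, s]) (H a t / t ^+ 3).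
  apply: Rintegral_ge0 => t /=; rewrite in_itv/= => /andP[rt _].
  by apply: vinner_div_ge0; rewrite (le_trans (ltW r0)).
by have := p_nincr r0 rs s1; lra.
Qed.

Lemma shoot_le a r : 0 <= a -> 0 < r <= 1 -> shoot a r <= a + p r.
Proof.
move=> a0 /andP[r0 r1]; rewrite /shoot gerBl.
by have [_ ->] := volterra_sol_mfun a0; rewrite // ltW.
Qed.

Lemma vinner_nondecreasing a r s : 0 <= a -> 0 <= r -> r <= s -> s <= 1 ->
  H a s = H a r + \int[mu]_(t in `[r, s]) vkernel p a t (D a t).
Proof.
move=> a0 r0 rs s1; apply: Rintegral_itv_split; first by rewrite r0.
apply: (integrable_itvS (lexx 0) s1); apply: vkernel_integrable => //.
exact: volterra_sol_mfun.
Qed.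

Lemma vinner_homo a r s : 0 <= a -> 0 <= r -> r <= s -> s <= 1 -> H a r <= H a s.
Proof.
move=> a0 r0 rs s1; rewrite (@vinner_nondecreasing a r s) // lerDl.
apply: Rintegral_ge0 => t /=; rewrite in_itv/= => /andP[rt _].
by apply: vkernel_ge0; rewrite (le_trans r0).
Qed.

Lemma Rintegral_inv_cube r : 0 < r <= 1 ->
  \int[mu]_(t in `[r, 1]) (t ^- 3) = (r ^- 2 - 1) / 2.
Proof.
move=> /andP[r0 r1].
have pos x : r <= x <= 1 -> x != 0 by move=> /andP[rx _]; rewrite gt_eqF // (lt_le_trans r0).
refine (@Rintegral_FTC2 _ (fun t => - (t ^- 2 / 2)) _ _ _ _ r1 _ _ _).
- by move=> x /pos x0; isd; rewrite ?expf_neq0 //; field.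
- by move=> x /pos x0; isdc; rewrite expf_neq0.
- by rewrite expr1n invr1; lra.
Qed.

(** Integrating back from 1, [shoot a r] is [shoot a 1 + p r] plus the integral of [H a t / t ^+ 3]
    over [[r, 1]]. The first two terms are nonnegative and [H a] is nondecreasing, so its value at
    [r] can be pulled out. *)
Lemma shoot_lower a r : 0 <= a -> 0 <= shoot a 1 -> 0 < r <= 1 ->
  H a r * ((r ^- 2 - 1) / 2) <= shoot a r.
Proof.
move=> a0 sh1 /andP[r0 r1].
have -> : shoot a r = shoot a 1 + p r + \int[mu]_(t in `[r, 1]) (H a t / t ^+ 3).
  by rewrite /shoot p1 (@volterra_sol_split a r 1) ?(ltW r0)//; ring.
rewrite -Rintegral_inv_cube ?r0 // -RintegralZl //; last first.
  apply: continuous_itv_integrable => x /andP[rx _].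
  by isdc; rewrite expf_neq0 // gt_eqF // (lt_le_trans r0).
suff h : \int[mu]_(t in `[r, 1]) (H a r * t ^- 3) <=
       \int[mu]_(t in `[r, 1]) (H a t / t ^+ 3).
  apply: (le_trans h); rewrite lerDr; apply: addr_ge0 => //.
  by apply: p_ge0; rewrite r0.
apply: le_Rintegral => //.
  - apply: continuous_itv_integrable => x /andP[rx _].
    by isdc; rewrite expf_neq0 // gt_eqF // (lt_le_trans r0).
  - apply: (@integrable_itvS _ _ 0 1) => //; first exact: ltW.
    by apply: vinner_div_integrable => //; exact: volterra_sol_mfun.
  - move=> t /=; rewrite in_itv/= => /andP[rt t1]; apply: ler_wpM2r.
      by rewrite invr_ge0 exprn_ge0 // (le_trans (ltW r0)).
    by apply: vinner_homo => //; exact: ltW.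
Qed.

Lemma vkernel_shoot a s : 0 <= shoot a s ->
  vkernel p a s (D a s) = s ^+ 3 * shoot a s ^+ 2 / 2.
Proof. by move=> s0; rewrite /vkernel -/(shoot a s) max_l. Qed.

(** As [shoot a] is nonincreasing, it is at least [m] on all of []0, r]], and the truncation is
    inactive there. *)
Lemma vinner_ge_cst a m r : 0 <= a -> 0 < r <= 1 -> 0 <= m -> m <= shoot a r ->
  m ^+ 2 * r ^+ 4 / 8 <= H a r.
Proof.
move=> a0 /andP[r0 r1] m0 mr.
have -> : m ^+ 2 * r ^+ 4 / 8 = (m ^+ 2 / 2) * r ^+ 4 / 4%:R by field.
rewrite -(@Rintegral_monomial _ _ 3 r (ltW r0)).
apply: le_Rintegral => //; first exact: monomial_integrable.
  apply: (integrable_itvS (lexx 0) r1); apply: vkernel_integrable => //.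
  exact: volterra_sol_mfun.
move=> t /=; rewrite in_itv/= => /andP[]; rewrite le_eqVlt => /predU1P[<- _|t0 tr].
  by rewrite vkernel0 expr0n/= mulr0.
have mt : m <= shoot a t by apply: (le_trans mr); exact: shoot_nincr.
have mt2 : m ^+ 2 <= shoot a t ^+ 2 by rewrite ler_sqr ?nnegrE ?(le_trans m0).
rewrite vkernel_shoot ?(le_trans m0)//.
have := ler_wpM2l (ltW (exprn_gt0 3 t0)) mt2; lra.
Qed.

(** A lower bound [c / t^2] turns the kernel into at least [c^2 / (2 t)], whose integral is
    logarithmic. This is the growth that beats any fixed bound when [r] tends to 0. *)
Lemma vinner_ge_log a c r s : 0 <= a -> 0 < r -> r <= s -> s <= 1 -> 0 <= c ->
  (forall t, r <= t <= s -> c / t ^+ 2 <= shoot a t) ->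
  c ^+ 2 / 2 * (ln s - ln r) <= H a s.
Proof.
move=> a0 r0 rs s1 c0 csh.
have pos x : r <= x <= s -> 0 < x by move=> /andP[rx _]; rewrite (lt_le_trans r0).
have -> : c ^+ 2 / 2 * (ln s - ln r) = \int[mu]_(t in `[r, s]) (c ^+ 2 / 2 / t).
  symmetry; refine (@Rintegral_FTC2 _ (fun t => c ^+ 2 / 2 * ln t) _ _ _ _ rs _ _ _).
  - by move=> x /pos x0; isd => //; field; rewrite gt_eqF.
  - by move=> x /pos x0; isdc; rewrite gt_eqF.
  - by rewrite /=; ring.
rewrite (@vinner_nondecreasing a r s) ?(ltW r0) // -[leLHS]add0r.
apply: lerD; first by apply: vinner_ge0; exact: ltW.
apply: le_Rintegral => //.
- by apply: continuous_itv_integrable => x /pos x0; isdc; rewrite gt_eqF.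
- apply: (@integrable_itvS _ _ 0 1) => //; first exact: ltW.
  by apply: vkernel_integrable => //; exact: volterra_sol_mfun.
- move=> t /=; rewrite in_itv/= => trs; have t0 := pos _ trs.
  have ct := csh _ trs.
  have c1 : 0 <= c / t ^+ 2 by apply: divr_ge0 => //; rewrite exprn_ge0 // ltW.
  rewrite vkernel_shoot ?(le_trans c1)//.
  have ct2 : (c / t ^+ 2) ^+ 2 <= shoot a t ^+ 2 by rewrite ler_sqr ?nnegrE ?(le_trans c1).
  have := ler_wpM2l (ltW (exprn_gt0 3 t0)) ct2.
  have -> : t ^+ 3 * (c / t ^+ 2) ^+ 2 = c ^+ 2 / t by field; rewrite gt_eqF.
  have -> : c ^+ 2 / 2 / t = c ^+ 2 / t / 2 by field; rewrite gt_eqF.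
  by move=> h; apply: ler_wpM2r.
Qed.

(* If the solution stayed positive up to 1, [m := shoot a (1 / 2)] would satisfy
   [m >= 3 / 2 * H a (1 / 2) >= 3 / 256 * m ^+ 2], against the logarithmic growth
   of [H a] on [r0, 1 / 2]. *)
Lemma shoot_large r0 : 0 < r0 <= 1 / 2 ->
  200 < (1 / 100) ^+ 2 * (ln (1 / 2) - ln r0) -> shoot (r0 ^- 2) 1 <= 0.
Proof.
have half : 0 < (1 / 2 : R) <= 1.
  by apply/andP; split; lra.
have c0 : (0 : R) <= 1 / 100 by lra.
(* This scaling gives [a ^+ 2 * r0 ^+ 2 = a], so up to radius [r0] the function [D a] takes away at
   most [a / 8 + r0 / 3]. Thus [shoot a r0 >= a / 2], and [H a r0] is bounded below by a constant
   independent of [r0]. *)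
move=> /andP[r0_gt0 r0_le] big; set a := r0 ^- 2.
have r2 : 0 < r0 ^+ 2 by rewrite exprn_gt0.
have ar : a * r0 ^+ 2 = 1 by rewrite /a mulVf ?gt_eqF.
have a4 : 4 <= a.
  by rewrite -[a]mul1r ler_pdivlMr //; have := ler_wpM2l (ltW r0_gt0) r0_le; nra.
have a0 : 0 <= a by lra.
have r01 : r0 <= 1 by lra.
rewrite leNgt; apply/negP => sh1.
have sh_ge : a / 2 <= shoot a r0.
  have := volterra_sol_bound a0 (introT andP (conj (ltW r0_gt0) r01)).
  have -> : a ^+ 2 * r0 ^+ 2 = a by rewrite expr2 -mulrA ar mulr1.
  rewrite /shoot; have := p_ge0 (introT andP (conj r0_gt0 r01)); lra.
have Hr0 : 1 / 32 <= H a r0.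
  apply: le_trans (vinner_ge_cst a0 _ _ sh_ge); rewrite ?r0_gt0 //; last by lra.
  have -> : (a / 2) ^+ 2 * r0 ^+ 4 / 8 = (a * r0 ^+ 2) ^+ 2 / 32 by field.
  by rewrite ar expr1n.
(* For [t <= 1 / 2] one has [t^-2 - 1 >= (3 / 4) t^-2], so [shoot_lower] gives the coefficient
   [3 / 256], which exceeds [1 / 100]. *)
have shq t : r0 <= t <= 1 / 2 -> 1 / 100 / t ^+ 2 <= shoot a t.
  move=> /andP[r0t t2]; have t0 := lt_le_trans r0_gt0 r0t.
  have t1 : t <= 1 by lra.
  apply: (le_trans _ (shoot_lower a0 (ltW sh1) (introT andP (conj t0 t1)))).
  have Ht : 1 / 32 <= H a t by apply: (le_trans Hr0); apply: vinner_homo => //; exact: ltW.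
  have tt : 4 <= t ^- 2.
    rewrite -[t ^- 2]mul1r ler_pdivlMr ?exprn_gt0//.
    by have := ler_wpM2l (ltW t0) t2; nra.
  apply: (@le_trans _ _ (1 / 32 * ((t ^- 2 - 1) / 2))); first by lra.
  by apply: ler_wpM2r => //; lra.
have Hlog := vinner_ge_log a0 r0_gt0 r0_le (proj2 (andP half)) c0 shq.
have shH := shoot_lower a0 (ltW sh1) half.
have sh0 : 0 <= shoot a (1 / 2).
  by apply: (le_trans (ltW sh1)); apply: shoot_nincr => //; case/andP: half.
have Hq := vinner_ge_cst a0 half sh0 (lexx _).
have e4 : (1 / 2) ^- 2 = 4 :> R by field.
have e16 : (1 / 2) ^+ 4 = 1 / 16 :> R by field.
rewrite e4 in shH; rewrite e16 in Hq.
move: (H a (1 / 2)) (shoot a (1 / 2)) (ln (1 / 2) - ln r0) shH Hq sh0 big Hlog.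
move=> h m l shH Hq sh0 big Hlog {shq sh_ge Hr0 sh1 e4 e16 c0 half}.
(* The threshold 200 makes [h > 100], hence [m >= 150], while [m^2 / 128 <= h <= 2 m / 3] would
   force [m <= 256 / 3]. *)
have m150 : 150 <= m by lra.
have := ler_wpM2r sh0 m150; rewrite -expr2; lra.
Qed.

Lemma shoot_at0 : shoot 0 1 <= 0.
Proof.
have [_ /(_ 1)] := @volterra_sol_mfun 0 (lexx 0).
by rewrite /shoot p1 lexx ler01 /= => /(_ isT); lra.
Qed.

Lemma shoot_at1 : 0 < shoot 1 1.
Proof.
have := @volterra_sol_bound 1 1 ler01; rewrite /shoot p1 lexx ler01 /= => /(_ isT).
by rewrite !expr1n; lra.
Qed.

Lemma shoot_continuous A : {within `[0, A], continuous (fun a => shoot a 1)}.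
Proof.
have [A0|A0] := ltP A 0.
  by rewrite set_itv_ge ?bnd_simp -?ltNge //; exact: continuous_subspace0.
apply/subspace_continuousP => a /=; rewrite in_itv/= => aA.
set C := 1 + expR (A + 1).
have C0 : 0 < C by rewrite /C addr_gt0 ?expR_gt0.
apply/cvgrPdist_le => e e0; near=> b.
have bA : 0 <= b <= A.
  by have : `[0, A]%classic b by near: b; exact: withinT.
have -> : shoot a 1 - shoot b 1 = (a - b) - (D a 1 - D b 1).
  by rewrite /shoot; move: (D a 1) (D b 1) => x y; ring.
apply: (le_trans (ler_normB _ _)).
have h : `|D a 1 - D b 1| <= `|a - b| * expR ((A + 1) * 1).
  by apply: volterra_sol_lip => //; rewrite ler01 lexx.
apply: (le_trans (lerD (lexx _) h)); rewrite mulr1.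
have -> : `|a - b| + `|a - b| * expR (A + 1) = `|a - b| * C by rewrite /C; ring.
rewrite -ler_pdivlMr //; near: b.
by apply: cvg_within; exists (e / C); [exact: divr_gt0|move=> x /ltW].
Unshelve. all: by end_near. Qed.

Lemma shoot_roots : exists a b, [/\ 0 <= a, a < b, shoot a 1 = 0 & shoot b 1 = 0].
Proof.
have [r0 r0P big] : exists2 r0 : R, 0 < r0 <= 1 / 2 &
    200 < (1 / 100) ^+ 2 * (ln (1 / 2) - ln r0).
  have : (0 : R) < 1 / 100 by lra.
  move: (1 / 100 : R) (200 : R) => c M c0.
  have [M0|M0] := ltP M 0.
    by exists (1 / 2); [lra|rewrite subrr mulr0].
  have [N N0 big] : exists2 N, 0 <= N & M < c ^+ 2 * N.
    exists ((M + 1) / c ^+ 2); first by rewrite divr_ge0 ?sqr_ge0 // addr_ge0.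
    by rewrite mulrC divfK ?expf_neq0 ?gt_eqF // ltrDl.
  (* With this [r0] the difference [ln (1 / 2) - ln r0] is exactly [N]. *)
  exists (1 / 2 * expR (- N)).
    rewrite mulr_gt0 ?expR_gt0 //= ler_piMr // -expR0 ler_expR; lra.
  rewrite (@lnM _ (1 / 2)) ?posrE ?expR_gt0 // expRK.
  by rewrite opprD addrA subrr add0r opprK.
set A := r0 ^- 2; have shA : shoot A 1 <= 0 by exact: shoot_large.
have A1 : 1 <= A.
  have /andP[r0_gt0 r0_le] := r0P.
  by rewrite -[A]mul1r ler_pdivlMr ?exprn_gt0 // mul1r exprn_ile1 ?(ltW r0_gt0) //; lra.
have A0 : 0 <= A by lra.
have [a] : exists2 a, a \in `[0, 1] & shoot a 1 = 0.
  apply: (IVT ler01).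
    by apply: continuous_subspaceW (@shoot_continuous A); apply: subset_itvl; rewrite bnd_simp.
  move: shoot_at0 (ltW shoot_at1); move: (shoot 0 1) (shoot 1 1) => x y x0 y0.
  by rewrite ge_min x0 le_max y0 orbT.
rewrite in_itv/= => /andP[a0 a1] sha.
have [b] : exists2 b, b \in `[1, A] & shoot b 1 = 0.
  apply: (IVT A1).
    by apply: continuous_subspaceW (@shoot_continuous A); apply: subset_itvr; rewrite bnd_simp.
  move: shA (ltW shoot_at1); move: (shoot A 1) (shoot 1 1) => x y x0 y0.
  by rewrite ge_min x0 orbT le_max y0.
rewrite in_itv/= => /andP[b1 bA] shb.
exists a, b; split=> //; rewrite lt_neqAle (le_trans a1 b1) andbT.
apply/eqP => ab; have a1' : a = 1 by apply/eqP; rewrite eq_le a1 ab.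
by have := shoot_at1; rewrite a1' in sha; rewrite sha ltxx.
Qed.

End Shooting.

(** * The contribution of [f] and its singularity at 0 *)

Section Forcing.
Context {R : realType}.
Local Notation mu := (@lebesgue_measure R).
Variable f : R -> R.
Hypothesis f_L1 : mu.-integrable `[0, 1] (fun r : R => (f r * r)%:E).
Hypothesis f_ge0 : {ae mu, forall r : R, r \in `[0, 1] -> 0 <= f r}.
Implicit Types (r s t : R).

Definition mass r : R := \int[mu]_(t in `[0, r]) (f t * t).

Definition moment r : R := \int[mu]_(t in `[0, r]) (t * mass t).

Definition potential r : R := \int[mu]_(t in `[r, 1]) (moment t / t ^+ 3).

Lemma mass_split r s : 0 <= r -> r <= s -> s <= 1 ->
  mass s = mass r + \int[mu]_(t in `[r, s]) (f t * t).
Proof.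
move=> r0 rs s1; apply: Rintegral_itv_split; first by rewrite r0.
exact: (integrable_itvS (lexx 0) s1 f_L1).
Qed.

(** Since [f] is nonnegative only almost everywhere, the integrand is first replaced by its maximum
    with 0, which changes nothing in the integral. *)
Lemma mass_homo r s : 0 <= r -> r <= s -> s <= 1 -> mass r <= mass s.
Proof.
move=> r0 rs s1; rewrite (mass_split r0 rs s1) lerDl.
have fi : mu.-integrable `[r, s] (EFin \o (fun t => f t * t)).
  exact: (integrable_itvS r0 s1 f_L1).
have mf : measurable_fun `[r, s] (EFin \o (fun t => f t * t)) := measurable_int _ fi.
rewrite /Rintegral fine_ge0 //.
rewrite (@ae_eq_integral _ _ _ mu `[r, s] (fun t => maxe (f t * t)%:E 0)) //.
- by apply: integral_ge0 => t _; rewrite le_max lexx orbT.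
- exact: measurable_maxe.
- move: f_ge0; apply: filterS; first exact: (ae_filter_ringOfSetsType mu).
  move=> t ft trs; rewrite max_l // lee_fin.
  move: trs; rewrite /= in_itv/= => /andP[rt ts].
  by apply: mulr_ge0; [apply: ft; rewrite in_itv/= (le_trans r0 rt) (le_trans ts)|exact: le_trans rt].
Qed.

Lemma mass0 : mass 0 = 0.
Proof. by rewrite /mass set_itv1 Rintegral_set1. Qed.

Lemma mass_ge0 r : 0 <= r <= 1 -> 0 <= mass r.
Proof. by move=> /andP[r0 r1]; rewrite -mass0; exact: mass_homo. Qed.

Lemma mass_continuous_within : {within `[0, 1], continuous mass}.
Proof. exact: parameterized_integral_continuous. Qed.

Lemma mass_continuous : {in `]0, 1[, continuous mass}.
Proof. exact: Rintegral_itv_continuous. Qed.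

Lemma mass_cvg0 : mass r @[r --> 0^'+] --> 0.
Proof.
have /(continuous_within_itvP _ ltr01)[_ + _] := mass_continuous_within.
by rewrite mass0.
Qed.

Lemma id_mass_integrable : mu.-integrable `[0, 1] (EFin \o (fun t => t * mass t)).
Proof.
apply: continuous_compact_integrable; first exact: segment_compact.
by apply/subspace_continuousP => x x01; apply: cvgM;
  [exact: cvg_within|exact: (subspace_continuousP _ _).1 mass_continuous_within _ x01].
Qed.

Lemma moment_homo r s : 0 <= r -> r <= s -> s <= 1 -> moment r <= moment s.
Proof.
move=> r0 rs s1; rewrite [leRHS](@Rintegral_itv_split _ _ 0 r s) ?r0 //; last first.
  exact: (integrable_itvS (lexx 0) s1 id_mass_integrable).
rewrite lerDl; apply: Rintegral_ge0 => t /=; rewrite in_itv/= => /andP[rt ts].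
by apply: mulr_ge0; [exact: le_trans rt|apply: mass_ge0; rewrite (le_trans r0 rt) (le_trans ts)].
Qed.

Lemma moment_ge0 r : 0 <= r <= 1 -> 0 <= moment r.
Proof.
move=> /andP[r0 r1]; have : moment 0 <= moment r by exact: moment_homo.
by rewrite /moment set_itv1 Rintegral_set1.
Qed.

Lemma moment_le r : 0 <= r <= 1 -> moment r <= mass r * r ^+ 2 / 2.
Proof.
move=> /andP[r0 r1]; rewrite -(@Rintegral_monomial _ (mass r) 1) //.
apply: le_Rintegral => //.
- exact: (integrable_itvS (lexx 0) r1 id_mass_integrable).
- exact: monomial_integrable.
- move=> t /=; rewrite in_itv/= expr1 => /andP[t0 tr].
  by rewrite mulrC; apply: ler_wpM2r => //; exact: mass_homo.
Qed.

Lemma moment_continuous : {in `]0, 1[, continuous moment}.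
Proof. by apply: Rintegral_itv_continuous; exact: id_mass_integrable. Qed.

Lemma is_derive_moment r : 0 < r < 1 -> is_derive r 1 moment (r * mass r).
Proof.
move=> r01; apply: (is_derive_Rintegral_itv id_mass_integrable r01).
apply: cvgM; first exact: cvg_id.
by apply: mass_continuous; rewrite in_itv.
Qed.

Lemma moment_div_continuous : {in `]0, 1[, continuous (fun t => moment t / t ^+ 3)}.
Proof.
move=> x x01; have /andP[x0 _] : 0 < x < 1 by move: x01; rewrite in_itv.
apply: cvgM; first exact: moment_continuous.
by apply: (@isd_continuous _ (fun y => y ^- 3)); isd; rewrite ?expf_neq0 ?gt_eqF.
Qed.

Lemma moment_div_ge0 t : 0 <= t <= 1 -> 0 <= moment t / t ^+ 3.
Proof. by move=> t01; rewrite divr_ge0 ?moment_ge0 ?exprn_ge0 //; case/andP: t01. Qed.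

Lemma moment_div_le t : 0 < t <= 1 -> moment t / t ^+ 3 <= mass 1 / 2 / t.
Proof.
move=> /andP[t0 t1]; rewrite ler_pdivrMr ?exprn_gt0//.
have -> : mass 1 / 2 / t * t ^+ 3 = mass 1 * t ^+ 2 / 2 by field; rewrite gt_eqF.
apply: (le_trans (moment_le _)); first by rewrite (ltW t0).
rewrite ler_pM2r ?invr_gt0 // ler_pM2r ?exprn_gt0 //.
by apply: mass_homo => //; exact: ltW.
Qed.

Lemma moment_div_integrable r : 0 < r ->
  mu.-integrable `[r, 1] (EFin \o (fun t => moment t / t ^+ 3)).
Proof.
move=> r0; have [r1|r1] := leP r 1; last first.
  by rewrite set_itv_ge -?ltNge ?bnd_simp //; exact: integrable_set0.
apply: (@bounded_itv_integrable _ _ _ _ (mass 1 / 2 / r)).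
  have := continuous_oo_measurable moment_div_continuous.
  by apply: measurable_funS => //; apply: subset_itvr; rewrite bnd_simp ltW.
move=> t; rewrite in_itv/= => /andP[rt t1]; have t0 := lt_le_trans r0 rt.
rewrite ger0_norm ?moment_div_ge0 ?(ltW t0) //.
apply: (le_trans (moment_div_le _)); first by rewrite t0.
by rewrite ler_wpM2l ?divr_ge0 ?mass_ge0 ?lexx ?ler01 // lef_pV2.
Qed.

Lemma potential_ge0 r : 0 <= r -> 0 <= potential r.
Proof.
move=> r0; apply: Rintegral_ge0 => t /=; rewrite in_itv/= => /andP[rt t1].
by apply: moment_div_ge0; rewrite (le_trans r0).
Qed.

Lemma potential_split r s : 0 < r -> r <= s -> s <= 1 ->
  potential r = \int[mu]_(t in `[r, s]) (moment t / t ^+ 3) + potential s.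
Proof.
move=> r0 rs s1; apply: Rintegral_itv_split; first by rewrite rs.
exact: moment_div_integrable.
Qed.

Lemma potential_nincr r s : 0 < r -> r <= s -> s <= 1 -> potential s <= potential r.
Proof.
move=> r0 rs s1; rewrite (potential_split r0 rs s1) lerDr.
apply: Rintegral_ge0 => t /=; rewrite in_itv/= => /andP[rt ts].
by apply: moment_div_ge0; rewrite (le_trans (ltW r0) rt) (le_trans ts).
Qed.

Lemma potential1 : potential 1 = 0.
Proof. by rewrite /potential set_itv1 Rintegral_set1. Qed.

Lemma is_derive_potential r : 0 < r < 1 ->
  is_derive r 1 potential (- (moment r / r ^+ 3)).
Proof.
move=> r01; apply: (is_derive_Rintegral_itv_low moment_div_integrable r01).
by apply: moment_div_continuous; rewrite in_itv.
Qed.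

(** The fourth root of [r]. Its inverse dominates the logarithm at 0, and even the square of this
    inverse leaves [qroot r ^+ 2] after multiplication by [r]. *)
Definition qroot r : R := Num.sqrt (Num.sqrt r).

Lemma qroot_gt0 r : 0 < r -> 0 < qroot r.
Proof. by move=> r0; rewrite !sqrtr_gt0. Qed.

Lemma qroot_expr4 r : 0 <= r -> qroot r ^+ 4 = r.
Proof.
move=> r0; rewrite (exprM _ 2 2) sqr_sqrtr ?sqrtr_ge0 // sqr_sqrtr //.
Qed.

(** Apply [ln x <= x - 1] to [x = 1 / qroot r], whose logarithm is a quarter of [- ln r]. *)
Lemma oppr_ln_le r : 0 < r -> - ln r <= 4 / qroot r - 4.
Proof.
move=> r0; have q0 := qroot_gt0 r0.
rewrite -{1}(qroot_expr4 (ltW r0)) lnXn // -mulNrn -lnV ?posrE //.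
have := @le_ln1Dx _ ((qroot r)^-1 - 1).
have -> : 1 + ((qroot r)^-1 - 1) = (qroot r)^-1 by ring.
have : 0 < (qroot r)^-1 by rewrite invr_gt0.
by rewrite -mulr_natr; move: (ln _) => l; lra.
Qed.

(** The moment is at most [mass f 1 * t ^+ 2 / 2], so the integrand of [potential] is at most a
    multiple of [1 / t]; the resulting logarithm is then traded for a power. *)
Lemma potential_le r : 0 < r <= 1 -> potential r <= 2 * mass 1 / qroot r.
Proof.
move=> /andP[r0 r1]; have m0 : 0 <= mass 1 by rewrite mass_ge0 // ler01 lexx.
have pos x : r <= x <= 1 -> 0 < x by move=> /andP[rx _]; rewrite (lt_le_trans r0).
have e : \int[mu]_(t in `[r, 1]) (mass 1 / 2 / t) = mass 1 / 2 * - ln r.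
  refine (@Rintegral_FTC2 _ (fun t => mass 1 / 2 * ln t) _ _ _ _ r1 _ _ _).
  - by move=> x /pos x0; isd => //; field; rewrite gt_eqF.
  - by move=> x /pos x0; isdc; rewrite gt_eqF.
  - by rewrite ln1; ring.
apply: (@le_trans _ _ (mass 1 / 2 * - ln r)).
  rewrite -e; apply: le_Rintegral => //.
  - exact: moment_div_integrable.
  - by apply: continuous_itv_integrable => x /pos x0; isdc; rewrite gt_eqF.
  - move=> t /=; rewrite in_itv/= => tr1; have t0 := pos _ tr1.
    by apply: moment_div_le; rewrite t0; case/andP: tr1.
apply: (le_trans (ler_wpM2l _ (oppr_ln_le r0))); first by rewrite divr_ge0.
rewrite mulrBr; have -> : 2 * mass 1 / qroot r = mass 1 / 2 * (4 / qroot r).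
  by field; rewrite gt_eqF // qroot_gt0.
by rewrite gerBl mulr_ge0 // divr_ge0.
Qed.

End Forcing.

(** * Estimates for [s] at a root of the shooting function *)

Section RootProfile.
Context {R : realType}.
Local Notation mu := (@lebesgue_measure R).
Variables (f : R -> R) (lam : R).
Hypothesis f_L1 : mu.-integrable `[0, 1] (fun r : R => (f r * r)%:E).
Hypothesis f_ge0 : {ae mu, forall r : R, r \in `[0, 1] -> 0 <= f r}.
Hypothesis lam_ge0 : 0 <= lam.
Hypothesis lam_small : 2 * (lam * mass f 1) <= 1.
Implicit Types (r s t a : R).

Definition forcing r : R := lam * potential f r.

Lemma qroot_le1 r : r <= 1 -> qroot r <= 1.
Proof.
move=> r1; rewrite /qroot -(sqrtr1 R) ler_sqrt // -(sqrtr1 R) ler_sqrt //.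
Qed.

Lemma is_derive_forcing r : 0 < r < 1 ->
  is_derive r 1 forcing (lam * - (moment f r / r ^+ 3)).
Proof.
move=> r01; have := is_derive_potential f_L1 f_ge0 r01 => d.
by rewrite /forcing; isd; ring.
Qed.

Lemma forcing_continuous : {in `]0, 1[, continuous forcing}.
Proof.
move=> r; rewrite in_itv/= => r01.
exact: isd_continuous (is_derive_forcing r01).
Qed.

Lemma forcing_ge0 r : 0 < r <= 1 -> 0 <= forcing r.
Proof. by move=> /andP[r0 _]; rewrite mulr_ge0 // potential_ge0 // ltW. Qed.

Lemma forcing_le r : 0 < r <= 1 -> forcing r <= (qroot r)^-1.
Proof.
move=> r01; have /andP[r0 r1] := r01.
apply: (le_trans (ler_wpM2l lam_ge0 (potential_le f_L1 f_ge0 r01))).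
have -> : lam * (2 * mass f 1 / qroot r) = 2 * (lam * mass f 1) / qroot r by ring.
by rewrite ler_piMl // invr_ge0 ltW // qroot_gt0.
Qed.

Lemma forcing_sqr_le r : 0 < r <= 1 -> r * forcing r ^+ 2 <= 1.
Proof.
move=> r01; have /andP[r0 r1] := r01; have q0 := qroot_gt0 r0.
have : forcing r ^+ 2 <= (qroot r)^-1 ^+ 2.
  by rewrite ler_sqr ?nnegrE ?invr_ge0 ?(ltW q0) ?forcing_ge0 ?forcing_le.
move=> /(ler_wpM2l (ltW r0)) /le_trans; apply.
rewrite -{1}(qroot_expr4 (ltW r0)).
have -> : qroot r ^+ 4 * (qroot r)^-1 ^+ 2 = qroot r ^+ 2 by field; rewrite gt_eqF.
by rewrite exprn_ile1 // ?qroot_le1 // ltW.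
Qed.

Lemma forcing_nincr r s : 0 < r -> r <= s -> s <= 1 -> forcing s <= forcing r.
Proof. by move=> r0 rs s1; rewrite ler_wpM2l // potential_nincr. Qed.

Lemma forcing1 : forcing 1 = 0.
Proof. by rewrite /forcing potential1 mulr0. Qed.

Local Notation D := (volterra_sol forcing).
Local Notation H a := (vinner forcing a (D a)).

Variable a : R.
Hypothesis a_ge0 : 0 <= a.
Hypothesis root : shoot forcing a 1 = 0.

Local Notation sig := (shoot forcing a).

(** The function [J] of the overview: [H a] is its quadratic part, the moment is the part of [f]. *)
Definition flux r : R := H a r + lam * moment f r.

Let C := a + 1.

Lemma sig_nincr r s : 0 < r -> r <= s -> s <= 1 -> sig s <= sig r.
Proof.
apply: shoot_nincr => //; [exact: forcing_continuous|exact: forcing_ge0|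
  exact: forcing_sqr_le|exact: forcing_nincr].
Qed.

Lemma sig_ge0 r : 0 < r <= 1 -> 0 <= sig r.
Proof. by move=> /andP[r0 r1]; rewrite -root; exact: sig_nincr. Qed.

Lemma sig_le r : 0 < r <= 1 -> sig r <= C / qroot r.
Proof.
move=> r01; have /andP[r0 r1] := r01; have q0 := qroot_gt0 r0.
have h : sig r <= a + forcing r.
  by apply: shoot_le => //; [exact: forcing_continuous|exact: forcing_ge0|exact: forcing_sqr_le].
apply: (le_trans h); rewrite /C mulrDl div1r; apply: lerD; last exact: forcing_le.
by rewrite ler_peMr // invf_ge1 // qroot_le1.
Qed.

Lemma Dfun : nonneg_mfun (D a).
Proof.
apply: volterra_sol_mfun => //; [exact: forcing_continuous|exact: forcing_ge0|
  exact: forcing_sqr_le].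
Qed.

Lemma vkernel_D_integrable :
  mu.-integrable `[0, 1] (EFin \o (fun s => vkernel forcing a s (D a s))).
Proof.
apply: vkernel_integrable => //; [exact: forcing_continuous|exact: forcing_ge0|
  exact: forcing_sqr_le|exact: Dfun].
Qed.

Lemma volterra_D r : 0 <= r <= 1 -> D a r = volterra forcing a (D a) r.
Proof.
by move=> r01; rewrite volterra_fix //; [exact: forcing_continuous|exact: forcing_ge0|
  exact: forcing_sqr_le].
Qed.

Lemma vinner_div_D_integrable :
  mu.-integrable `[0, 1] (EFin \o (fun t => H a t / t ^+ 3)).
Proof.
apply: vinner_div_integrable => //; [exact: forcing_continuous|exact: forcing_ge0|
  exact: forcing_sqr_le|exact: Dfun].
Qed.

Lemma is_derive_D r : 0 < r < 1 -> is_derive r 1 (D a) (H a r / r ^+ 3).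
Proof.
move=> r01; have /andP[r0 r1] := r01.
apply: (@near_eq_is_derive _ _ _ (volterra forcing a (D a))).
- near=> s; rewrite volterra_D //.
  by apply/andP; split; apply/ltW; near: s; [exact: lt_nbhsr|exact: lt_nbhsl].
- apply: (is_derive_Rintegral_itv vinner_div_D_integrable r01).
  apply: vinner_div_continuous => //; [exact: forcing_continuous|exact: forcing_ge0|
    exact: forcing_sqr_le|exact: Dfun].
Unshelve. all: by end_near. Qed.

Lemma is_derive_sig r : 0 < r < 1 -> is_derive r 1 sig (- (flux r / r ^+ 3)).
Proof.
move=> r01; have d1 := is_derive_forcing r01; have d2 := is_derive_D r01.
have -> : sig = fun r => a + forcing r + - D a r by [].
by isd; rewrite /flux; ring.
Qed.

(** Differentiability is known only inside the interval, so the limit at 1 comes from continuity of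
    integrals in their upper limit. For [potential] the base point is [1 / 2], away from the
    singularity at 0. *)
Lemma sig_cvg1 : sig r @[r --> 1^'-] --> 0.
Proof.
have h1 : 2^-1 < 1 :> R by rewrite invf_lt1 ?ltr1n.
have h0 : 0 < 2^-1 :> R by [].
have cD : D a r @[r --> 1^'-] --> D a 1.
  have := parameterized_integral_cvg_at_left ltr01 vinner_div_D_integrable.
  rewrite volterra_D ?ler01 ?lexx // => h.
  apply: cvg_trans h; apply: near_eq_cvg; near=> r; rewrite volterra_D //.
  apply/andP; split; last by near: r; exact: nbhs_left_le.
  by apply/ltW; near: r; exact: nbhs_left_gt.
have cp : potential f r @[r --> 1^'-] --> potential f 1.
  have h := parameterized_integral_cvg_at_left h1 (moment_div_integrable f_L1 f_ge0 h0).
  have e : potential f 2^-1 -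
      parameterized_integral mu 2^-1 1 (fun t => moment f t / t ^+ 3) = potential f 1.
    by rewrite (potential_split f_L1 f_ge0 h0 (ltW h1) (lexx 1)) addrAC subrr add0r.
  have {}h : potential f 2^-1 - parameterized_integral mu 2^-1 r
      (fun t => moment f t / t ^+ 3) @[r --> 1^'-] --> potential f 1.
    by rewrite -e; apply: cvgB => //; exact: cvg_cst.
  apply: cvg_trans h; apply: near_eq_cvg; near=> r.
  have r2 : 2^-1 <= r by near: r; exact: nbhs_left_ge.
  have r1 : r <= 1 by near: r; exact: nbhs_left_le.
  by rewrite (potential_split f_L1 f_ge0 h0 r2 r1) /= addrAC subrr add0r.
rewrite -root; apply: cvgB => //; apply: cvgD; first exact: cvg_cst.
by apply: cvgM => //; exact: cvg_cst.
Unshelve. all: by end_near. Qed.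

(** This is [J'(r) / r], and also [r] times the derivative of the Laplacian [u'' + u' / r]: the
    fourth-order equation integrated once. *)
Definition source r : R := (r * sig r) ^+ 2 / 2 + lam * mass f r.

(** Here the truncation disappears: at a root [sig] is nonnegative, so the solution of the truncated
    problem solves the original one. At [s = 0] both sides vanish through the factor [s ^+ 3]. *)
Lemma vkernel_sig s : 0 <= s <= 1 ->
  vkernel forcing a s (D a s) = s ^+ 3 * sig s ^+ 2 / 2.
Proof.
move=> /andP[]; rewrite le_eqVlt => /predU1P[<- _|s0 s1].
  by rewrite vkernel0 expr0n/= !mul0r.
by rewrite vkernel_shoot // sig_ge0 // s0.
Qed.

Lemma is_derive_flux r : 0 < r < 1 -> is_derive r 1 flux (r * source r).
Proof.
move=> r01; have /andP[r0 r1] := r01.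
have d1 := is_derive_moment f_L1 r01.
have d2 : is_derive r 1 (fun r => H a r) (r ^+ 3 * sig r ^+ 2 / 2).
  rewrite -vkernel_sig ?(ltW r0) ?(ltW r1) //.
  apply: (is_derive_Rintegral_itv vkernel_D_integrable r01).
  suff : vkernel forcing a s (D a s) @[s --> r] --> vkernel forcing a r (D a r) by [].
  rewrite vkernel_sig ?(ltW r0) ?(ltW r1) //.
  suff cc : s ^+ 3 * sig s ^+ 2 / 2 @[s --> r] --> r ^+ 3 * sig r ^+ 2 / 2.
    apply: cvg_trans cc; apply: near_eq_cvg; near=> s; rewrite vkernel_sig //.
    by apply/andP; split; apply/ltW; near: s; [exact: lt_nbhsr|exact: lt_nbhsl].
  have ds := is_derive_sig r01.
  by apply: (@isd_continuous _ (fun s => s ^+ 3 * sig s ^+ 2 / 2)); isd.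
by rewrite /flux; isd; rewrite /source; field.
Unshelve. all: by end_near. Qed.

(** A nondecreasing majorant of [source] that tends to 0 at 0. It controls [J r / r ^+ 2] as well,
    and thereby [r u'''(r)]. *)
Definition source_bound r : R := C ^+ 2 / 2 * r + lam * mass f r.

Lemma sqr_sig_le r : 0 < r <= 1 -> r * sig r ^+ 2 <= C ^+ 2.
Proof.
move=> r01; have /andP[r0 r1] := r01; have q0 := qroot_gt0 r0.
have : sig r ^+ 2 <= (C / qroot r) ^+ 2.
  by rewrite ler_sqr ?nnegrE ?sig_ge0 ?sig_le // divr_ge0 ?(ltW q0) // addr_ge0.
move=> /(ler_wpM2l (ltW r0)) /le_trans; apply.
rewrite -{1}(qroot_expr4 (ltW r0)).
have -> : qroot r ^+ 4 * (C / qroot r) ^+ 2 = C ^+ 2 * qroot r ^+ 2 by field; rewrite gt_eqF.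
by rewrite ler_piMr ?sqr_ge0 // exprn_ile1 // ?qroot_le1 // ltW.
Qed.

Lemma source_le r : 0 < r <= 1 -> source r <= source_bound r.
Proof.
move=> r01; have /andP[r0 r1] := r01; rewrite lerD2r exprMn.
have := ler_wpM2l (ltW r0) (sqr_sig_le r01); rewrite mulrA -expr2; lra.
Qed.

Lemma flux_ge0 r : 0 <= r <= 1 -> 0 <= flux r.
Proof.
move=> r01; have /andP[r0 r1] := r01.
by rewrite addr_ge0 ?vinner_ge0 // mulr_ge0 // moment_ge0.
Qed.

Lemma flux_le r : 0 <= r <= 1 -> flux r <= source_bound r * r ^+ 2 / 2.
Proof.
move=> r01; have /andP[r0 r1] := r01.
have h1 := ler_wpM2l lam_ge0 (moment_le f_L1 f_ge0 r01).
have : H a r <= C ^+ 2 / 2 * r ^+ 3 / 3%:R.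
  rewrite -(@Rintegral_monomial _ (C ^+ 2 / 2) 2) //.
  apply: le_Rintegral => //.
  - exact: (integrable_itvS (lexx 0) r1 vkernel_D_integrable).
  - exact: monomial_integrable.
  - move=> t /=; rewrite in_itv/= => /andP[]; rewrite le_eqVlt => /predU1P[<- _|t0 tr].
      by rewrite vkernel0 expr0n/= mulr0.
    have t1 := le_trans tr r1.
    rewrite vkernel_sig ?(ltW t0) //.
    have := ler_wpM2l (sqr_ge0 t) (sqr_sig_le (introT andP (conj t0 t1))).
    by rewrite mulrA -exprSr; lra.
have : 0 <= C ^+ 2 * r ^+ 3 by rewrite mulr_ge0 ?sqr_ge0 ?exprn_ge0.
rewrite /flux /source_bound [r ^+ 3]exprSr; move: (H a r) (moment f r) h1 => x y.
by move: (mass f r) (C ^+ 2) (r ^+ 2) => m c q; lra.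
Qed.

Lemma source_bound_homo r s : 0 <= r -> r <= s -> s <= 1 ->
  source_bound r <= source_bound s.
Proof.
move=> r0 rs s1; rewrite lerD // ler_wpM2l //; last exact: mass_homo.
by rewrite divr_ge0 // sqr_ge0.
Qed.

Lemma source_bound_cvg0 : source_bound r @[r --> 0^'+] --> 0.
Proof.
have : source_bound r @[r --> 0^'+] --> C ^+ 2 / 2 * 0 + lam * 0.
  apply: cvgD; apply: cvgM; try exact: cvg_cst; last exact: mass_cvg0.
  by apply: cvg_at_right_filter; exact: cvg_id.
by rewrite !mulr0 addr0.
Qed.

End RootProfile.

(** * Classical derivatives on the open interval are weak derivatives *)

Section WeakDerivative.
Context {R : realType}.
Local Notation mu := (@lebesgue_measure R).

Lemma supp_near0 (V : normedModType R) (F : V -> R) (x : V) :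
  ~ supp F x -> \forall y \near x, F y = 0.
Proof.
move=> Fx.
have : nbhs x (~` supp F) by apply: open_nbhs_nbhs; split => //; exact/closed_openC/closed_closure.
apply: filterS => y Fy; apply/eqP/negP => /negP F0; apply: Fy.
by apply: subset_closure.
Qed.

Lemma test_fun_derive (psi : R -> R) (U : set R^o) : test_fun U psi ->
  (forall x : R, is_derive x 1 psi (derive1 psi x)) /\
  (forall x : R, {for x, continuous (derive1 psi)}).
Proof.
move=> [smo _ _]; split=> x.
  have /derivable1_diffP d := smo [::] x.
  by rewrite derive1E; exact: derivableP.
have := smo [:: 1] x => /= /differentiable_continuous.
suff -> : derive1 psi = 'D_(1 : R^o) psi by [].
by apply/funext => y; rewrite derive1E.
Qed.

Lemma test_fun_oo (psi : R -> R) : test_fun (`]0, 1[%classic : set R^o) psi ->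
  exists a b : R, [/\ 0 < a, a <= b, b < 1 &
    forall x, x <= a \/ b <= x -> psi x = 0 /\ derive1 psi x = 0].
Proof.
move=> tf; have [smo cpt sub] := tf.
have out x : ~ supp (psi : R^o -> R) x -> psi x = 0 /\ derive1 psi x = 0.
  move=> /supp_near0 n0; split; first exact: (nbhs_singleton n0).
  rewrite derive1E; have -> : 'D_1 psi x = 'D_1 (cst 0 : R -> R) x by exact: near_eq_derive.
  exact: derive_cst.
have [[x0 Sx0]|noS] := pselect (exists x, supp (psi : R^o -> R) x); last first.
  exists (1 / 2), (1 / 2); split=> //; try lra.
  by move=> x _; apply: out => Sx; apply: noS; exists x.
have cid : {within supp (psi : R^o -> R), continuous (fun x : R => x)}.
  by apply: continuous_subspaceT => x; exact: cvg_id.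
have ne : supp (psi : R^o -> R) !=set0 by exists x0.
have [m Sm mS] := compact_EVT_min ne cpt cid.
have [M SM MS] := compact_EVT_max ne cpt cid.
have := sub _ (set_mem Sm); rewrite /= in_itv/= => /andP[m0 m1].
have := sub _ (set_mem SM); rewrite /= in_itv/= => /andP[M0 M1].
have mM : m <= M by apply: mS.
(* Halfway from the extreme points of the support towards 0 and 1, both end points lie outside the
   support, so the derivative of [psi] vanishes there too. *)
exists (m / 2), ((M + 1) / 2); split; try lra.
move=> x xout; apply: out => Sx; have := mS _ (mem_set Sx); have := MS _ (mem_set Sx).
by case: xout; lra.
Qed.

Lemma continuous_oo_locally_integrable (h : R -> R) (a b : R) :
  {in `]a, b[, continuous h} -> locally_integrable `]a, b[%classic h.
Proof.
move=> ch; split; [|exact: interval_open|].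
  by apply: open_continuous_measurable_fun; [exact: interval_open|move=> x; rewrite inE => /ch].
move=> K KD cK.
have : mu.-integrable K (EFin \o h).
  apply: continuous_compact_integrable => //; apply/subspace_continuousP => x Kx.
  by apply: cvg_within_filter; apply: ch; exact: KD.
by case/integrableP.
Qed.

(** Integration by parts on a compact interval outside which [psi] and its derivative vanish; hence
    nothing is asked of [u] and [v] at 0 and 1. *)
Lemma weak_derivative_classical (u v : R -> R) :
  (forall x : R, 0 < x < 1 -> is_derive x 1 u (v x)) ->
  {in `]0, 1[, continuous v} -> weak_derivative u v.
Proof.
move=> du cv.
have cu : {in `]0, 1[, continuous u}.
  by move=> x; rewrite in_itv/= => /du/isd_continuous.
split; try exact: continuous_oo_locally_integrable.
move=> psi tf; have [dpsi cpsi] := test_fun_derive tf.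
have [a [b [a0 ab b1 out]]] := test_fun_oo tf.
have sub : `]0, 1[%classic `&` `[a, b]%classic = (`[a, b]%classic : set R).
  rewrite setIidr // => x /=; rewrite !in_itv/= => /andP[ax xb].
  by rewrite (lt_le_trans a0) // (le_lt_trans xb).
have restr (h : R -> R) : (forall x, x < a \/ b < x -> h x = 0) ->
    \int[mu]_(r in `]0, 1[) h r = \int[mu]_(r in `[a, b]) h r.
  move=> h0; rewrite -[in RHS]sub Rintegral_mkcondr; apply: eq_Rintegral => x _.
  rewrite patchE; case: ifPn => //; rewrite notin_setE /= in_itv/= => /negP.
  by rewrite negb_and -!ltNge => /orP; exact: h0.
have itv x : a <= x <= b -> 0 < x < 1.
  by move=> /andP[ax xb]; rewrite (lt_le_trans a0) // (le_lt_trans xb).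
have c1 x : a <= x <= b -> {for x, continuous (fun r => u r * derive1 psi r)}.
  by move=> /itv x01; apply: cvgM; [apply: cu; rewrite in_itv|exact: cpsi].
have c2 x : a <= x <= b -> {for x, continuous (fun r => v r * psi r)}.
  move=> /itv x01; apply: cvgM; [by apply: cv; rewrite in_itv|].
  exact: isd_continuous (dpsi x).
rewrite !restr; last 2 first.
- by move=> x xo; have [->] := out x ltac:(by case: xo => /ltW; [left|right]); rewrite mulr0.
- by move=> x xo; have [_ ->] := out x ltac:(by case: xo => /ltW; [left|right]); rewrite mulr0.
apply/eqP; rewrite -subr_eq0 opprK -RintegralD //; try exact: continuous_itv_integrable.
apply/eqP; refine (@Rintegral_FTC2 _ (fun x => u x * psi x) _ _ _ _ ab _ _ _).
- move=> x /itv x01; have d1 := du x x01; have d2 := dpsi x.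
  by isd; ring.
- by move=> x xab; apply: cvgD; [exact: c1|exact: c2].
- have [-> _] := out a (or_introl (lexx a)); have [-> _] := out b (or_intror (lexx b)).
  by rewrite !mulr0 subrr.
Qed.

End WeakDerivative.

(** * Integration by parts against the mass function of an integrable [f] *)

Section MassByParts.
Context {R : realType}.
Local Notation mu := (@lebesgue_measure R).

Lemma continuous_itv_bounded (h : R -> R) (a b : R) : a <= b ->
  (forall x, a <= x <= b -> {for x, continuous h}) ->
  exists2 M, 0 <= M & forall x, a <= x <= b -> `|h x| <= M.
Proof.
move=> ab ch.
have [|c cab hc] := @EVT_max _ (fun x => `|h x|) a b ab.
  apply/subspace_continuousP => x; rewrite /= in_itv/= => /ch hx.
  by apply: cvg_within_filter; apply: cvg_norm.
by exists `|h c| => // x xab; apply: hc; rewrite in_itv.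
Qed.

Lemma integrable_itvM (g h : R -> R) (a b : R) :
  mu.-integrable `[a, b] (EFin \o g) ->
  (forall x, a <= x <= b -> {for x, continuous h}) ->
  mu.-integrable `[a, b] (EFin \o (fun x => g x * h x)).
Proof.
move=> gi ch; have [ab|ab] := leP a b; last first.
  by rewrite set_itv_ge -?ltNge ?bnd_simp //; exact: integrable_set0.
have [M M0 hM] := continuous_itv_bounded ab ch.
have := integrableMl (mu := mu) (measurable_itv `[a, b]) gi (h := h).
apply.
  apply: subspace_continuous_measurable_fun => //.
  apply/subspace_continuousP => x; rewrite /= in_itv/= => /ch.
  exact: cvg_within_filter.
exists M; split; first exact: num_real.
move=> x Mx t /=; rewrite in_itv/= => tab.
exact: le_trans (hM _ tab) (ltW Mx).
Qed.

Variable f : R -> R.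
Hypothesis f_L1 : mu.-integrable `[0, 1] (fun r : R => (f r * r)%:E).

(* Integration by parts for the absolutely continuous function [mass f]: the
   defect of the formula on [r, s] is at most [2 M (s - r)] times the mass of
   [|f t * t|] on [r, s], hence vanishes along finer and finer partitions. *)
Lemma mass_by_parts (g g' : R -> R) :
  (forall x : R, is_derive x 1 g (g' x)) ->
  (forall x : R, {for x, continuous g'}) -> g 1 = 0 ->
  \int[mu]_(r in `[0, 1]) (mass f r * g' r) =
  - \int[mu]_(r in `[0, 1]) (f r * g r * r).
Proof.
move=> dg cg' g1.
have cg x : {for x, continuous g} by exact: isd_continuous (dg x).
pose w t := f t * t.
have wi a b : 0 <= a -> b <= 1 -> mu.-integrable `[a, b] (EFin \o w).
  by move=> a0 b1; exact: (integrable_itvS a0 b1 f_L1).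
have nwi a b : 0 <= a -> b <= 1 -> mu.-integrable `[a, b] (EFin \o (fun t => `|w t|)).
  by move=> a0 b1; apply: integrable_norm; exact: wi.
have wgi a b : 0 <= a -> b <= 1 -> mu.-integrable `[a, b] (EFin \o (fun t => w t * g t)).
  by move=> a0 b1; apply: integrable_itvM; [exact: wi|].
have mass_int : mu.-integrable `[0, 1] (EFin \o mass f).
  apply: continuous_compact_integrable; first exact: segment_compact.
  exact: mass_continuous_within.
have mi a b : 0 <= a -> b <= 1 -> mu.-integrable `[a, b] (EFin \o (fun t => mass f t * g' t)).
  by move=> a0 b1; apply: (integrable_itvS a0 b1); apply: integrable_itvM.
have [M M0 g'M] := continuous_itv_bounded ler01 (fun x _ => cg' x).
have gM r s : 0 <= r -> r <= s -> s <= 1 -> `|g r - g s| <= M * (s - r).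
  move=> r0; rewrite le_eqVlt => /predU1P[<- _|rs s1]; first by rewrite !subrr normr0 mulr0.
  have [|c crs e] := @MVT _ g g' r s rs (fun x _ => dg x).
    by apply: continuous_subspaceT.
  rewrite distrC e normrM [`|s - r|]gtr0_norm ?subr_gt0 // ler_wpM2r ?subr_ge0 ?(ltW rs) //.
  by move: crs; rewrite in_itv/= => /andP[rc cs]; apply: g'M;
    rewrite (le_trans r0 (ltW rc)) (le_trans (ltW cs)).
pose W r := \int[mu]_(t in `[0, r]) `|w t|.
pose Z r := \int[mu]_(t in `[0, r]) (w t * g t) +
  \int[mu]_(t in `[0, r]) (mass f t * g' t) - mass f r * g r.
have step r s : 0 <= r -> r <= s -> s <= 1 -> `|Z s - Z r| <= 2 * M * (s - r) * (W s - W r).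
  move=> r0 rs s1.
  have s0 := le_trans r0 rs.
  pose w' := \int[mu]_(t in `[r, s]) `|w t|.
  have -> : W s - W r = w'.
    by rewrite /W (@Rintegral_itv_split _ _ 0 r s) ?r0 ?nwi // addrAC subrr add0r.
  have mass_diff t : r <= t <= s -> `|mass f t - mass f r| <= w'.
    move=> /andP[rt ts]; have t1 := le_trans ts s1.
    rewrite (mass_split f_L1 r0 rt t1) addrAC subrr add0r.
    apply: (@le_trans _ _ (\int[mu]_(t in `[r, t]) `|w t|)).
      by apply: ler_norm_Rintegral_itv => //; [exact: wi|exact: nwi].
    rewrite /w' (@Rintegral_itv_split _ _ r t s) ?rt ?nwi // lerDl.
    by apply: Rintegral_ge0 => x _.
  have e1 : \int[mu]_(t in `[r, s]) (mass f r * g' t) = mass f r * (g s - g r).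
    notypeclasses refine (@Rintegral_FTC2 _ (fun t => mass f r * g t) _ _ _ _ rs _ _ _).
    - by move=> x _; have d := dg x; isd; ring.
    - by move=> x _; apply: cvgM; [exact: cvg_cst|exact: cg'].
    - by ring.
  have e2 : \int[mu]_(t in `[r, s]) (w t * g s) = (mass f s - mass f r) * g s.
    rewrite RintegralZr ?wi // (mass_split f_L1 r0 rs s1).
    by rewrite [mass f r + _]addrC addrK.
  (* The increment of [mass f * g] is written as [(mass f s - mass f r) * g s + mass f r * (g s - g
     r)]. Each of the two integrals then compares one factor with its value at an end point. *)
  have -> : Z s - Z r = \int[mu]_(t in `[r, s]) (w t * g t - w t * g s) +
      \int[mu]_(t in `[r, s]) (mass f t * g' t - mass f r * g' t).
    rewrite !RintegralB ?wgi ?mi // ?e1 ?e2 /Z; last 2 first.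
    - by apply: continuous_itv_integrable => x _; apply: cvgM; [exact: cvg_cst|exact: cg'].
    - by apply: integrable_itvM; [exact: wi|move=> x _; exact: cvg_cst].
    have := @Rintegral_itv_split _ (fun t => w t * g t) 0 r s
      (introT andP (conj r0 rs)) (wgi _ _ (lexx 0) s1).
    have := @Rintegral_itv_split _ (fun t => mass f t * g' t) 0 r s
      (introT andP (conj r0 rs)) (mi _ _ (lexx 0) s1).
    move=> -> ->; move: (\int[mu]_(t in `[0, r]) (w t * g t)) (\int[mu]_(t in `[r, s]) (w t * g t)) => x1 x2.
    move: (\int[mu]_(t in `[0, r]) (mass f t * g' t)) (\int[mu]_(t in `[r, s]) (mass f t * g' t)) => x3 x4.
    move: (mass f s) (mass f r) => x5 x6; ring.
  have -> : 2 * M * (s - r) * w' = w' * (M * (s - r)) + w' * M * (s - r) by ring.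
  apply: (le_trans (ler_normD _ _)); apply: lerD.
    rewrite /w' -RintegralZr ?nwi //; apply: ler_norm_Rintegral_itv.
    - apply: integrable_itvB; first exact: wgi.
      by apply: integrable_itvM; [exact: wi|move=> x _; exact: cvg_cst].
    - by apply: integrable_itvM; [exact: nwi|move=> x _; exact: cvg_cst].
    - move=> t; rewrite in_itv/= => /andP[rt ts]; rewrite -mulrBr normrM.
      apply: ler_wpM2l => //; apply: (le_trans (gM _ _ (le_trans r0 rt) ts s1)).
      by apply: ler_wpM2l => //; lra.
  have -> : w' * M * (s - r) = \int[mu]_(t in `[r, s]) (w' * M).
    symmetry; notypeclasses refine (@Rintegral_FTC2 _ (fun t => w' * M * t) _ _ _ _ rs _ _ _).
    - by move=> x _; isd; ring.
    - by move=> x _; exact: cvg_cst.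
    - by ring.
  apply: ler_norm_Rintegral_itv.
  - apply: integrable_itvB; first exact: mi.
    by apply: continuous_itv_integrable => x _; apply: cvgM; [exact: cvg_cst|exact: cg'].
  - by apply: continuous_itv_integrable => x _; exact: cvg_cst.
  - move=> t; rewrite in_itv/= => trs; have /andP[rt ts] := trs.
    rewrite -mulrBl normrM ler_pM // ?mass_diff // g'M //.
    by rewrite (le_trans r0 rt) (le_trans ts).
(* On the grid of step [1 / n.+1] the increments of [W] telescope, so the total defect is at most
   [2 M W(1) / n.+1]. *)
have grid n k : (k <= n.+1)%N -> `|Z (k%:R / n.+1%:R) - Z 0| <=
    2 * M / n.+1%:R * W (k%:R / n.+1%:R).
  elim: k => [_|k IH kn].
    rewrite mul0r subrr normr0 mulr_ge0 ?divr_ge0 ?mulr_ge0 ?ler0n //.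
    by apply: Rintegral_ge0.
  have n0 : 0 < n.+1%:R :> R by rewrite ltr0n.
  have d : k.+1%:R / n.+1%:R - k%:R / n.+1%:R = n.+1%:R^-1 :> R.
    by rewrite -mulrBl -natrB // subSnn mul1r.
  have st := @step (k%:R / n.+1%:R) (k.+1%:R / n.+1%:R) _ _ _.
  apply: (le_trans (ler_distD (Z (k%:R / n.+1%:R)) _ _)).
  apply: (@le_trans _ _ (2 * M * n.+1%:R^-1 * (W (k.+1%:R / n.+1%:R) - W (k%:R / n.+1%:R)) +
    2 * M / n.+1%:R * W (k%:R / n.+1%:R))).
    apply: lerD; last by apply: IH; exact: ltnW.
    rewrite d in st; apply: st.
    - by rewrite divr_ge0.
    - by rewrite ler_pM2r ?invr_gt0 // ler_nat.
    - by rewrite ler_pdivrMr // mul1r ler_nat.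
  by rewrite -mulrDr subrK.
have Z10 : Z 1 = Z 0.
  apply/eqP; rewrite -subr_eq0 -normr_le0 leNgt; apply/negP => pos.
  pose K := 2 * M * W 1.
  have [n Kn] : exists n : nat, K / `|Z 1 - Z 0| < n.+1%:R.
    exists (Num.truncn (K / `|Z 1 - Z 0|)); apply: truncnS_gt.
  have := @grid n n.+1 (leqnn _); rewrite divff ?pnatr_eq0 //.
  move: Kn; rewrite ltr_pdivrMr // leNgt => Kn /negP; apply.
  by rewrite mulrAC -/K ltr_pdivrMr ?ltr0n // mulrC.
have : Z 1 = 0.
  by rewrite Z10 /Z mass0 mul0r subr0 !set_itv1 !Rintegral_set1 addr0.
rewrite /Z g1 mulr0 subr0 addrC => /eqP; rewrite addr_eq0 => /eqP ->; congr (- _).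
by apply: eq_Rintegral => t _; rewrite /w mulrAC.
Qed.

End MassByParts.

(** * Derivatives on open intervals and one-sided limits *)

Section ClassicalDerivatives.
Context {R : realType}.
Local Notation mu := (@lebesgue_measure R).

Lemma near_oo (a b x : R) : a < x < b -> \forall y \near x, a < y < b.
Proof.
move=> /andP[ax xb]; near=> y.
by apply/andP; split; near: y; [exact: lt_nbhsr|exact: lt_nbhsl].
Unshelve. all: by end_near. Qed.

Lemma is_derive_oo (f h k : R -> R) (a b : R) :
  (forall x, a < x < b -> f x = h x) ->
  (forall x, a < x < b -> is_derive x 1 h (k x)) ->
  forall x, a < x < b -> is_derive x 1 f (k x).
Proof.
move=> fh dh x xab; apply: (@near_eq_is_derive _ _ _ h); last exact: dh.
by apply: filterS (near_oo xab) => y /fh.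
Qed.

Lemma derive1_oo (f h k : R -> R) (a b : R) :
  (forall x, a < x < b -> f x = h x) ->
  (forall x, a < x < b -> is_derive x 1 h (k x)) ->
  forall x, a < x < b -> derive1 f x = k x.
Proof.
move=> fh dh x xab; rewrite derive1E.
by have [_ ->] := is_derive_oo fh dh xab.
Qed.

Lemma squeeze_cvgr_norm (T : Type) (F : set_system T) (FF : Filter F)
  (f h : T -> R) : (\forall x \near F, `|f x| <= h x) -> h x @[x --> F] --> 0 ->
  f x @[x --> F] --> 0.
Proof.
move=> fh h0; apply: norm_cvg0; apply: (@squeeze_cvgr _ _ _ _ (cst 0) h) => //.
- by apply: filterS fh => x ->; rewrite normr_ge0.
- exact: cvg_cst.
Qed.

(** For an antiderivative that is controlled at the left end point only through limits; it is
    applied at 0, where [u''] and [u' / r] may be singular. *)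
Lemma Rintegral_FTC2_right (E e : R -> R) (a b : R) : a < b ->
  (forall x, a < x <= b -> is_derive x 1 E (e x)) ->
  (forall x, a < x <= b -> {for x, continuous e}) ->
  e r @[r --> a^'+] --> e a -> E r @[r --> a^'+] --> E a ->
  \int[mu]_(t in `[a, b]) e t = E b - E a.
Proof.
move=> ab dE ce e0 E0.
have abb : a < b <= b by rewrite ab lexx.
rewrite /Rintegral (@continuous_FTC2 _ e E) //.
- apply/(continuous_within_itvP _ ab); split=> //.
    by move=> x; rewrite in_itv/= => /andP[ax xb]; apply: ce; rewrite ax ltW.
  by apply: cvg_at_left_filter; exact: ce.
- split=> //.
    by move=> x; rewrite in_itv/= => /andP[ax xb]; have [] := dE x; rewrite ?ax ?(ltW xb).
  by apply: cvg_at_left_filter; exact: isd_continuous (dE _ abb).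
- move=> x; rewrite in_itv/= => /andP[ax xb].
  by have [_ <-] := dE x (introT andP (conj ax (ltW xb))); rewrite derive1E.
Qed.

End ClassicalDerivatives.

(** * One-dimensional profiles of radial test functions *)

Section RadialTest.
Context {R : realType}.

Lemma is_derive_line (V : normedModType R) (F : V -> R) (v : V) (r : R) :
  differentiable F (r *: v) ->
  is_derive r 1 (fun s : R => F (s *: v)) ('D_v F (r *: v)).
Proof.
move=> dF.
have e : (fun h : R => h^-1 *: (((fun s : R => F (s *: v)) \o shift r) (h *: (1 : R)) - F (r *: v))) =
         (fun h : R => h^-1 *: ((F \o shift (r *: v)) (h *: v) - F (r *: v))).
  by apply/funext => h; rewrite /= scalerDl [h *: 1]mulr1.
have dv : derivable F (r *: v) v by exact: diff_derivable.
by apply: DeriveDef; [rewrite /derivable e|rewrite /derive e].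
Qed.

Let e0 : 'rV[R]_2 := delta_mx ord0 ord0.

Lemma enorm_line (r : R) : enorm (r *: e0) = `|r|.
Proof.
rewrite /enorm !big_ord_recl big_ord0 !mxE /= mulr1 mulr0.
by rewrite expr0n /= !addr0 sqrtr_sqr.
Qed.

(** Nothing is known of [phi] on negative numbers, so it is replaced by the restriction [g] of the
    planar function to a line through the origin. This [g] is smooth and even, whence [g1 0 = 0]. It
    vanishes near 1 because the unit vector lies outside the closed support. *)
Lemma radial_test_profile (phi : R -> R) : radial_test_fun phi ->
  exists g g1 g2 : R -> R,
  [/\ [/\ forall x : R, is_derive x 1 g (g1 x), forall x : R, is_derive x 1 g1 (g2 x),
          forall x : R, {for x, continuous g2} & g1 0 = 0],
      exists2 b : R, 0 < b < 1 &
        forall r, b < r <= 1 -> [/\ g r = 0, g1 r = 0 & g2 r = 0] &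
      forall r : R, 0 < r -> [/\ phi r = g r, derive1 phi r = g1 r & derive1n 2 phi r = g2 r]].
Proof.
move=> [smo cpt sub]; set F := fun x : 'rV[R]_2 => phi (enorm x) in smo cpt sub.
pose g (r : R) := F (r *: e0); pose g1 (r : R) := 'D_e0 F (r *: e0).
pose g2 (r : R) := 'D_e0 ('D_e0 F) (r *: e0).
have dg (x : R) : is_derive x 1 g (g1 x) by apply: is_derive_line; exact: (smo [::]).
have dg1 (x : R) : is_derive x 1 g1 (g2 x) by apply: is_derive_line; exact: (smo [:: e0]).
have dg2 (x : R) : is_derive x 1 g2 ('D_e0 ('D_e0 ('D_e0 F)) (x *: e0)).
  by apply: is_derive_line; exact: (smo [:: e0; e0]).
have gphi r : 0 < r -> phi r = g r by move=> r0; rewrite /g /F enorm_line gtr0_norm.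
have pos (r : R) : 0 < r -> \forall s \near r, 0 < s.
  by move=> r0; near=> s; near: s; exact: lt_nbhsr.
have d1 r : 0 < r -> derive1 phi r = g1 r.
  move=> r0; rewrite derive1E; have [_ <-] := dg r.
  by apply: near_eq_derive => //; apply: filterS (pos r r0) => s /gphi.
exists g, g1, g2; split; [split=> //|..].
- by move=> x; exact: isd_continuous (dg2 x).
- have ev : g = fun r => g (- r) by apply/funext => r; rewrite /g /F !enorm_line normrN.
  have d := dg 0; have d' : is_derive (0 : R) 1 g (- g1 0).
    rewrite {1}ev; have dd : is_derive (- (0 : R)) 1 g (g1 0) by rewrite oppr0.
    have := isd_comp (isdN (isd_id (0 : R))) dd; rewrite mulrN1; exact.
  have [_ e1] := d; have [_ e2] := d'.
  have : g1 0 = - g1 0 by rewrite -{1}e1 -e2.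
  by move: (g1 0) => x; lra.
- have F1 : ~ supp F ((1 : R) *: e0).
    by move=> /sub /=; rewrite enorm_line normr1 ltxx.
  have cl : {for (1 : R), continuous (fun r : R => r *: e0)}.
    by move=> /=; apply: cvgZr_tmp; exact: cvg_id.
  have /nbhs_ballP[d /= d0 dP] : \forall r \near (1 : R), g r = 0 := cl _ (supp_near0 F1).
  exists (Num.max (1 / 2) (1 - d)).
    by rewrite lt_max gt_max; apply/andP; split; [apply/orP; left; lra|apply/andP; split; lra].
  have gz r : Num.max (1 / 2) (1 - d) < r < 1 + d -> g r = 0.
    rewrite gt_max => /andP[/andP[_ dr] rd]; apply: dP; rewrite /ball /= ltr_norml; apply/andP; split; lra.
  have g1z r : Num.max (1 / 2) (1 - d) < r < 1 + d -> g1 r = 0.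
    move=> rr; have [_ <-] := dg r; rewrite -derive1E.
    by apply: (derive1_oo (h := cst 0) (k := cst 0) gz) => // x _; exact: isd_cst.
  have g2z r : Num.max (1 / 2) (1 - d) < r < 1 + d -> g2 r = 0.
    move=> rr; have [_ <-] := dg1 r; rewrite -derive1E.
    by apply: (derive1_oo (h := cst 0) (k := cst 0) g1z) => // x _; exact: isd_cst.
  move=> r /andP[br r1]; have rr : Num.max (1 / 2) (1 - d) < r < 1 + d.
    by rewrite br /=; lra.
  by split; [exact: gz|exact: g1z|exact: g2z].
- move=> r r0; split; [exact: gphi|exact: d1|].
  rewrite derive1nS derive1E; have [_ <-] := dg1 r.
  by apply: near_eq_derive => //; apply: filterS (pos r r0) => s /d1.
Unshelve. all: by end_near. Qed.

End RadialTest.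

(** * Certificates of smoothness on the line and on the plane *)

Section SmoothFunctions.
Context {R : realType}.

Definition smooth1 (h : R -> R) : Prop :=
  forall k (x : R), derivable (derive1n k h) x 1.

Lemma smooth1_derive (h : R -> R) : smooth1 h -> smooth1 (derive1 h).
Proof. by move=> sh k x; rewrite -derive1Sn. Qed.

Lemma smooth1_is_derive (h : R -> R) (x : R) : smooth1 h ->
  is_derive x 1 h (derive1 h x).
Proof. by move=> /(_ 0%N x) d; rewrite derive1E; exact: derivableP. Qed.

Lemma smooth1_primitive (h H : R -> R) :
  (forall x : R, is_derive x 1 H (h x)) -> smooth1 h -> smooth1 H.
Proof.
move=> dH sh [|k] x; first by have [] := dH x.
rewrite derive1Sn (_ : derive1 H = h) //.
by apply/funext => y; rewrite derive1E; have [_ ->] := dH y.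
Qed.

(* A class of functions that is stable under directional derivatives, used to
   certify smoothness both on the line and on the plane. *)
Inductive smooth_expr (V : normedModType R) : (V -> R) -> Prop :=
| SmoothAffine F : (forall x, differentiable F x) ->
    (forall v, exists c, forall x, 'D_v F x = c) -> smooth_expr F
| SmoothAdd F G : smooth_expr F -> smooth_expr G -> smooth_expr (fun x => F x + G x)
| SmoothMul F G : smooth_expr F -> smooth_expr G -> smooth_expr (fun x => F x * G x)
| SmoothComp h F : smooth1 h -> smooth_expr F -> smooth_expr (fun x => h (F x)).

Lemma smooth_expr_cst (V : normedModType R) (c : R) : smooth_expr (fun _ : V => c).
Proof.
apply: SmoothAffine => [x|v]; first exact: differentiable_cst.
by exists 0 => x; exact: derive_cst.
Qed.

Lemma smooth_expr_derive (V : normedModType R) (F : V -> R) : smooth_expr F ->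
  (forall x, differentiable F x) /\ (forall v, smooth_expr ('D_v F)).
Proof.
elim=> {F} [F dF DF|F G _ [dF DF] _ [dG DG]|F G sF [dF DF] sG [dG DG]|h F sh sF [dF DF]].
- split=> // v; have [c Dc] := DF v.
  have -> : 'D_v F = fun _ => c by apply/funext.
  exact: smooth_expr_cst.
- split=> [x|v]; first exact: differentiableD.
  have -> : 'D_v (fun x => F x + G x) = fun x => 'D_v F x + 'D_v G x.
    by apply/funext => x; apply: deriveD; exact: diff_derivable.
  exact: SmoothAdd.
- split=> [x|v]; first exact: differentiableM.
  have -> : 'D_v (fun x => F x * G x) = fun x => F x * 'D_v G x + G x * 'D_v F x.
    by apply/funext => x; apply: deriveM; exact: diff_derivable.
  by apply: SmoothAdd; exact: SmoothMul.
- have dh y : differentiable h y by apply/derivable1_diffP; exact: (sh 0%N).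
  split=> [x|v]; first exact: differentiable_comp.
  have -> : 'D_v (fun x => h (F x)) = fun x => derive1 h (F x) * 'D_v F x.
    apply/funext => x; rewrite deriveE; last exact: differentiable_comp.
    rewrite -[fun _ => _]/(h \o F) diff_comp // [LHS]/= deriv1E; last exact: (sh 0%N).
    by rewrite /= -deriveE // mulrC.
  by apply: SmoothMul => //; apply: SmoothComp => //; exact: smooth1_derive.
Qed.

Lemma smooth_expr_smooth (V : normedModType R) (F : V -> R) :
  smooth_expr F -> smooth F.
Proof.
move=> sF vs x; apply: (smooth_expr_derive _).1.
by elim: vs => //= v vs IH; apply: (smooth_expr_derive IH).2.
Qed.

Lemma smooth_expr_smooth1 (h : R -> R) : smooth_expr (h : R^o -> R) -> smooth1 h.
Proof.
move=> sh k x; apply/derivable1_diffP; apply: (smooth_expr_derive _).1.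
elim: k => // k IH; rewrite derive1nS.
have -> : derive1 (derive1n k h) = 'D_(1 : R^o) (derive1n k h : R^o -> R).
  by apply/funext => y; rewrite derive1E.
exact: (smooth_expr_derive IH).2.
Qed.

Lemma smooth_expr_affine1 (a b : R) : smooth_expr (fun x : R^o => a * x + b).
Proof.
have d (x : R) : is_derive x 1 (fun x : R => a * x + b) a by isd; ring.
apply: SmoothAffine => [x|v].
  by apply/derivable1_diffP; have [] := d x.
exists (v * a) => x.
have dx : derivable (fun x : R => a * x + b) x 1 by have [] := d x.
rewrite deriveE; last exact/derivable1_diffP.
by rewrite deriv1E //= derive1E; have [_ ->] := d x.
Qed.

Lemma smooth_expr_coord n (i : 'I_n.+1) : smooth_expr (fun x : 'rV[R]_n.+1 => x ord0 i).
Proof.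
apply: SmoothAffine => [x|v]; first exact: differentiable_coord.
exists (v ord0 i) => x.
have := @derive_mx _ _ _ _ id x v (@derivable_id _ _ x v).
by rewrite derive_id => /(congr1 (fun A : 'rV[R]_n.+1 => A ord0 i)); rewrite mxE.
Qed.

End SmoothFunctions.

(** * A flat function and a smooth bump *)

Section FlatFunction.
Context {R : realType}.

Lemma poly_le_pow (p : {poly R}) : exists n, exists2 K : R, 0 <= K &
  forall y, 1 <= y -> `|p.[y]| <= K * y ^+ n.
Proof.
elim/poly_ind: p => [|p c [n [K K0 IH]]].
  by exists 0%N, 0 => // y _; rewrite horner0 normr0 mul0r.
exists n.+1, (K + `|c|); first by rewrite addr_ge0.
move=> y y1; have y0 : 0 <= y by rewrite (le_trans ler01).
rewrite !hornerE; apply: (le_trans (ler_normD _ _)); rewrite mulrDl; apply: lerD.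
  rewrite normrM [`|y|]ger0_norm // exprSr mulrA; apply: ler_wpM2r => //.
  exact: IH.
by rewrite ler_peMr // exprn_ege1.
Qed.

(** If [p] grows at most like [y ^+ n], the term of degree [n + 2] of the exponential series gains
    [y^-2]. With [y = 1 / h] this is the [h^2] that makes the difference quotient at 0 vanish. *)
Lemma poly_exp_le (p : {poly R}) : exists2 K : R, 0 <= K &
  forall y, 1 <= y -> `|p.[y] * expR (- y)| <= K / y ^+ 2.
Proof.
have [n [K K0 pK]] := poly_le_pow p.
exists (K * (n.+2)`!%:R); first by rewrite mulr_ge0.
move=> y y1; have y0 : 0 < y by rewrite (lt_le_trans ltr01).
rewrite normrM [X in _ * X]ger0_norm ?expR_ge0 // expRN.
rewrite ler_pdivrMr ?expR_gt0 // mulrAC ler_pdivlMr ?exprn_gt0 //.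
apply: (le_trans (ler_wpM2r (sqr_ge0 y) (pK y y1))).
rewrite -!mulrA -exprD addn2; apply: ler_wpM2l => //.
have := @expR_ge1Dxn _ y n.+1 (ltW y0).
have f0 : 0 < (n.+2)`!%:R :> R by rewrite ltr0n fact_gt0.
move=> h; rewrite mulrC -ler_pdivrMr //.
by apply: le_trans h; rewrite lerDr.
Qed.

(** The polynomial parameter makes the family of functions [p(1/x) exp(-1/x)], extended by 0, closed
    under differentiation. Smoothness then needs only one derivative, computed for all [p] at
    once. *)
Definition flat (p : {poly R}) (x : R) : R :=
  if 0 < x then p.[x^-1] * expR (- x^-1) else 0.

Lemma is_derive_flat (p : {poly R}) (x : R) :
  is_derive x 1 (flat p) (flat ('X^2 * (p - p^`())) x).
Proof.
have [x0|x0|->] := ltgtP x 0.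
- rewrite /flat ltNge (ltW x0) /=.
  apply: (@near_eq_is_derive _ _ _ (fun _ : R => 0 : R)).
  by near=> y; rewrite ltNge ltW //=; near: y; exact: lt_nbhsl.
- rewrite {2}/flat x0.
  have xn : x != 0 by rewrite gt_eqF.
  have dp : is_derive x 1 (fun x => p.[x^-1]) (p^`().[x^-1] * (-1 / x ^+ 2)).
    have di : is_derive x 1 (fun y : R => y^-1) (-1 / x ^+ 2) by isd.
    have dh : is_derive x^-1 1 (horner p) p^`().[x^-1].
      by apply: DeriveDef; [exact: derivable_horner|rewrite -derive1E -derivE].
    exact: (isd_comp di dh).
  have d : is_derive x 1 (fun x => p.[x^-1] * expR (- x^-1))
      (('X^2 * (p - p^`())).[x^-1] * expR (- x^-1)).
    isd => //; rewrite hornerM hornerXn hornerD hornerN.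
    by move: p.[_] p^`().[_] (expR _) => u v w; field.
  apply: (near_eq_is_derive _ d).
  by near=> y; rewrite /flat ifT //; near: y; exact: lt_nbhsr.
- rewrite {2}/flat ltxx.
  have [K K0 pK] := poly_exp_le p.
  have fK h : `|h| <= 1 -> `|flat p h| <= K * h ^+ 2.
    move=> h1; rewrite /flat; case: ltP => h0; last by rewrite normr0 mulr_ge0 ?sqr_ge0.
    have := pK h^-1; rewrite exprVn invrK; apply.
    by rewrite invf_ge1 //; move: h1; rewrite gtr0_norm.
  have c : (fun h : R => h^-1 *: ((flat p \o shift 0) (h *: (1 : R)) - flat p 0)) @ 0^' --> (0 : R).
    apply: (@squeeze_cvgr_norm _ _ _ _ _ (fun h => K * `|h|)); last first.
      have : K * `|h| @[h --> (0 : R)^'] --> K * `|0 : R|.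
        apply: cvg_within_filter; apply: cvgM; first exact: cvg_cst.
        by apply: cvg_norm; exact: cvg_id.
      by rewrite normr0 mulr0.
    near=> h; have hn : h != 0 by near: h; exact: nbhs_dnbhs_neq.
    rewrite /= addr0 [h *: 1]mulr1 {2}/flat ltxx subr0 normrM normfV.
    rewrite mulrC ler_pdivrMr ?normr_gt0 // -mulrA -expr2 real_normK ?num_real //.
    by apply: fK; apply: ltW; near: h; exact: dnbhs0_lt.
  by apply: DeriveDef; [apply/cvg_ex; exists 0|apply/cvg_lim].
Unshelve. all: by end_near. Qed.

Lemma flat_smooth (p : {poly R}) : smooth1 (flat p).
Proof.
suff h k : exists q, derive1n k (flat p) = flat q.
  by move=> k x; have [q ->] := h k; have [] := is_derive_flat q x.
elim: k => [|k [q IH]]; first by exists p.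
exists ('X^2 * (q - q^`())); rewrite derive1nS IH.
by apply/funext => x; rewrite derive1E; have [_ ->] := is_derive_flat q x.
Qed.

Definition bump (x : R) : R := flat 1 x * flat 1 (1 - x).

Lemma bump_smooth : smooth1 bump.
Proof.
apply: smooth_expr_smooth1.
have -> : bump = fun x => flat 1 (1 * x + 0) * flat 1 (- 1 * x + 1).
  by apply/funext => x; rewrite mul1r addr0 mulN1r addrC.
by apply: SmoothMul; apply: SmoothComp;
  [exact: flat_smooth|exact: smooth_expr_affine1|exact: flat_smooth|exact: smooth_expr_affine1].
Qed.

Lemma bump_gt0 x : 0 < x < 1 -> 0 < bump x.
Proof.
move=> /andP[x0 x1]; rewrite /bump /flat x0 subr_gt0 x1 -polyC1 !hornerC !mul1r.
by apply: mulr_gt0; exact: expR_gt0.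
Qed.

Lemma bump_out x : x <= 0 \/ 1 <= x -> bump x = 0.
Proof.
rewrite /bump /flat => -[x0|x1]; first by rewrite ltNge x0 mul0r.
by rewrite [0 < 1 - x]ltNge subr_le0 x1 mulr0.
Qed.

Lemma bump_ge0 x : 0 <= bump x.
Proof.
have [x0|x0] := leP x 0; first by rewrite bump_out //; left.
have [x1|x1] := leP 1 x; first by rewrite bump_out //; right.
by rewrite ltW // bump_gt0 // x0.
Qed.

End FlatFunction.

(** * Uniform approximation by smooth functions that vanish near 1 *)

Section SmoothApproximation.
Context {R : realType}.
Local Notation mu := (@lebesgue_measure R).

Lemma primitive_left (h : R -> R) (a : R) :
  (forall x : R, {for x, continuous h}) -> (forall x, x <= a -> h x = 0) ->
  exists2 H : R -> R, (forall x : R, is_derive x 1 H (h x)) & forall x, x <= a -> H x = 0.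
Proof.
(* The integral starts at [a - 1] so that [x = a] is an interior point of the domain of integration;
   [h] vanishes on the added piece. *)
move=> ch h0; pose H x := \int[mu]_(t in `[a - 1, x]) h t.
have H0 x : x <= a -> H x = 0.
  move=> xa; rewrite /H (_ : 0 = \int[mu]_(t in `[a - 1, x]) 0); last first.
    by rewrite Rintegral_cst // mul0r.
  by apply: eq_Rintegral => t; rewrite inE /= in_itv/= => /andP[_ tx]; rewrite h0 // (le_trans tx).
exists H => // x; have [xa|ax] := ltP x a.
  rewrite h0 ?(ltW xa) //; apply: (near_eq_is_derive _ (isd_cst 0 x)).
  by near=> y; rewrite H0 //; apply: ltW; near: y; exact: lt_nbhsl.
have hi : mu.-integrable `[a - 1, x + 1] (EFin \o h) by exact: continuous_itv_integrable.
apply: (is_derive_Rintegral_itv hi); last exact: ch.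
by apply/andP; split; lra.
Unshelve. all: by end_near. Qed.

Lemma primitive_right (h : R -> R) (b : R) :
  (forall x : R, {for x, continuous h}) -> (forall x, b <= x -> h x = 0) ->
  exists2 H : R -> R, (forall x : R, is_derive x 1 H (h x)) & forall x, b <= x -> H x = 0.
Proof.
move=> ch h0.
have [|x xb|H dH H0] := @primitive_left (fun x => h (- x)) (- b).
- move=> x; apply: (@continuous_comp _ _ _ (fun x : R => - x) h).
    by apply: cvgN; exact: cvg_id.
  exact: ch.
- by rewrite h0 // lerNr.
exists (fun x => - H (- x)) => x; last by move=> bx; rewrite H0 ?oppr0 // lerN2.
have d := isdN (isd_comp (isdN (isd_id x)) (dH (- x))).
by rewrite opprK mulrN1 opprK in d.
Qed.

Lemma smooth1_continuous (h : R -> R) (x : R) : smooth1 h -> {for x, continuous h}.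
Proof. by move=> sh; exact: isd_continuous (smooth1_is_derive x sh). Qed.

(** Heine's theorem by compactness: around each point half of the local radius works for all nearby
    points. *)
Lemma within_uniform_continuous (k : R -> R) (e : R) :
  {within `[0, 1], continuous k} -> 0 < e ->
  exists2 d : R, 0 < d & forall x y, 0 <= x <= 1 -> 0 <= y <= 1 ->
    `|x - y| < d -> `|k x - k y| <= e.
Proof.
move=> ck e0.
have /compact_near_coveringP cov : compact (`[0, 1]%classic : set R) by exact: segment_compact.
pose P (d x : R) := forall y, 0 <= y <= 1 -> 0 <= x <= 1 -> `|x - y| < d -> `|k x - k y| <= e.
have : \forall d \near (0 : R)^'+, `[0, 1]%classic `<=` P d.
  apply: cov => x x01.
  have /cvgrPdist_lt /(_ (e / 2)) := (subspace_continuousP _ _).1 ck x x01.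
  rewrite divr_gt0 // => /(_ isT); rewrite /prop_near1 /within /= => /nbhs_ballP[r /= r0 rP].
  exists (ball x (r / 2), [set d : R | d < r / 2]) => /=.
    split; first by exact: nbhsx_ballx (divr_gt0 r0 _).
    by apply: nbhs_right_lt; rewrite divr_gt0.
  move=> [x' d] /= [xx' dr] y y01 x'01 x'y.
  have h1 : `|k x - k x'| < e / 2.
    by apply: rP; [apply: lt_trans xx' _; lra|rewrite /= in_itv].
  have h2 : `|k x - k y| < e / 2.
    apply: rP; last by rewrite /= in_itv.
    have -> : r = r / 2 + r / 2 by lra.
    apply: le_lt_trans (ler_distD x' _ _) _; apply: ltrD => //; exact: lt_trans dr.
  rewrite distrC in h1; apply: le_trans (ler_distD (k x) _ _) _; lra.
move=> /nbhs_ballP[d /= d0 dP]; exists (d / 2) => [|x y x01 y01]; first exact: divr_gt0.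
have bd : ball 0 d (d / 2) by rewrite /ball /= sub0r normrN gtr0_norm ?divr_gt0 //; lra.
have xin : `[0, 1]%classic x by rewrite /= in_itv.
have d20 : 0 < d / 2 by exact: divr_gt0.
exact: dP bd d20 x xin y y01 x01.
Qed.

(** [B] is the primitive of [bump] that vanishes on the right of 1. Thus [- B 0] is the integral of
    the bump, and it later serves as the normalizing constant. *)
Lemma smooth_step : exists2 B : R -> R, smooth1 B &
  [/\ B 0 < 0, forall x, x <= 0 -> B x = B 0, forall x, 1 <= x -> B x = 0 &
      forall x y, x <= y -> B x <= B y].
Proof.
have [|x x1|B dB B1] := @primitive_right bump 1.
- by move=> x; apply: smooth1_continuous; exact: bump_smooth.
- by rewrite bump_out //; right.
have mvt x y : x < y -> exists2 c, x < c < y & B y - B x = bump c * (y - x).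
  move=> xy; have [|c cxy e] := @MVT _ B bump x y xy (fun z _ => dB z).
    by apply: continuous_subspaceT => z; exact: isd_continuous (dB z).
  by exists c => //; move: cxy; rewrite in_itv.
exists B; first exact: smooth1_primitive dB bump_smooth.
split=> //.
- have [c c01] := mvt 0 1 ltr01; rewrite B1 // subr0 mulr1 sub0r => e.
  by rewrite -oppr_gt0 e bump_gt0.
- move=> x; rewrite le_eqVlt => /predU1P[->//|x0].
  have [c /andP[_ c0]] := mvt x 0 x0; rewrite bump_out ?mul0r; last by left; exact: ltW.
  by move/eqP; rewrite subr_eq0 => /eqP.
- move=> x y; rewrite le_eqVlt => /predU1P[->//|xy].
  by have [c _ e] := mvt x y xy; rewrite -subr_ge0 e mulr_ge0 ?bump_ge0 // subr_ge0 ltW.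
Qed.

Lemma smooth_expr_sum (V : normedModType R) (I : Type) (s : seq I) (F : I -> V -> R) :
  (forall i, smooth_expr (F i)) -> smooth_expr (fun x => \sum_(i <- s) F i x).
Proof.
move=> sF; elim: s => [|i s IH].
  have -> : (fun x : V => \sum_(i <- [::]) F i x) = fun _ => 0.
    by apply/funext => x; rewrite big_nil.
  exact: smooth_expr_cst.
have -> : (fun x : V => \sum_(j <- i :: s) F j x) = fun x => F i x + \sum_(j <- s) F j x.
  by apply/funext => x; rewrite big_cons.
exact: SmoothAdd.
Qed.

(* A partition of unity of step 1/n, built from differences of translates of
   the smooth step, is applied to the samples [k (j / n)]. *)
Lemma smooth_approximation (k : R -> R) (b e : R) :
  {within `[0, 1], continuous k} -> b < 1 ->
  (forall x, b <= x <= 1 -> k x = 0) -> 0 < e ->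
  exists2 g : R -> R, smooth1 g &
    (exists2 c : R, c < 1 & forall x, c <= x -> g x = 0) /\
    (forall x, 0 <= x <= 1 -> `|g x - k x| <= e).
Proof.
move=> ck b1 kb e0.
have [d d0 kd] := within_uniform_continuous ck e0.
have [B sB [B0 Bneg B1 Bhomo]] := smooth_step.
(* The second bound gives vanishing near 1: for [x >= (1 + b) / 2], a sample point at distance less
   than [1 / N] from [x] lies beyond [b], where [k] is 0. *)
pose d' := Num.min d ((1 - b) / 2).
have d'0 : 0 < d' by rewrite lt_min d0 divr_gt0 // subr_gt0.
have [n nd] : exists n : nat, (n.+1%:R)^-1 < d'.
  exists (Num.truncn d'^-1); rewrite invf_plt ?posrE ?ltr0n //; exact: truncnS_gt.
move: nd; rewrite lt_min => /andP[nd nb].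
set N : R := n.+1%:R in nd nb; have N0 : 0 < N by rewrite /N ltr0n.
pose th (j : nat) x := B (N * x - j%:R + 1) - B (N * x - j%:R).
have th_ge0 j x : 0 <= th j x by rewrite subr_ge0 Bhomo // lerDl.
have th_out j x : N^-1 <= `|x - j%:R / N| -> th j x = 0.
  have -> : `|x - j%:R / N| = `|N * x - j%:R| / N.
    have -> : N * x - j%:R = N * (x - j%:R / N) by field; rewrite gt_eqF.
    by rewrite normrM gtr0_norm // mulrAC divff ?mul1r // gt_eqF.
  rewrite -{1}[N^-1]mul1r ler_pM2r ?invr_gt0 // /th; move: (N * x - j%:R) => y.
  rewrite ler_normr => /orP[y1|y1]; first by rewrite !B1 ?subrr //; lra.
  by rewrite (Bneg (y + 1)) ?(Bneg y) ?subrr //; lra.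
(* The sum telescopes to [B (N x + 1) - B (N x - N)]. The first term is 0 because its argument is at
   least 1, the second is [B 0] because its argument is nonpositive. *)
have th_sum x : 0 <= x <= 1 -> \sum_(0 <= j < n.+2) th j x = - B 0.
  move=> /andP[x0 x1].
  have -> : \sum_(0 <= j < n.+2) th j x =
      \sum_(0 <= j < n.+2) (- B (N * x - j.+1%:R + 1) - - B (N * x - j%:R + 1)).
    apply: eq_bigr => j _; rewrite /th.
    have -> : N * x - j.+1%:R + 1 = N * x - j%:R by rewrite -natr1; ring.
    by rewrite opprK addrC.
  rewrite (telescope_sumr (fun j => - B (N * x - j%:R + 1))) // (B1 (N * x - 0%:R + 1)); last first.
    by rewrite subr0 lerDr mulr_ge0 // ltW.
  rewrite oppr0 subr0 Bneg // -natr1 -/N.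
  have : N * x <= N by rewrite ler_piMr // ltW.
  by lra.
have th_diff j x : (j < n.+2)%N -> 0 <= x <= 1 ->
    `|(k (j%:R / N) - k x) * th j x| <= e * th j x.
  move=> jn x01; rewrite normrM [`|th j x|]ger0_norm //.
  have [far|near] := leP N^-1 `|x - j%:R / N|; first by rewrite th_out // !mulr0.
  apply: ler_wpM2r => //; apply: kd => //; last by rewrite distrC (lt_trans near).
  by rewrite divr_ge0 ?(ltW N0) //= ler_pdivrMr // mul1r ler_nat.
pose g x := \sum_(0 <= j < n.+2) (k (j%:R / N) / - B 0) * th j x.
exists g.
  apply: smooth_expr_smooth1; apply: smooth_expr_sum => j.
  apply: SmoothMul; first exact: smooth_expr_cst.
  have -> : th j = fun x => B (N * x + (1 - j%:R)) + (-1) * B (N * x + - j%:R).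
    by apply/funext => x; rewrite /th mulN1r; congr (B _ - _); ring.
  apply: SmoothAdd; first by apply: SmoothComp => //; exact: smooth_expr_affine1.
  apply: SmoothMul; first exact: smooth_expr_cst.
  by apply: SmoothComp => //; exact: smooth_expr_affine1.
split.
  exists ((1 + b) / 2) => [|x xb]; first by lra.
  rewrite /g big_nat big1 // => j /andP[_ jn].
  have [far|near] := leP N^-1 `|x - j%:R / N|; first by rewrite th_out // mulr0.
  rewrite kb ?mul0r //; apply/andP; split; last by rewrite ler_pdivrMr // mul1r ler_nat.
  by move: near; rewrite ltr_norml; move: (j%:R / N) (N^-1) nb => y z; lra.
move=> x x01.
have -> : g x - k x = (\sum_(0 <= j < n.+2) (k (j%:R / N) - k x) * th j x) / - B 0.
  have e1 : k x = (\sum_(0 <= j < n.+2) k x * th j x) / - B 0.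
    by rewrite -mulr_sumr th_sum // mulfK // oppr_eq0 lt_eqF.
  rewrite {1}e1 /g !mulr_suml -sumrB; apply: eq_bigr => j _.
  by rewrite mulrAC -mulrBl -mulrBl.
rewrite normrM normfV [`|- B 0|]gtr0_norm ?oppr_gt0 // ler_pdivrMr ?oppr_gt0 //.
apply: (le_trans (ler_norm_sum _ _ _)); rewrite -(th_sum x x01) mulr_sumr big_nat [leRHS]big_nat.
by apply: ler_sum => j /andP[_ jn]; exact: th_diff.
Qed.

End SmoothApproximation.

(** * A logarithmic increment bound and functions of the squared radius *)

Section SquareProfile.
Context {R : realType}.

(** The functions [d + K ln] and [d - K ln] have derivatives [(e + K) / x] and [(e - K) / x] of
    constant sign, so the mean value theorem applied to each gives one side of the bound. *)
Lemma log_lipschitz (d e : R -> R) (K r s : R) : 0 < r -> r <= s ->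
  {within `[r, s], continuous d} ->
  (forall x, r < x < s -> is_derive x 1 d (e x / x)) ->
  (forall x, r < x < s -> `|e x| <= K) ->
  `|d s - d r| <= K * (ln s - ln r).
Proof.
move=> r0; rewrite le_eqVlt => /predU1P[<- _ _ _|rs cd dd eK].
  by rewrite !subrr normr0 mulr0.
have mvt a : exists2 c, r < c < s &
    (d s + a * ln s) - (d r + a * ln r) = (e c + a) / c * (s - r).
  have [| |c] := @MVT _ (fun x => d x + a * ln x) (fun x => (e x + a) / x) r s rs.
  - move=> x; rewrite in_itv/= => rxs; have d1 := dd x rxs; have /andP[rx _] := rxs.
    have x0 := lt_trans r0 rx.
    by isd => //; field; rewrite gt_eqF.
  - apply/subspace_continuousP => x xrs; apply: cvgD.
      exact: (subspace_continuousP _ _).1 cd _ xrs.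
    apply: cvgM; first exact: cvg_cst.
    move: xrs; rewrite /= in_itv/= => /andP[rx _].
    by apply: cvg_within_filter; exact: (continuous_ln (lt_le_trans r0 rx)).
  - by rewrite in_itv/= => rcs ec; exists c.
have pos c : r < c < s -> 0 < (s - r) / c.
  by move=> /andP[rc _]; rewrite divr_gt0 ?subr_gt0 // (lt_trans r0).
have [c1 c1rs e1] := mvt K; have [c2 c2rs e2] := mvt (- K).
have p1 : 0 <= (e c1 + K) / c1 * (s - r).
  rewrite mulrAC -mulrA; apply: mulr_ge0; last exact: ltW (pos _ c1rs).
  by have := eK _ c1rs; rewrite ler_norml => /andP[]; lra.
have p2 : 0 <= - ((e c2 - K) / c2 * (s - r)).
  rewrite mulrAC -mulrA -mulNr; apply: mulr_ge0; last exact: ltW (pos _ c2rs).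
  by have := eK _ c2rs; rewrite ler_norml => /andP[]; lra.
rewrite -e1 in p1; rewrite -e2 in p2; rewrite ler_norml.
move: (d s) (d r) (ln s) (ln r) p1 p2 => w x y z; clear.
by move=> p1 p2; apply/andP; split; lra.
Qed.

Lemma enorm_sqr (x : 'rV[R]_2) :
  enorm x ^+ 2 = x ord0 ord0 * x ord0 ord0 + x ord0 ord_max * x ord0 ord_max.
Proof.
rewrite sqr_sqrtr; last by apply: sumr_ge0 => i _; exact: sqr_ge0.
rewrite !big_ord_recl big_ord0 addr0 !expr2; congr (_ + x _ _ * x _ _); exact: val_inj.
Qed.

(** The radius is not smooth at the origin but its square is a polynomial in the coordinates. This
    is why the approximants are functions of [r ^+ 2]. *)
Lemma square_radial_test (h : R -> R) (c : R) : smooth1 h -> c < 1 ->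
  (forall x, c <= x -> h x = 0) -> radial_test_fun (fun r => h (r ^+ 2)).
Proof.
move=> sh c1 h0; rewrite /radial_test_fun /test_fun.
have -> : (fun x : 'rV[R]_2 => h (enorm x ^+ 2)) =
    fun x => h (x ord0 ord0 * x ord0 ord0 + x ord0 ord_max * x ord0 ord_max).
  by apply/funext => x; rewrite enorm_sqr.
have sF := SmoothAdd (SmoothMul (@smooth_expr_coord R 1 ord0) (smooth_expr_coord ord0))
  (SmoothMul (@smooth_expr_coord R 1 ord_max) (smooth_expr_coord ord_max)).
set q := (fun x : 'rV[R]_2 => _ + _) in sF.
have sub : supp (fun x => h (q x)) `<=` [set x | q x <= c].
  rewrite /supp closureE => x; apply; split.
    apply: (@preimage_closed _ _ q [set y | y <= c]); last exact: closed_le.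
    by move=> x' _; apply: differentiable_continuous; exact: (smooth_expr_derive sF).1.
  by move=> y /= hy; rewrite leNgt; apply/negP => /ltW/h0 e; rewrite e eqxx in hy.
split.
- exact: smooth_expr_smooth (SmoothComp sh sF).
- apply: bounded_closed_compact; last exact: closed_closure.
  exists 1; split; first exact: num_real.
  move=> M M1 x /sub /= qx; apply: le_trans (ltW M1).
  rewrite [`|x|]mx_normrE; apply: bigmax_le => // -[i j] _ /=; rewrite ord1.
  have hj : x ord0 j ^+ 2 <= 1 ^+ 2.
    rewrite expr1n; apply: le_trans (ltW c1); apply: le_trans qx; rewrite /q -!expr2.
    have := sqr_ge0 (x ord0 ord0); have := sqr_ge0 (x ord0 ord_max).
    case: (unliftP ord0 j) => [j' ->|->]; last by lra.
    by rewrite (ord1 j') (_ : lift ord0 ord0 = ord_max); [lra|exact: val_inj].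
  by rewrite -(ler_sqr (x := `|x ord0 j|)) ?nnegrE // real_normK ?num_real.
- move=> x /sub /= qx; rewrite -(@ltr_sqr _ (enorm x)) ?nnegrE ?sqrtr_ge0 // enorm_sqr expr1n.
  exact: le_lt_trans c1.
Qed.

End SquareProfile.

(** * From a profile [s] to a solution [u] *)

Section Profile.
Context {R : realType}.
Local Notation mu := (@lebesgue_measure R).
(* [sig] plays the role of [- u' / r] and [G] is a majorant of the source term
   that vanishes at 0. *)
Variables (f : R -> R) (lam C : R) (sig J G : R -> R).
Hypothesis f_L1 : mu.-integrable `[0, 1] (fun r : R => (f r * r)%:E).
Hypothesis sig1 : sig 1 = 0.
Hypothesis sig_ge0 : forall r : R, 0 < r <= 1 -> 0 <= sig r.
Hypothesis sig_nincr : forall r s : R, 0 < r -> r <= s -> s <= 1 -> sig s <= sig r.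
Hypothesis sig_le : forall r : R, 0 < r <= 1 -> sig r <= C / qroot r.
Hypothesis sig_cvg1 : sig r @[r --> 1^'-] --> 0.
Hypothesis is_derive_sig : forall r : R, 0 < r < 1 ->
  is_derive r 1 sig (- (J r / r ^+ 3)).
Hypothesis is_derive_J : forall r : R, 0 < r < 1 ->
  is_derive r 1 J (r * ((r * sig r) ^+ 2 / 2 + lam * mass f r)).
Hypothesis J_ge0 : forall r : R, 0 <= r <= 1 -> 0 <= J r.
Hypothesis J_le : forall r : R, 0 <= r <= 1 -> J r <= G r * r ^+ 2 / 2.
Hypothesis lam_mass_ge0 : forall r : R, 0 <= r <= 1 -> 0 <= lam * mass f r.
Hypothesis source_le_G : forall r : R, 0 < r <= 1 ->
  (r * sig r) ^+ 2 / 2 + lam * mass f r <= G r.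
Hypothesis G_homo : forall r s : R, 0 <= r -> r <= s -> s <= 1 -> G r <= G s.
Hypothesis G_cvg0 : G r @[r --> 0^'+] --> 0.
Hypothesis C_ge0 : 0 <= C.
Implicit Types r s t : R.

Definition prof_u1 r : R := - (r * sig r).

Definition prof_u2 r : R := J r / r ^+ 2 - sig r.

Definition prof_u r : R :=
  \int[mu]_(t in `[0, r]) prof_u1 t - \int[mu]_(t in `[0, 1]) prof_u1 t.

Lemma qroot_ge0 r : 0 <= qroot r. Proof. exact: sqrtr_ge0. Qed.

Lemma r_sig_le r : 0 < r <= 1 -> r * sig r <= C * qroot r ^+ 3.
Proof.
move=> r01; have /andP[r0 _] := r01; have q0 := qroot_gt0 r0.
apply: (le_trans (ler_wpM2l (ltW r0) (sig_le r01))).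
rewrite -{1}(qroot_expr4 (ltW r0)) le_eqVlt; apply/orP; left; apply/eqP.
by field; rewrite gt_eqF.
Qed.

Lemma qroot_homo r s : 0 <= r -> r <= s -> qroot r <= qroot s.
Proof.
move=> r0 rs; by rewrite /qroot ler_sqrt ?sqrtr_ge0 // ler_sqrt // (le_trans r0).
Qed.

Lemma norm_u1_le r s : 0 < r -> r <= s -> s <= 1 -> `|prof_u1 r| <= C * qroot s.
Proof.
move=> r0 rs s1; have r1 := le_trans rs s1.
have r01 : 0 < r <= 1 by rewrite r0.
rewrite normrN ger0_norm ?mulr_ge0 ?sig_ge0 ?(ltW r0) //.
apply: (le_trans (r_sig_le r01)); apply: ler_wpM2l => //.
apply: (@le_trans _ _ (qroot r)); last exact: qroot_homo (ltW r0) rs.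
rewrite exprS ler_piMr ?qroot_ge0 // exprn_ile1 ?qroot_ge0 // qroot_le1 //.
Qed.

Lemma is_derive_u1 r : 0 < r < 1 -> is_derive r 1 prof_u1 (prof_u2 r).
Proof.
move=> r01; have /andP[r0 _] := r01; have d := is_derive_sig r01.
by rewrite /prof_u1; isd; rewrite /prof_u2; field; rewrite gt_eqF.
Qed.

Lemma is_derive_u2 r : 0 < r < 1 -> is_derive r 1 prof_u2
  (((r * sig r) ^+ 2 / 2 + lam * mass f r) / r - J r / r ^+ 3).
Proof.
move=> r01; have /andP[r0 _] := r01; have d := is_derive_sig r01.
have d' := is_derive_J r01.
have -> : prof_u2 = fun r => J r * (r ^+ 2)^-1 + - sig r by [].
isd; first by rewrite expf_neq0 // gt_eqF.
by field; rewrite gt_eqF.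
Qed.

Lemma u1_integrable : mu.-integrable `[0, 1] (EFin \o prof_u1).
Proof.
apply: (@bounded_itv_integrable _ _ _ _ (C * qroot 1)).
  apply: continuous_oo_measurable => r; rewrite in_itv/= => r01.
  exact: isd_continuous (is_derive_u1 r01).
move=> r; rewrite in_itv/= => /andP[]; rewrite le_eqVlt => /predU1P[<- _|r0 r1].
  by rewrite /prof_u1 mul0r oppr0 normr0 mulr_ge0 ?qroot_ge0.
exact: norm_u1_le.
Qed.

Lemma is_derive_u r : 0 < r < 1 -> is_derive r 1 prof_u (prof_u1 r).
Proof.
move=> r01; have d := is_derive_Rintegral_itv u1_integrable r01
  (isd_continuous (is_derive_u1 r01)).
rewrite /prof_u; set c := \int[mu]_(t in `[0, 1]) _.
by isd; ring.
Qed.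

Lemma u_continuous_within : {within `[0, 1], continuous prof_u}.
Proof.
apply/subspace_continuousP => x x01; apply: cvgB; last exact: cvg_cst.
exact: (subspace_continuousP _ _).1 (parameterized_integral_continuous ler01 u1_integrable) _ x01.
Qed.

Lemma u_at1 : prof_u 1 = 0. Proof. by rewrite /prof_u subrr. Qed.

Lemma u_MVT r s : 0 <= r -> r < s -> s <= 1 ->
  exists2 c, r < c < s & prof_u s - prof_u r = prof_u1 c * (s - r).
Proof.
move=> r0 rs s1.
have [c] : exists2 c, c \in `]r, s[ & prof_u s - prof_u r = prof_u1 c * (s - r).
  apply: MVT => //.
    move=> x; rewrite in_itv/= => /andP[rx xs]; apply: is_derive_u.
    by rewrite (le_lt_trans r0 rx) (lt_le_trans xs).
  apply: continuous_subspaceW u_continuous_within.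
  by apply: subset_itv; rewrite bnd_simp.
by rewrite in_itv/= => crs ?; exists c.
Qed.

Lemma qroot_cvg0 : qroot r @[r --> (0 : R)^'+] --> (0 : R).
Proof.
apply: cvg_at_right_filter.
have : qroot r @[r --> (0 : R)] --> qroot 0.
  apply: (@continuous_comp _ _ _ (@Num.sqrt R) (@Num.sqrt R)); exact: sqrt_continuous.
by rewrite /qroot !sqrtr0.
Qed.

Lemma u_deriv0 : (prof_u r - prof_u 0) / r @[r --> 0^'+] --> 0.
Proof.
apply: (@squeeze_cvgr_norm _ _ _ _ _ (fun r => C * qroot r)); last first.
  have : C * qroot r @[r --> (0 : R)^'+] --> C * 0.
    by apply: cvgM; [exact: cvg_cst|exact: qroot_cvg0].
  by rewrite mulr0.
near=> r.
have r0 : 0 < r by near: r; exact: nbhs_right_gt.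
have r1 : r <= 1 by near: r; exact: nbhs_right_le.
have [c /andP[c0 cr] ->] := u_MVT (lexx 0) r0 r1.
rewrite subr0 mulfK ?gt_eqF //; apply: norm_u1_le => //; exact: ltW.
Unshelve. all: by end_near. Qed.

(** The quotient equals [u'(c)] for some [c] between [r] and 1, and
    [|u'(c)| = c sig(c) <= sig(c) <= sig(r)] by monotonicity. *)
Lemma u_deriv1 : (prof_u r - prof_u 1) / (r - 1) @[r --> 1^'-] --> 0.
Proof.
apply: (@squeeze_cvgr_norm _ _ _ _ _ sig); last exact: sig_cvg1.
near=> r.
have r0 : 0 < r by near: r; apply: nbhs_left_gt.
have r1 : r < 1 by near: r; exact: nbhs_left_lt.
have [c /andP[rc c1] e] := u_MVT (ltW r0) r1 (lexx 1).
have c0 := lt_trans r0 rc.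
rewrite -opprB e -[r - 1]opprB invrN mulrN mulNr opprK mulfK ?subr_eq0 ?gt_eqF //.
have c01 : 0 < c <= 1 by rewrite c0 ltW.
rewrite normrN ger0_norm ?mulr_ge0 ?sig_ge0 ?(ltW c0) //.
apply: (@le_trans _ _ (sig c)); first by rewrite ler_piMl ?sig_ge0 // ltW.
by apply: sig_nincr => //; exact: ltW.
Unshelve. all: by end_near. Qed.

Lemma derive1_u r : 0 < r < 1 -> derive1 prof_u r = prof_u1 r.
Proof. by apply: (@derive1_oo _ prof_u prof_u) => // x; exact: is_derive_u. Qed.

Lemma derive2_u r : 0 < r < 1 -> derive1n 2 prof_u r = prof_u2 r.
Proof.
rewrite derive1nS; apply: (@derive1_oo _ _ prof_u1); last exact: is_derive_u1.
exact: derive1_u.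
Qed.

Lemma u_boundary_conditions : boundary_conditions prof_u.
Proof.
split=> //; [exact: u_continuous_within|exact: u_deriv0|exact: u_at1|exact: u_deriv1|].
split.
  have n01 : \forall r \near (0 : R)^'+, 0 < r < 1.
    near=> r; apply/andP; split; near: r; [exact: nbhs_right_gt|exact: nbhs_right_lt].
  move=> [|[|[|//]]] _; apply: filterS n01 => r r01.
  - by have [] := is_derive_u r01.
  - have [] // := is_derive_oo derive1_u is_derive_u1 r01.
  - have [] // := is_derive_oo derive2_u is_derive_u2 r01.
apply: (@squeeze_cvgr_norm _ _ _ _ _ (fun r => G r + G r)); last first.
  have : G r + G r @[r --> (0 : R)^'+] --> (0 + 0 : R) by apply: cvgD; exact: G_cvg0.
  by rewrite addr0.
near=> r.
have r01 : 0 < r < 1.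
  by apply/andP; split; near: r; [exact: nbhs_right_gt|exact: nbhs_right_lt].
have /andP[r0 r1] := r01; have r01' : 0 <= r <= 1 by rewrite !ltW.
rewrite derive1nS (derive1_oo derive2_u is_derive_u2 r01).
(* Thus [r u'''(r)] is the source term minus [J r / r ^+ 2], and both are at most [G r]. *)
have -> : r * (((r * sig r) ^+ 2 / 2 + lam * mass f r) / r - J r / r ^+ 3) =
    ((r * sig r) ^+ 2 / 2 + lam * mass f r) - J r / r ^+ 2.
  by field; rewrite gt_eqF.
apply: (le_trans (ler_normB _ _)).
have sg := source_le_G (introT andP (conj r0 (ltW r1))).
have s0 : 0 <= (r * sig r) ^+ 2 / 2 + lam * mass f r.
  by rewrite addr_ge0 ?lam_mass_ge0 // divr_ge0 // sqr_ge0.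
have G0 := le_trans s0 sg.
rewrite ger0_norm // ger0_norm ?divr_ge0 ?J_ge0 ?sqr_ge0 //.
apply: lerD => //; rewrite ler_pdivrMr ?exprn_gt0 //.
apply: (le_trans (J_le r01')).
have : 0 <= G r * r ^+ 2 by rewrite mulr_ge0 ?sqr_ge0.
by lra.
Unshelve. all: by end_near. Qed.

Let C2 : R := G 1 / 2 + C.

Lemma G_ge0 r : 0 < r <= 1 -> 0 <= G r.
Proof.
move=> r01; have /andP[r0 r1] := r01; apply: le_trans (source_le_G r01).
by rewrite addr_ge0 ?lam_mass_ge0 ?r1 ?(ltW r0) // divr_ge0 // sqr_ge0.
Qed.

Lemma C2_ge0 : 0 <= C2.
Proof. by rewrite addr_ge0 // divr_ge0 // G_ge0 // ltr01 lexx. Qed.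

Lemma invq_ge1 r : 0 < r <= 1 -> 1 <= (qroot r)^-1.
Proof. by move=> /andP[r0 r1]; rewrite invf_ge1 ?qroot_gt0 // qroot_le1. Qed.

Lemma J_div_le r : 0 < r <= 1 -> 0 <= J r / r ^+ 2 <= G 1 / 2 / qroot r.
Proof.
move=> r01; have /andP[r0 r1] := r01.
have r01' : 0 <= r <= 1 by rewrite ltW.
rewrite divr_ge0 ?J_ge0 ?sqr_ge0 //=.
have G1 : 0 <= G 1 / 2 by rewrite divr_ge0 // G_ge0 // ltr01 lexx.
apply: (@le_trans _ _ (G 1 / 2)); last by rewrite ler_peMr // invq_ge1.
rewrite ler_pdivrMr ?exprn_gt0 //; apply: (le_trans (J_le r01')).
rewrite mulrAC; apply: ler_wpM2r; first exact: sqr_ge0.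
by apply: ler_wpM2r => //; apply: G_homo => //; exact: ltW.
Qed.

Lemma norm_u2_le r : 0 < r <= 1 -> `|prof_u2 r| <= C2 / qroot r.
Proof.
move=> r01; rewrite /prof_u2 /C2; apply: (le_trans (ler_normB _ _)).
have /andP[j0 j1] := J_div_le r01.
by rewrite ger0_norm // ger0_norm ?sig_ge0 // mulrDl lerD // sig_le.
Qed.

Lemma qroot_sqr_le r (K x : R) : 0 < r <= 1 -> `|x| <= K / qroot r ->
  `|x ^+ 2 * r| <= K ^+ 2.
Proof.
move=> r01 xK; have /andP[r0 r1] := r01; have q0 := qroot_gt0 r0.
rewrite ger0_norm; last by apply: mulr_ge0; [exact: sqr_ge0|exact: ltW].
have -> : x ^+ 2 = `|x| ^+ 2 by rewrite real_normK ?num_real.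
have : `|x| ^+ 2 <= (K / qroot r) ^+ 2.
  by rewrite ler_sqr ?nnegrE ?(le_trans _ xK).
move=> /(ler_wpM2r (ltW r0)) /le_trans; apply.
rewrite -{2}(qroot_expr4 (ltW r0)).
have -> : (K / qroot r) ^+ 2 * qroot r ^+ 4 = K ^+ 2 * qroot r ^+ 2 by field; rewrite gt_eqF.
by rewrite ler_piMr ?sqr_ge0 // exprn_ile1 // ?qroot_le1 // ltW.
Qed.

Lemma prof_u1_div r : 0 < r -> prof_u1 r / r = - sig r.
Proof. by move=> r0; rewrite /prof_u1; field; rewrite gt_eqF. Qed.

(** A singularity of order [r^(-1/4)] is harmless: the integrand is at most [K ^+ 2]. *)
Lemma weighted_square_integrable (h : R -> R) (K : R) :
  {in `]0, 1[, continuous h} ->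
  (forall r, 0 < r <= 1 -> `|h r| <= K / qroot r) ->
  mu.-integrable `[0, 1] (EFin \o (fun r => h r ^+ 2 * r)).
Proof.
move=> ch hK; apply: (@bounded_itv_integrable _ _ _ _ (K ^+ 2)).
  apply: continuous_oo_measurable => r r01; apply: cvgM; last exact: cvg_id.
  by rewrite expr2; under eq_cvg do rewrite expr2; apply: cvgM; exact: ch.
move=> r; rewrite in_itv/= => /andP[]; rewrite le_eqVlt => /predU1P[<- _|r0 r1].
  by rewrite mulr0 normr0 sqr_ge0.
by apply: qroot_sqr_le; rewrite ?r0 //; apply: hK; rewrite r0.
Qed.

Lemma u1_cont : {in `]0, 1[, continuous prof_u1}.
Proof. by move=> r; rewrite in_itv/= => /is_derive_u1/isd_continuous. Qed.

Lemma u2_cont : {in `]0, 1[, continuous prof_u2}.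
Proof. by move=> r; rewrite in_itv/= => /is_derive_u2/isd_continuous. Qed.

Lemma u_W22 : W22 prof_u prof_u1 prof_u2.
Proof.
split.
- by apply: weak_derivative_classical; [exact: is_derive_u|exact: u1_cont].
- by apply: weak_derivative_classical; [exact: is_derive_u1|exact: u2_cont].
- exact: weighted_square_integrable u2_cont norm_u2_le.
- apply: (@weighted_square_integrable (fun r => prof_u1 r / r) C).
    move=> r; rewrite in_itv/= => r01; have /andP[r0 _] := r01; have d := is_derive_u1 r01.
    by apply: (@isd_continuous _ (fun r => prof_u1 r / r)); isd; [rewrite gt_eqF|].
  move=> r r01; have /andP[r0 _] := r01.
  by rewrite prof_u1_div // normrN ger0_norm ?sig_ge0 // sig_le.
Qed.

(** After [mass_by_parts] has moved the derivative off [mass f], the whole identity is the integral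
    of one function [e] that has an explicit antiderivative [E], vanishing at 0 and near 1. The
    fourth powers of [qroot] absorb every singularity at 0. *)
Lemma u_weak_equation : weak_equation lam f prof_u1 prof_u2.
Proof.
move=> phi /radial_test_profile[g [g1 [g2 [[dg dg1 cg2 g10] [b /andP[b0 b1] out] phig]]]].
have cg1 x : {for x, continuous g1} by exact: isd_continuous (dg1 x).
have cg x : {for x, continuous g} by exact: isd_continuous (dg x).
have g1_at1 : g 1 = 0 by have [] := out 1; rewrite ?b1 ?lexx.
pose A r := prof_u2 r + prof_u1 r / r.
have -> : \int[mu]_(r in `[0, 1])
      (A r * (derive1n 2 phi r + derive1 phi r / r) * r) =
    \int[mu]_(r in `[0, 1]) (A r * (g2 r + g1 r / r) * r).
  apply: eq_Rintegral => r; rewrite inE /= in_itv/= => /andP[].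
  rewrite le_eqVlt => /predU1P[<- _|r0 r1]; first by rewrite !mulr0.
  by have [_ e1 e2] := phig r r0; rewrite /= in e2; rewrite /= e2 e1.
have -> : \int[mu]_(r in `[0, 1]) (prof_u1 r * prof_u2 r * phi r) =
    \int[mu]_(r in `[0, 1]) (prof_u1 r * prof_u2 r * g r).
  apply: eq_Rintegral => r; rewrite inE /= in_itv/= => /andP[].
  rewrite le_eqVlt => /predU1P[<- _|r0 r1]; last by have [-> _ _] := phig r r0.
  by rewrite /prof_u1 !mul0r oppr0 !mul0r.
have -> : \int[mu]_(r in `[0, 1]) (f r * phi r * r) =
    \int[mu]_(r in `[0, 1]) (f r * g r * r).
  apply: eq_Rintegral => r; rewrite inE /= in_itv/= => /andP[].
  rewrite le_eqVlt => /predU1P[<- _|r0 r1]; last by have [-> _ _] := phig r r0.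
  by rewrite !mulr0.
have := mass_by_parts f_L1 dg cg1 g1_at1.
set I1 := \int[mu]_(r in _) (A r * _ * _); set I2 := \int[mu]_(r in _) (_ * g r).
set I3 := \int[mu]_(r in _) (f r * g r * r); set I4 := \int[mu]_(r in _) (mass f r * g1 r).
move=> I4E.
suff h : I1 + lam * I4 - I2 = 0.
  by rewrite I4E in h; clear I4E; move: I1 I2 I3 h => x y z; lra.
pose e r := A r * (g2 r + g1 r / r) * r + lam * (mass f r * g1 r) - prof_u1 r * prof_u2 r * g r.
(* The bound [M * r] for [g1] comes from [g1 0 = 0] and the mean value theorem; it keeps [g1 r / r]
   bounded. *)
have [M M0 [gM g1M g2M]] : exists2 M, 0 <= M &
    [/\ forall r, 0 <= r <= 1 -> `|g r| <= M,
        forall r, 0 <= r <= 1 -> `|g1 r| <= M * r &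
        forall r, 0 <= r <= 1 -> `|g2 r| <= M].
  have [M1 M10 gM] := continuous_itv_bounded ler01 (fun x _ => cg x).
  have [M2 M20 g2M] := continuous_itv_bounded ler01 (fun x _ => cg2 x).
  exists (M1 + M2); first exact: addr_ge0.
  split=> r r01; have /andP[r0 r1] := r01.
  - by apply: (le_trans (gM r r01)); rewrite lerDl.
  - move: r0; rewrite le_eqVlt => /predU1P[<-|r0]; first by rewrite g10 normr0 mulr0.
    have [|c crs ec] := @MVT _ g1 g2 0 r r0 (fun x _ => dg1 x).
      by apply: continuous_subspaceT.
    rewrite g10 !subr0 in ec; rewrite ec normrM [`|r|]gtr0_norm // ler_wpM2r ?(ltW r0) //.
    move: crs; rewrite in_itv/= => /andP[c0 cr].
    have : `|g2 c| <= M2 by apply: g2M; rewrite (ltW c0) (le_trans (ltW cr)).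
    by move=> /le_trans; apply; rewrite lerDr.
  - by apply: (le_trans (g2M r r01)); rewrite lerDr.
pose C3 := C2 + C; have C30 : 0 <= C3 by rewrite addr_ge0 ?C2_ge0.
have A_le r : 0 < r <= 1 -> `|A r| <= C3 / qroot r.
  move=> r01; have /andP[r0 _] := r01.
  rewrite /A prof_u1_div // /C3 mulrDl; apply: (le_trans (ler_normB _ _)).
  by rewrite lerD ?norm_u2_le // ger0_norm ?sig_ge0 // sig_le.
have qpow n r : 0 < r <= 1 -> qroot r ^+ n.+1 <= qroot r.
  move=> /andP[r0 r1]; rewrite exprS ler_piMr ?qroot_ge0 //.
  by rewrite exprn_ile1 ?qroot_ge0 // qroot_le1.
pose t1 r := A r * (g2 r + g1 r / r) * r; pose t2 r := mass f r * g1 r.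
pose t3 r := prof_u1 r * prof_u2 r * g r.
have t1_le r : 0 < r <= 1 -> `|t1 r| <= C3 * (2 * M) * qroot r.
  move=> r01; have /andP[r0 r1] := r01; have q0 := qroot_gt0 r0.
  have r01' : 0 <= r <= 1 by rewrite ltW.
  have h : `|g2 r + g1 r / r| <= 2 * M.
    apply: (le_trans (ler_normD _ _)).
    have : `|g1 r / r| <= M by rewrite normrM normfV [`|r|]gtr0_norm // ler_pdivrMr // g1M.
    by have := g2M r r01'; lra.
  rewrite /t1 !normrM [`|r|]gtr0_norm //.
  apply: (@le_trans _ _ (C3 / qroot r * (2 * M) * r)).
    by apply: ler_wpM2r; [exact: ltW|apply: ler_pM => //; exact: A_le].
  rewrite -{2}(qroot_expr4 (ltW r0)).
  have -> : C3 / qroot r * (2 * M) * qroot r ^+ 4 = C3 * (2 * M) * qroot r ^+ 3 by field; rewrite gt_eqF.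
  by apply: ler_wpM2l; [rewrite !mulr_ge0|exact: qpow].
have t2_le r : 0 < r <= 1 -> `|lam * t2 r| <= G 1 * M * qroot r.
  move=> r01; have /andP[r0 r1] := r01; have r01' : 0 <= r <= 1 by rewrite ltW.
  rewrite /t2 mulrA normrM; have lm := lam_mass_ge0 r01'.
  rewrite ger0_norm // -mulrA; apply: ler_pM => //.
    apply: (@le_trans _ _ (G r)); last by apply: G_homo => //; exact: ltW.
    by apply: le_trans (source_le_G r01); rewrite lerDr divr_ge0 // sqr_ge0.
  apply: (le_trans (g1M r r01')); apply: ler_wpM2l => //.
  by rewrite -{1}(qroot_expr4 (ltW r0)); exact: qpow.
have u1_le r : 0 < r <= 1 -> `|prof_u1 r| <= C * qroot r ^+ 3.
  move=> r01; have /andP[r0 r1] := r01.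
  by rewrite normrN ger0_norm ?mulr_ge0 ?sig_ge0 ?(ltW r0) // r_sig_le.
have t3_le r : 0 < r <= 1 -> `|t3 r| <= C * C2 * M * qroot r.
  move=> r01; have /andP[r0 r1] := r01; have q0 := qroot_gt0 r0.
  have r01' : 0 <= r <= 1 by rewrite ltW.
  rewrite /t3 !normrM.
  apply: (@le_trans _ _ (C * qroot r ^+ 3 * (C2 / qroot r) * M)).
    apply: ler_pM; rewrite ?mulr_ge0 ?gM //; apply: ler_pM => //; [exact: u1_le|exact: norm_u2_le].
  have -> : C * qroot r ^+ 3 * (C2 / qroot r) * M = C * C2 * M * qroot r ^+ 2 by field; rewrite gt_eqF.
  by apply: ler_wpM2l; [rewrite !mulr_ge0 ?C2_ge0|exact: qpow].
have ctA x : 0 < x < 1 -> {for x, continuous A}.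
  move=> x01; have /andP[x0 _] := x01; have d := is_derive_u1 x01; have d' := is_derive_u2 x01.
  by apply: (@isd_continuous _ (fun r => prof_u2 r + prof_u1 r / r)); isd; [rewrite gt_eqF|].
have cinv (x : R) : 0 < x -> {for x, continuous (fun y : R => y^-1)}.
  by move=> x0; isdc; rewrite gt_eqF.
have ct1 x : 0 < x < 1 -> {for x, continuous t1}.
  move=> x01; have /andP[x0 _] := x01; apply: cvgM; last exact: cvg_id.
  apply: cvgM; first exact: ctA.
  by apply: cvgD; [exact: cg2|apply: cvgM; [exact: cg1|exact: cinv]].
have ct2 x : 0 < x < 1 -> {for x, continuous t2}.
  by move=> x01; apply: cvgM; [apply: mass_continuous => //; rewrite in_itv|exact: cg1].
have ct3 x : 0 < x < 1 -> {for x, continuous t3}.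
  move=> x01; have xin : x \in `]0, 1[ by rewrite in_itv.
  by apply: cvgM; [apply: cvgM; [exact: u1_cont|exact: u2_cont]|exact: cg].
have integr (t : R -> R) (K : R) : t 0 = 0 -> (forall x, 0 < x < 1 -> {for x, continuous t}) ->
    0 <= K -> (forall r, 0 < r <= 1 -> `|t r| <= K * qroot r) ->
    mu.-integrable `[0, 1] (EFin \o t) /\ t r @[r --> (0 : R)^'+] --> (0 : R).
  move=> t0 ct K0 tK; split.
    apply: (@bounded_itv_integrable _ _ _ _ K).
      by apply: continuous_oo_measurable => r; rewrite in_itv/= => /ct.
    move=> r; rewrite in_itv/= => /andP[]; rewrite le_eqVlt => /predU1P[<- _|r0 r1].
      by rewrite t0 normr0.
    apply: (le_trans (tK r _)); first by rewrite r0.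
    by rewrite ler_piMr // qroot_le1.
  apply: (@squeeze_cvgr_norm _ _ _ _ _ (fun r => K * qroot r)).
    near=> r; apply: tK; apply/andP; split; near: r;
      [exact: nbhs_right_gt|exact: nbhs_right_le].
  have : K * qroot r @[r --> (0 : R)^'+] --> K * 0.
    by apply: cvgM; [exact: cvg_cst|exact: qroot_cvg0].
  by rewrite mulr0.
have G10 : 0 <= G 1 by rewrite G_ge0 // ltr01 lexx.
have u10 : prof_u1 0 = 0 by rewrite /prof_u1 mul0r oppr0.
have [i1 l1] := integr t1 (C3 * (2 * M)) ltac:(by rewrite /t1 mulr0) ct1
  ltac:(by rewrite !mulr_ge0) t1_le.
have clt2 x : 0 < x < 1 -> {for x, continuous (fun r => lam * t2 r)}.
  by move=> x01; apply: cvgM; [exact: cvg_cst|exact: ct2].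
have [i2 l2] := integr (fun r => lam * t2 r) (G 1 * M) ltac:(by rewrite /t2 g10 !mulr0) clt2
  ltac:(by rewrite !mulr_ge0) t2_le.
have [i3 l3] := integr t3 (C * C2 * M) ltac:(by rewrite /t3 u10 !mul0r) ct3
  ltac:(by rewrite !mulr_ge0 ?C2_ge0) t3_le.
have it2 : mu.-integrable `[0, 1] (EFin \o t2).
  apply: (@integrable_itvM _ (mass f) g1) => //.
  apply: continuous_compact_integrable; first exact: segment_compact.
  exact: mass_continuous_within.
have -> : I1 + lam * I4 - I2 = \int[mu]_(r in `[0, 1]) e r.
  rewrite /e RintegralB //; last exact: integrable_itvD.
  by rewrite RintegralD // RintegralZl.
(* With [A] the Laplacian of [u], [r A'(r) = J'(r) / r = u'^2 / 2 + lam * mass f r]. In [E'] the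
   terms [u'^2 / 2 * g1] cancel and exactly [e] remains. *)
pose E r := A r * r * g1 r - prof_u1 r ^+ 2 / 2 * g r.
(* The derivative formulas hold only inside []0, 1[], so the integral is cut at a point beyond which
   the test profile vanishes. *)
pose b' := (b + 1) / 2.
have b'0 : 0 < b' by rewrite /b'; lra.
have b'1 : b' < 1 by rewrite /b'; lra.
have bb' : b < b' by rewrite /b'; lra.
rewrite (@Rintegral_itv_split _ _ 0 b' 1); last 2 first.
- by rewrite (ltW b'0) ltW.
- by apply: integrable_itvB => //; exact: integrable_itvD.
have -> : \int[mu]_(r in `[b', 1]) e r = 0.
  rewrite (_ : 0 = \int[mu]_(r in `[b', 1]) 0); last by rewrite Rintegral_cst // mul0r.
  apply: eq_Rintegral => r; rewrite inE /= in_itv/= => /andP[b'r r1].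
  have [gr g1r g2r] := out r (introT andP (conj (lt_le_trans bb' b'r) r1)).
  by rewrite /e gr g1r g2r mul0r addr0 !mulr0 mul0r addr0 subr0.
rewrite addr0.
have E_le r : 0 < r <= 1 -> `|E r| <= (C3 * M + C ^+ 2 * M) * qroot r.
  move=> r01; have /andP[r0 r1] := r01; have q0 := qroot_gt0 r0.
  have r01' : 0 <= r <= 1 by rewrite ltW.
  rewrite mulrDl; apply: (le_trans (ler_normB _ _)); apply: lerD.
    rewrite !normrM [`|r|]gtr0_norm //.
    apply: (@le_trans _ _ (C3 / qroot r * r * M)).
      apply: ler_pM; rewrite ?mulr_ge0 ?(ltW r0) //.
        by apply: ler_wpM2r; [exact: ltW|exact: A_le].
      by apply: (le_trans (g1M r r01')); rewrite ler_piMr.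
    rewrite -{2}(qroot_expr4 (ltW r0)).
    have -> : C3 / qroot r * qroot r ^+ 4 * M = C3 * M * qroot r ^+ 3 by field; rewrite gt_eqF.
    by apply: ler_wpM2l; [rewrite mulr_ge0|exact: qpow].
  rewrite normrM; apply: (@le_trans _ _ (C ^+ 2 * qroot r ^+ 6 * M)); last first.
    by rewrite mulrAC; apply: ler_wpM2l; [rewrite mulr_ge0 ?sqr_ge0|exact: qpow].
  apply: ler_pM => //; last exact: gM.
  have h : `|prof_u1 r| ^+ 2 <= (C * qroot r ^+ 3) ^+ 2.
    by rewrite ler_sqr ?nnegrE ?(le_trans _ (u1_le r r01)) ?u1_le.
  rewrite normrM normrX; move: h; rewrite exprMn -exprM.
  have -> : `|2^-1| = 2^-1 :> R by rewrite ger0_norm.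
  by have := sqr_ge0 `|prof_u1 r|; lra.
have E0 : E 0 = 0 by rewrite /E u10 mulr0 !mul0r expr0n /= !mul0r subrr.
have Ecvg : E r @[r --> (0 : R)^'+] --> E 0.
  rewrite E0; apply: (@squeeze_cvgr_norm _ _ _ _ _ (fun r => (C3 * M + C ^+ 2 * M) * qroot r)).
    near=> r; apply: E_le; apply/andP; split; near: r;
      [exact: nbhs_right_gt|exact: nbhs_right_le].
  have : (C3 * M + C ^+ 2 * M) * qroot r @[r --> (0 : R)^'+] --> (C3 * M + C ^+ 2 * M) * 0.
    by apply: cvgM; [exact: cvg_cst|exact: qroot_cvg0].
  by rewrite mulr0.
have e0 : e 0 = 0 by rewrite /e mulr0 g10 !mulr0 u10 !mul0r addr0 subrr.
have ecvg : e r @[r --> (0 : R)^'+] --> e 0.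
  have : t1 r + lam * t2 r - t3 r @[r --> (0 : R)^'+] --> (0 + 0 - 0 : R).
    by apply: cvgB => //; apply: cvgD.
  by rewrite e0 addr0 subr0.
have x01 x : 0 < x <= b' -> 0 < x < 1 by move=> /andP[-> xb]; rewrite (le_lt_trans xb).
have Eb : E b' - E 0 = 0.
  have [gb g1b _] := out b' ltac:(by rewrite bb' ltW).
  by rewrite E0 /E gb g1b !mulr0 !subrr.
transitivity (E b' - E 0); last exact: Eb.
notypeclasses refine (@Rintegral_FTC2_right _ E e 0 b' b'0 _ _ ecvg Ecvg).
- move=> x /x01 x01'; have /andP[x0 _] := x01'.
  have d1 := is_derive_u1 x01'; have d2 := is_derive_u2 x01'; have d3 := dg x; have d4 := dg1 x.
  rewrite /E /A; isd; first by rewrite gt_eqF.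
  rewrite /e /A /prof_u1 /prof_u2; field; rewrite gt_eqF //.
- move=> x /x01 x01'; apply: cvgB; last exact: ct3.
  by apply: cvgD; [exact: ct1|exact: clt2].
Unshelve. all: by end_near. Qed.

(** In the variable [rho = r^2] the target is [4 rho g(rho) = W(rho)] with
    [W(rho) = J(sqrt rho) / rho]. Since [W] is small near 0 but not near 1, a variable threshold
    [cut] is subtracted from it before dividing by [4 rho] and smoothing. The threshold costs at
    most [delta] where it is constant and at most [G 1 / 2] elsewhere; smoothing costs another
    [delta]. *)
Lemma profile_approximation (delta : R) : 0 < delta -> delta <= 1 / 4 ->
  exists2 g : R -> R, smooth1 g &
    (exists2 c : R, c < 1 & forall x, c <= x -> g x = 0) /\
    forall r, 0 < r <= 1 ->
      `|J r / r ^+ 2 - 4 * r ^+ 2 * g (r ^+ 2)| <= G 1 / 2 + delta /\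
      (r ^+ 2 <= 1 - 2 * delta -> `|J r / r ^+ 2 - 4 * r ^+ 2 * g (r ^+ 2)| <= 2 * delta).
Proof.
move=> d0 d4; set K0 := G 1 / 2.
have K00 : 0 <= K0 by rewrite divr_ge0 // G_ge0 // ltr01 lexx.
pose W (rho : R) := J (Num.sqrt rho) / rho.
(* Equal to [delta] up to [1 - 2 delta], then linear with slope [K0 / delta], so that from
   [1 - delta] on it exceeds the bound [K0] of [W]. *)
pose cut (rho : R) : R := delta + K0 * Num.max 0 ((rho - (1 - 2 * delta)) / delta).
(* Near 0 one has [W < delta], hence [k = 0]: the division by [rho] creates no singularity. *)
pose k (rho : R) := Num.max (W rho - cut rho) 0 / (4 * rho).
have cut_ge (rho : R) : delta <= cut rho by rewrite lerDl mulr_ge0 // le_max lexx.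
have cut_low (rho : R) : rho <= 1 - 2 * delta -> cut rho = delta.
  move=> h; rewrite /cut max_l ?mulr0 ?addr0 //.
  by rewrite ler_pdivrMr // mul0r; lra.
have sq01 (rho : R) : 0 < rho <= 1 -> 0 < Num.sqrt rho <= 1.
  move=> /andP[p0 p1]; rewrite sqrtr_gt0 p0 /=.
  by rewrite -(sqrtr1 R) ler_sqrt.
have W_le (rho : R) : 0 < rho <= 1 -> 0 <= W rho <= G (Num.sqrt rho) / 2.
  move=> p01; have /andP[s0 s1] := sq01 _ p01; have /andP[p0 _] := p01.
  have s01 : 0 <= Num.sqrt rho <= 1 by rewrite ltW.
  rewrite /W divr_ge0 ?J_ge0 ?(ltW p0) //= ler_pdivrMr //.
  by apply: (le_trans (J_le s01)); rewrite sqr_sqrtr ?(ltW p0) // mulrAC.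
have W_leK (rho : R) : 0 < rho <= 1 -> W rho <= K0.
  move=> p01; have /andP[_ h] := W_le _ p01; apply: (le_trans h).
  have /andP[s0 s1] := sq01 _ p01.
  by rewrite ler_pM2r ?invr_gt0 // G_homo // ltW.
have k0 : k 0 = 0 by rewrite /k mulr0 invr0 mulr0.
have k_zero (rho : R) : W rho <= cut rho -> k rho = 0.
  by move=> h; rewrite /k max_r ?mul0r // subr_le0.
have k_high (rho : R) : 1 - delta <= rho <= 1 -> k rho = 0.
  move=> /andP[p0 p1]; apply: k_zero.
  have p01 : 0 < rho <= 1 by rewrite p1 andbT; lra.
  apply: (le_trans (W_leK _ p01)).
  have : 1 <= Num.max 0 ((rho - (1 - 2 * delta)) / delta).
    by rewrite le_max; apply/orP; right; rewrite ler_pdivlMr // mul1r; lra.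
  move=> /(ler_wpM2l K00); rewrite mulr1 /cut; lra.
have ck : {within `[0, 1], continuous k}.
  apply/(continuous_within_itvP _ ltr01); split.
  - move=> x; rewrite in_itv/= => /andP[x0 x1].
    have s01 : 0 < Num.sqrt x < 1.
      by rewrite sqrtr_gt0 x0 /= -(sqrtr1 R) ltr_sqrt.
    have inv0 (y : R) : 0 < y -> {for y, continuous (fun z : R => z^-1)}.
      by move=> y0; isdc; rewrite gt_eqF.
    have cW : {for x, continuous W}.
      apply: cvgM; last exact: inv0.
      apply: (@continuous_comp _ _ _ (@Num.sqrt R) J); first exact: sqrt_continuous.
      exact: isd_continuous (is_derive_J s01).
    have ccut : {for x, continuous cut}.
      apply: cvgD; first exact: cvg_cst.
      apply: cvgM; first exact: cvg_cst.
      apply: (@continuous_comp _ _ _ (fun z : R => (z - (1 - 2 * delta)) / delta) (fun z => Num.max 0 z)).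
        by apply: cvgM; [apply: cvgB; [exact: cvg_id|exact: cvg_cst]|exact: cvg_cst].
      by apply: continuous_max; [exact: cvg_cst|exact: cvg_id].
    apply: cvgM.
      by apply: (@continuous_max _ _ (fun z => W z - cut z) (fun _ => 0)); [apply: cvgB|exact: cvg_cst].
    apply: (@continuous_comp _ _ _ (fun z : R => 4 * z) (fun z => z^-1)).
      by apply: cvgM; [exact: cvg_cst|exact: cvg_id].
    by apply: inv0; rewrite mulr_gt0.
  - have : \forall r \near (0 : R)^'+, G r < 2 * delta.
      by apply: (cvgr_lt _ G_cvg0); rewrite mulr_gt0.
    move=> /nbhs_ballP[e /= e0 eP].
    rewrite k0; apply: cvg_near_cst; near=> rho.
    have p0 : 0 < rho by near: rho; exact: nbhs_right_gt.
    have p1 : rho <= 1 by near: rho; exact: nbhs_right_le.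
    have p01 : 0 < rho <= 1 by rewrite p0.
    have pe : rho < e ^+ 2 by near: rho; apply: nbhs_right_lt; rewrite exprn_gt0.
    apply: k_zero; apply: le_trans (cut_ge _).
    have /andP[_ h] := W_le _ p01; apply: (le_trans h).
    have /andP[s0 s1] := sq01 _ p01.
    have : G (Num.sqrt rho) < 2 * delta.
      apply: eP => //; rewrite /ball /= sub0r normrN gtr0_norm //.
      by rewrite -[ltRHS](gtr0_norm e0) -sqrtr_sqr ltr_sqrt // exprn_gt0.
    by lra.
  - rewrite k_high; last by apply/andP; split; lra.
    apply: cvg_near_cst; near=> rho; apply: k_high; apply/andP; split; apply: ltW; near: rho.
      by apply: nbhs_left_gt; lra.
    exact: nbhs_left_lt.
have [|x||g sg [gc gk]] := @smooth_approximation _ k (1 - delta) (delta / 4) ck.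
- by lra.
- exact: k_high.
- exact: divr_gt0.
exists g => //; split => // r r01; have /andP[r0 r1] := r01.
have q01 : 0 < r ^+ 2 <= 1 by rewrite exprn_gt0 //= exprn_ile1 // ltW.
have /andP[q0 q1] := q01.
have q01' : 0 <= r ^+ 2 <= 1 by rewrite ltW.
have WE : W (r ^+ 2) = J r / r ^+ 2 by rewrite /W sqrtr_sqr gtr0_norm.
have kE : 4 * r ^+ 2 * k (r ^+ 2) = Num.max (W (r ^+ 2) - cut (r ^+ 2)) 0.
  by rewrite /k mulrC divfK // mulf_neq0 // gt_eqF.
have near_k : `|4 * r ^+ 2 * k (r ^+ 2) - 4 * r ^+ 2 * g (r ^+ 2)| <= delta.
  rewrite -mulrBr normrM distrC ger0_norm; last by rewrite mulr_ge0 // ltW.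
  apply: (@le_trans _ _ (4 * (delta / 4))); last by lra.
  apply: ler_pM => //; last exact: gk.
    by rewrite mulr_ge0 // ltW.
  by rewrite ler_piMr.
rewrite -WE; have := W_leK _ q01; have := W_le _ q01 => /andP[W0 _].
move: near_k; rewrite kE; have := cut_ge (r ^+ 2); have := cut_low (r ^+ 2).
move: (W _) (cut _) (4 * _ * _) W0 => w c z w0 cl cg; rewrite ler_norml => /andP[z1 z2] wK.
split=> [|h].
  rewrite ler_norml; move: z1 z2; rewrite /Order.max; case: ifPn => hw z1 z2;
    rewrite -?leNgt in hw; apply/andP; split; lra.
have cd := cl h; rewrite ler_norml; move: z1 z2; rewrite /Order.max cd; case: ifPn => hw z1 z2;
    rewrite -?leNgt in hw; apply/andP; split; lra.
Unshelve. all: by end_near. Qed.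

(** The difference [d] satisfies [d(1) = 0] and [d' = e / r], where [e] is the error of
    [profile_approximation]. From 1 back to the radius [s] with [s^2 = 1 - 2 delta] the error is
    only bounded, but the logarithmic length is of order [delta]. Below [s] the error is [2 delta]
    and the logarithm is bounded by [4 / qroot r - 4]. *)
Lemma slope_error (delta : R) (g h1 : R -> R) : 0 < delta -> delta <= 1 / 4 ->
  (forall x : R, is_derive x 1 h1 (g x)) -> h1 1 = 0 ->
  (forall r, 0 < r <= 1 ->
      `|J r / r ^+ 2 - 4 * r ^+ 2 * g (r ^+ 2)| <= G 1 / 2 + delta /\
      (r ^+ 2 <= 1 - 2 * delta -> `|J r / r ^+ 2 - 4 * r ^+ 2 * g (r ^+ 2)| <= 2 * delta)) ->
  forall r, 0 < r <= 1 ->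
    `|- sig r - 2 * h1 (r ^+ 2)| <= (2 * G 1 + 12) * delta / qroot r.
Proof.
move=> d0 d4 dh1 h11 errP.
pose e r : R := J r / r ^+ 2 - 4 * r ^+ 2 * g (r ^+ 2).
pose d r : R := - sig r - 2 * h1 (r ^+ 2).
have G10 : 0 <= G 1 by rewrite G_ge0 // ltr01 lexx.
have d1 : d 1 = 0 by rewrite /d sig1 expr1n h11 mulr0 oppr0 addr0.
have dh1sq (x : R) : is_derive x 1 (fun y => h1 (y ^+ 2)) (g (x ^+ 2) * (2 * x)).
  have dsq : is_derive x 1 (fun y : R => y ^+ 2) (2 * x) by isd; ring.
  exact: isd_comp dsq (dh1 _).
have dd (x : R) : 0 < x < 1 -> is_derive x 1 d (e x / x).
  move=> x01; have ds := is_derive_sig x01; have dh := dh1sq x; have /andP[x0 _] := x01.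
  by rewrite /d; isd; rewrite /e; field; rewrite gt_eqF.
have cd r : 0 < r < 1 -> {within `[r, 1], continuous d}.
  move=> /andP[r0 r1]; apply/(continuous_within_itvP _ r1); split.
  - move=> x; rewrite in_itv/= => /andP[rx x1].
    by apply: isd_continuous (dd x _); rewrite x1 (lt_trans r0 rx).
  - by apply: cvg_at_right_filter; apply: isd_continuous (dd r _); rewrite r0.
  - rewrite d1; have : - sig r - 2 * h1 (r ^+ 2) @[r --> (1 : R)^'-] --> - (0 : R) - 2 * h1 (1 ^+ 2).
      apply: cvgB; first exact: cvgN.
      apply: cvg_at_left_filter; apply: cvgM; first exact: cvg_cst.
      exact: isd_continuous (dh1sq 1).
    by rewrite expr1n h11 mulr0 oppr0 addr0.
have high r : 0 < r <= 1 -> 1 - 2 * delta <= r ^+ 2 -> `|d r| <= (2 * G 1 + 4) * delta.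
  move=> /andP[r0]; rewrite le_eqVlt => /predU1P[-> _|r1 rd].
    by rewrite d1 normr0 mulr_ge0 ?(ltW d0) // addr_ge0 // mulr_ge0.
  have := @log_lipschitz _ d e (G 1 / 2 + delta) r 1 r0 (ltW r1).
  rewrite d1 sub0r normrN ln1 sub0r => h.
  have {h} : `|d r| <= (G 1 / 2 + delta) * - ln r.
    apply: h => [|x /andP[rx x1]|x /andP[rx x1]].
    - by apply: cd; rewrite r0.
    - by apply: dd; rewrite x1 (lt_trans r0).
    - by have [] := errP x; rewrite ?(ltW x1) ?(lt_trans r0).
  move=> /le_trans; apply.
  (* Uses [- ln r <= (1 - r) / r] together with [1 - r <= 2 delta] and [r >= 1 / 2], both
     consequences of [r >= r^2 >= 1 - 2 delta]. *)
  have l4 : - ln r <= 4 * delta.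
    have rr : r ^+ 2 <= r by rewrite expr2 ler_piMr // ltW.
    have := @le_ln1Dx _ (r^-1 - 1); rewrite addrCA subrr addr0 lnV ?posrE // => hl.
    have iv : 0 < r^-1 by rewrite invr_gt0.
    have : - ln r <= r^-1 - 1 by apply: hl; lra.
    move=> /le_trans; apply.
    have -> : r^-1 - 1 = (1 - r) / r by field; rewrite gt_eqF.
    rewrite ler_pdivrMr //; have : 2 * delta <= 4 * delta * r; last by lra.
    by have := ler_wpM2l (ltW d0) (ltac:(lra) : 1 / 2 <= r); lra.
  have l0 : 0 <= G 1 / 2 + delta by rewrite addr_ge0 ?divr_ge0 // ltW.
  apply: (le_trans (ler_wpM2l l0 l4)).
  have := ler_wpM2l (ltW d0) d4; have := mulr_ge0 G10 (ltW d0); lra.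
move=> r r01; rewrite -/(d r); have /andP[r0 r1] := r01.
have q1 := invq_ge1 r01.
have [rd|rd] := leP (1 - 2 * delta) (r ^+ 2).
  apply: (le_trans (high r r01 rd)).
  have := ler_wpM2l (mulr_ge0 G10 (ltW d0)) q1; have := ler_wpM2l (ltW d0) q1.
  move: (qroot r)^-1 q1 => q q1; lra.
pose s := Num.sqrt (1 - 2 * delta).
have s2 : s ^+ 2 = 1 - 2 * delta by rewrite sqr_sqrtr //; lra.
have s0 : 0 < s by rewrite sqrtr_gt0; lra.
have s1 : s < 1 by rewrite -(sqrtr1 R) ltr_sqrt //; lra.
have rs : r < s by rewrite -ltr_sqr ?nnegrE ?(ltW r0) ?(ltW s0) // s2.
have r1' := lt_trans rs s1.
have hs : `|d s| <= (2 * G 1 + 4) * delta by apply: high; rewrite ?s2 // s0 ltW.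
have hr : `|d s - d r| <= 2 * delta * (ln s - ln r).
  apply: (@log_lipschitz _ d e) => // [|||x /andP[rx xs]].
  - exact: ltW.
  - have crs := cd r (introT andP (conj r0 r1')).
    by apply: continuous_subspaceW crs; apply: subset_itv; rewrite bnd_simp // ltW.
  - by move=> x /andP[rx xs]; apply: dd; rewrite (lt_trans r0 rx) (lt_trans xs).
  - have x0 := lt_trans r0 rx.
    have [_ h] := errP x (introT andP (conj x0 (ltW (lt_trans xs s1)))).
    by apply: h; rewrite -s2 ler_sqr ?nnegrE // ltW.
have ls : ln s <= 0 by rewrite ln_le0 // ltW.
have lr := oppr_ln_le r0.
have {}hr : `|d s - d r| <= 2 * delta * (4 / qroot r - 4).
  apply: (le_trans hr); apply: ler_wpM2l; first by rewrite mulr_ge0 // ltW.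
  by move: (ln s) (ln r) (4 / qroot r) ls lr => x y z; lra.
have -> : d r = d s - (d s - d r) by ring.
apply: (le_trans (ler_normB _ _)).
move: `|d s| `|d s - d r| hs hr => x y hs hr.
have := ler_wpM2l (mulr_ge0 G10 (ltW d0)) q1; have := ler_wpM2l (ltW d0) q1.
move: (qroot r)^-1 q1 hr => q q1 hr; lra.
Qed.

Lemma W22_sqnorm_le (U U1 U2 : R -> R) (s A B : R) : 0 <= s <= 1 -> 0 <= A -> 0 <= B ->
  {in `]0, 1[, continuous U} -> {in `]0, 1[, continuous U1} -> {in `]0, 1[, continuous U2} ->
  (forall r, 0 < r <= s -> (U r ^+ 2 + U1 r ^+ 2 + U2 r ^+ 2 + U1 r ^+ 2 / r ^+ 2) * r <= A) ->
  (forall r, 0 < r <= 1 -> s <= r ->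
    (U r ^+ 2 + U1 r ^+ 2 + U2 r ^+ 2 + U1 r ^+ 2 / r ^+ 2) * r <= B) ->
  (W22_sqnorm U U1 U2 <= (A * s + B * (1 - s))%:E)%E.
Proof.
move=> /andP[s0 s1] A0 B0 cU cU1 cU2 FA FB.
pose F r := (U r ^+ 2 + U1 r ^+ 2 + U2 r ^+ 2 + U1 r ^+ 2 / r ^+ 2) * r.
have F0 : F 0 = 0 by rewrite /F mulr0.
have cF : {in `]0, 1[, continuous F}.
  move=> x x01; have /andP[x0 _] : 0 < x < 1 by move: x01; rewrite in_itv.
  have sq (V : R -> R) : {for x, continuous V} -> {for x, continuous (fun y => V y ^+ 2)}.
    move=> cV; have -> : (fun y => V y ^+ 2) = fun y => V y * V y by apply/funext => y; rewrite expr2.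
    exact: cvgM.
  apply: cvgM; last exact: cvg_id.
  apply: cvgD.
    apply: cvgD; last by apply: sq; exact: cU2.
    by apply: cvgD; apply: sq; [exact: cU|exact: cU1].
  apply: cvgM; first by apply: sq; exact: cU1.
  by apply: (@isd_continuous _ (fun y => y ^- 2)); isd; rewrite ?expf_neq0 ?gt_eqF.
have F_ge0 r : 0 <= r -> 0 <= F r.
  by move=> r0; rewrite mulr_ge0 // !addr_ge0 ?sqr_ge0 // divr_ge0 ?sqr_ge0.
have Fi : mu.-integrable `[0, 1] (EFin \o F).
  apply: (@bounded_itv_integrable _ _ _ _ (A + B)); first exact: continuous_oo_measurable.
  move=> r; rewrite in_itv/= => /andP[r0 r1]; rewrite ger0_norm ?F_ge0 //.
  move: r0; rewrite le_eqVlt => /predU1P[<-|r0]; first by rewrite F0 addr_ge0.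
  have [rs|sr] := leP r s; first by apply: (le_trans (FA r _)); rewrite ?r0 // lerDl.
  by apply: (le_trans (FB r _ (ltW sr))); rewrite ?r0 // lerDr.
have cst_le (c a b : R) : 0 <= a -> a <= b -> b <= 1 -> 0 <= c ->
    (forall r, 0 < r -> a <= r <= b -> F r <= c) ->
    \int[mu]_(r in `[a, b]) F r <= c * (b - a).
  move=> a0 ab b1 c0 Fc.
  have -> : c * (b - a) = \int[mu]_(r in `[a, b]) c.
    symmetry; refine (@Rintegral_FTC2 _ (fun x => c * x) _ _ _ _ ab _ _ _).
    - by move=> x _; isd; ring.
    - by move=> x _; exact: cvg_cst.
    - by ring.
  apply: le_Rintegral => //; first exact: (integrable_itvS a0 b1 Fi).
    by apply: continuous_itv_integrable => x _; exact: cvg_cst.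
  move=> r /=; rewrite in_itv/= => /andP[ar rb].
  have := le_trans a0 ar; rewrite le_eqVlt => /predU1P[<-|r0]; first by rewrite F0.
  by apply: Fc => //; rewrite ar.
have -> : W22_sqnorm U U1 U2 = (\int[mu]_(r in `[0, 1]) F r)%:E.
  by rewrite /Rintegral fineK //; apply: integrable_fin_num.
rewrite lee_fin (@Rintegral_itv_split _ _ 0 s 1) ?s0 //.
apply: lerD; last first.
  by apply: cst_le => // r r0 /andP[sr r1]; apply: FB => //; rewrite r0.
have := cst_le A 0 s (lexx 0) s0 s1 A0; rewrite subr0; apply.
by move=> r r0 /andP[_ rs]; apply: FA; rewrite r0.
Qed.

(** Integrating [g] twice from the right gives [h1] and [h], both vanishing near 1, and
    [phi r = h (r ^+ 2)]. With [d] the slope error and [err] the error of [g], the first derivatives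
    differ by [r d], the quotients [u' / r] by [d], and the second derivatives by [err + d]. *)
Lemma u_W22ring : W22ring prof_u prof_u1 prof_u2.
Proof.
split=> [|e e0]; first exact: u_W22.
have G10 : 0 <= G 1 by rewrite G_ge0 // ltr01 lexx.
pose K1 : R := 2 * G 1 + 12; pose K0 : R := G 1 / 2 + 1.
have K10 : 0 <= K1 by rewrite addr_ge0 // mulr_ge0.
have K00 : 0 <= K0 by rewrite addr_ge0 // divr_ge0.
(* Chosen so that the squared distance is at most [delta * K2]: the summands come from the slope
   error, from [err] where it is at most [2 delta], and from the layer near 1 of width at most
   [2 delta]. *)
pose K2 : R := 5 * K1 ^+ 2 + 8 + 4 * K0 ^+ 2.
have K20 : 0 < K2.
  by rewrite /K2; have := sqr_ge0 K1; have := sqr_ge0 K0; move: (K1 ^+ 2) (K0 ^+ 2) => x y; lra.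
pose delta := Num.min (1 / 4) (e ^+ 2 / (2 * K2)).
have d0 : 0 < delta by rewrite lt_min !divr_gt0 ?mulr_gt0 ?exprn_gt0.
have d4 : delta <= 1 / 4 by rewrite ge_min lexx.
have dK : delta * K2 < e ^+ 2.
  have : delta <= e ^+ 2 / (2 * K2) by rewrite ge_min lexx orbT.
  rewrite ler_pdivlMr ?mulr_gt0 // mulrCA; have := mulr_gt0 d0 K20.
  by move: (delta * K2) (e ^+ 2) => x y x0; lra.
have [g sg [[c c1 gc] errP]] := profile_approximation d0 d4.
have cg x : {for x, continuous g} by exact: smooth1_continuous.
have [h1 dh1 h1c] := primitive_right cg gc.
have sh1 : smooth1 h1 := smooth1_primitive dh1 sg.
have [h dh hc] := primitive_right (fun x => smooth1_continuous (x := x) sh1) h1c.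
have sh : smooth1 h := smooth1_primitive dh sh1.
pose phi (r : R) := h (r ^+ 2).
have dsq (x : R) : is_derive x 1 (fun y : R => y ^+ 2) (2 * x) by isd; ring.
have dphi (x : R) : is_derive x 1 phi (2 * x * h1 (x ^+ 2)).
  by rewrite mulrC; exact: isd_comp (dsq x) (dh _).
have phi1E : derive1 phi = fun r => 2 * r * h1 (r ^+ 2).
  by apply/funext => x; rewrite derive1E; have [_ ->] := dphi x.
have dphi1 (x : R) : is_derive x 1 (fun r => 2 * r * h1 (r ^+ 2))
    (2 * h1 (x ^+ 2) + 4 * x ^+ 2 * g (x ^+ 2)).
  have d : is_derive x 1 (fun r => h1 (r ^+ 2)) (g (x ^+ 2) * (2 * x)).
    exact: isd_comp (dsq x) (dh1 _).
  by isd; ring.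
have phi2E : derive1n 2 phi = fun r => 2 * h1 (r ^+ 2) + 4 * r ^+ 2 * g (r ^+ 2).
  by rewrite derive1nS /= phi1E; apply/funext => x; rewrite derive1E; have [_ ->] := dphi1 x.
exists phi; first exact: square_radial_test sh c1 hc.
rewrite phi1E phi2E.
have h11 : h1 1 = 0 by apply: h1c; exact: ltW.
have phi1 : phi 1 = 0 by rewrite /phi expr1n; apply: hc; exact: ltW.
pose err r : R := J r / r ^+ 2 - 4 * r ^+ 2 * g (r ^+ 2).
pose d r : R := - sig r - 2 * h1 (r ^+ 2).
have d_le r : 0 < r <= 1 -> `|d r| <= K1 * delta / qroot r.
  exact: slope_error d0 d4 dh1 h11 errP r.
have U1E r : prof_u1 r - 2 * r * h1 (r ^+ 2) = r * d r by rewrite /prof_u1 /d; ring.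
have U2E r : prof_u2 r - (2 * h1 (r ^+ 2) + 4 * r ^+ 2 * g (r ^+ 2)) = err r + d r.
  by rewrite /prof_u2 /err /d; ring.
have Kd0 : 0 <= K1 * delta by rewrite mulr_ge0 // ltW.
have rd_le r : 0 < r <= 1 -> `|r * d r| <= K1 * delta.
  move=> r01; have /andP[r0 r1] := r01; have q0 := qroot_gt0 r0.
  rewrite normrM gtr0_norm //; apply: (le_trans (ler_wpM2l (ltW r0) (d_le r r01))).
  rewrite -{1}(qroot_expr4 (ltW r0)).
  have -> : qroot r ^+ 4 * (K1 * delta / qroot r) = K1 * delta * qroot r ^+ 3 by field; rewrite gt_eqF.
  by rewrite ler_piMr // exprn_ile1 ?qroot_ge0 // qroot_le1.
have U_le r : 0 < r <= 1 -> `|prof_u r - phi r| <= K1 * delta.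
  move=> /andP[r0]; rewrite le_eqVlt => /predU1P[->|r1].
    by rewrite u_at1 phi1 subrr normr0.
  have [x|  |x] := @MVT _ (fun x => prof_u x - phi x) (fun x => x * d x) r 1 r1.
  - rewrite in_itv/= => /andP[rx x1].
    have du := is_derive_u (introT andP (conj (lt_trans r0 rx) x1)); have dp := dphi x.
    by rewrite -U1E; isd.
  - apply/subspace_continuousP => x; rewrite /= in_itv/= => /andP[rx x1].
    apply: cvgB; last by apply: cvg_within_filter; exact: isd_continuous (dphi x).
    have crs : {within `[r, 1], continuous prof_u}.
      by apply: continuous_subspaceW u_continuous_within; apply: subset_itv; rewrite bnd_simp // ltW.
    by apply: (subspace_continuousP _ _).1 crs _ _; rewrite /= in_itv/= rx.
  - rewrite in_itv/= => /andP[rx x1]; rewrite u_at1 phi1 subrr sub0r => /(congr1 Num.norm).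
    rewrite normrN => ->; rewrite normrM.
    have hx : `|x * d x| <= K1 * delta by apply: rd_le; rewrite (lt_trans r0 rx) ltW.
    rewrite (le_trans _ hx) // ler_piMr // ger0_norm ?subr_ge0 ?(ltW r1) //.
    by rewrite gerBl ltW.
(* The coefficient 5 collects one contribution each from [u - phi], from [r d] and from the quotient
   term, and two from splitting [(err + d)^2 <= 2 err^2 + 2 d^2]. *)
have F_le r (x : R) : 0 < r <= 1 -> `|err r| <= x ->
    ((prof_u r - phi r) ^+ 2 + (r * d r) ^+ 2 + (err r + d r) ^+ 2 + (r * d r) ^+ 2 / r ^+ 2) * r
    <= 5 * (K1 * delta) ^+ 2 + 2 * x ^+ 2.
  move=> r01 errx; have /andP[r0 r1] := r01.
  have sq (y z : R) : `|y| <= z -> y ^+ 2 <= z ^+ 2.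
    by move=> yz; rewrite -(real_normK (num_real y)) ler_sqr ?nnegrE // (le_trans _ yz).
  have h1r := sq _ _ (U_le r r01); have h2r := sq _ _ (rd_le r r01); have h3r := sq _ _ errx.
  have h4r : d r ^+ 2 * r <= (K1 * delta) ^+ 2.
    by have := qroot_sqr_le r01 (d_le r r01); rewrite ger0_norm // mulr_ge0 ?sqr_ge0 // ltW.
  have -> : (r * d r) ^+ 2 / r ^+ 2 = d r ^+ 2 by field; rewrite gt_eqF.
  have h5r : (err r + d r) ^+ 2 <= 2 * err r ^+ 2 + 2 * d r ^+ 2.
    by have := sqr_ge0 (err r - d r); move: (err r) (d r) => y z; nra.
  have {}h5r : (err r + d r) ^+ 2 * r <= 2 * (err r ^+ 2 * r) + 2 * (d r ^+ 2 * r).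
    by apply: (le_trans (ler_wpM2r (ltW r0) h5r)); rewrite mulrDl !mulrA.
  have m1 := ler_piMr (sqr_ge0 (prof_u r - phi r)) r1.
  have m2 := ler_piMr (sqr_ge0 (r * d r)) r1; have m3 := ler_piMr (sqr_ge0 (err r)) r1.
  move: ((K1 * delta) ^+ 2) h1r h2r h4r => k h1r h2r h4r; rewrite !mulrDl.
  move: ((prof_u r - phi r) ^+ 2 * r) ((r * d r) ^+ 2 * r) (err r ^+ 2 * r)
    ((err r + d r) ^+ 2 * r) (d r ^+ 2 * r) m1 m2 m3 h4r h5r.
  move: ((prof_u r - phi r) ^+ 2) ((r * d r) ^+ 2) (err r ^+ 2) (x ^+ 2) h1r h2r h3r.
  by intros; lra.
pose s := Num.sqrt (1 - 2 * delta).
have s2 : s ^+ 2 = 1 - 2 * delta by rewrite sqr_sqrtr //; lra.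
have s0 : 0 < s by rewrite sqrtr_gt0; lra.
have s1 : s < 1 by rewrite -(sqrtr1 R) ltr_sqrt //; lra.
have s_le : 1 - s <= 2 * delta.
  have : s ^+ 2 <= s by rewrite expr2 ler_piMr // ltW.
  by rewrite s2; lra.
pose A := 5 * (K1 * delta) ^+ 2 + 2 * (2 * delta) ^+ 2.
pose B := 5 * (K1 * delta) ^+ 2 + 2 * K0 ^+ 2.
have cont01 (v v' : R -> R) (p p' : R -> R) : (forall r, 0 < r < 1 -> is_derive r 1 v (v' r)) ->
    (forall r : R, is_derive r 1 p (p' r)) -> {in `]0, 1[, continuous (v \- p)}.
  move=> dv dp r; rewrite in_itv/= => r01.
  by apply: cvgB; [exact: isd_continuous (dv r r01)|exact: isd_continuous (dp r)].
have arith (a b x y : R) : a ^+ 2 * x ^+ 2 <= a ^+ 2 * x -> x ^+ 2 * y <= x ^+ 2 ->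
    b ^+ 2 * (1 - y) <= b ^+ 2 * (2 * x) -> x ^+ 2 <= x ->
    (5 * (a * x) ^+ 2 + 2 * (2 * x) ^+ 2) * y + (5 * (a * x) ^+ 2 + 2 * b ^+ 2) * (1 - y)
    <= x * (5 * a ^+ 2 + 8 + 4 * b ^+ 2) by lra.
apply: (@le_lt_trans _ _ (A * s + B * (1 - s))%:E); last first.
  rewrite lte_fin; apply: le_lt_trans dK.
  have dd : delta ^+ 2 <= delta by rewrite expr2 ler_piMr ?(ltW d0) //; lra.
  have m1 := ler_wpM2l (sqr_ge0 K1) dd; have m2 := ler_piMr (sqr_ge0 delta) (ltW s1).
  have m3 := ler_wpM2l (sqr_ge0 K0) s_le; rewrite /A /B /K2.
  exact: arith m1 m2 m3 dd.
apply: W22_sqnorm_le.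
- by rewrite !ltW.
- by rewrite addr_ge0 // mulr_ge0 // sqr_ge0.
- by rewrite addr_ge0 // mulr_ge0 // sqr_ge0.
- exact: cont01 is_derive_u dphi.
- exact: cont01 is_derive_u1 dphi1.
- move=> r r01; apply: cvgB; first exact: u2_cont.
  have c2 : {for r, continuous (fun y : R => y ^+ 2)} by exact: isd_continuous (dsq r).
  apply: cvgD; apply: cvgM.
  + exact: cvg_cst.
  + by apply: (@continuous_comp _ _ _ (fun y : R => y ^+ 2) h1) => //; exact: smooth1_continuous.
  + by apply: cvgM; first exact: cvg_cst.
  + by apply: (@continuous_comp _ _ _ (fun y : R => y ^+ 2) g).
- move=> r /andP[r0 rs]; have r01 : 0 < r <= 1 by rewrite r0 (le_trans rs) // ltW.
  rewrite /= U1E U2E; apply: F_le => //; have [_ h'] := errP r r01; apply: h'.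
  by rewrite -s2 ler_sqr ?nnegrE // ltW.
- move=> r r01 sr; rewrite /= U1E U2E; apply: F_le => //; have [h' _] := errP r r01.
  apply: (le_trans h'); rewrite /K0 lerD2l; lra.
Qed.

End Profile.

(** * Distinct roots give distinct solutions *)

Lemma volterra_eq (R : realType) (p D E : R -> R) (a b r : R) :
  (forall s, 0 <= s <= r -> vkernel p a s (D s) = vkernel p b s (E s)) ->
  volterra p a D r = volterra p b E r.
Proof.
move=> DE; apply: eq_Rintegral => t; rewrite inE /= in_itv/= => /andP[t0 tr].
congr (_ / _); apply: eq_Rintegral => s; rewrite inE /= in_itv/= => /andP[s0 st].
by apply: DE; rewrite s0 (le_trans st).
Qed.

Section RootSolutions.
Context {R : realType}.
Local Notation mu := (@lebesgue_measure R).
Variables (f : R -> R) (lam : R).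
Hypothesis f_L1 : mu.-integrable `[0, 1] (fun r : R => (f r * r)%:E).
Hypothesis f_ge0 : {ae mu, forall r : R, r \in `[0, 1] -> 0 <= f r}.
Hypothesis lam_ge0 : 0 <= lam.
Hypothesis lam_small : 2 * (lam * mass f 1) <= 1.
Local Notation sig a := (shoot (forcing f lam) a).
Implicit Types a b r : R.

Lemma root_is_derive a r : 0 <= a -> sig a 1 = 0 -> 0 < r < 1 ->
  is_derive r 1 (prof_u (sig a)) (prof_u1 (sig a) r).
Proof.
move=> a0 root; have C0 : 0 <= a + 1 by rewrite addr_ge0.
have h1 := sig_ge0 f_L1 f_ge0 lam_ge0 lam_small a0 root.
have h2 := sig_le f_L1 f_ge0 lam_ge0 lam_small a0.
have h3 := is_derive_sig f_L1 f_ge0 lam_ge0 lam_small a0.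
exact: is_derive_u h1 h2 h3 C0 r.
Qed.

Lemma root_solution a : 0 <= a -> sig a 1 = 0 -> solution lam f (prof_u (sig a)).
Proof.
move=> a0 root; have C0 : 0 <= a + 1 by rewrite addr_ge0.
have lm r : 0 <= r <= 1 -> 0 <= lam * mass f r by move=> r01; rewrite mulr_ge0 // mass_ge0.
have h1 := sig_ge0 f_L1 f_ge0 lam_ge0 lam_small a0 root.
have h2 := sig_nincr f_L1 f_ge0 lam_ge0 lam_small a0.
have h3 := sig_le f_L1 f_ge0 lam_ge0 lam_small a0.
have h4 := sig_cvg1 f_L1 f_ge0 lam_ge0 lam_small a0 root.
have h5 := is_derive_sig f_L1 f_ge0 lam_ge0 lam_small a0.
have h6 := is_derive_flux f_L1 f_ge0 lam_ge0 lam_small a0 root.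
have h7 := flux_ge0 f_L1 f_ge0 lam_ge0 a.
have h8 := flux_le f_L1 f_ge0 lam_ge0 lam_small a0 root.
have h9 := source_le f_L1 f_ge0 lam_ge0 lam_small a0 root.
have h10 := source_bound_homo f_L1 f_ge0 lam_ge0 a.
have h11 := source_bound_cvg0 lam f_L1 a.
split.
  exists (prof_u1 (sig a)), (prof_u2 (sig a) (flux f lam a)); split.
    exact: u_W22ring root h1 h3 h4 h5 h6 h7 h8 lm h9 h10 h11 C0.
  exact: u_weak_equation f_L1 h1 h3 h5 h6 h7 h8 lm h9 h10 C0.
exact: u_boundary_conditions h1 h2 h3 h4 h5 h6 h7 h8 lm h9 h11 C0.
Qed.

(** Equal solutions have equal derivatives, hence equal [sig]. At a root the kernel depends on [a]
    only through [sig], so the two functions [D] coincide at [1 / 2], and there [sig = a + p - D]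
    determines [a]. *)
Lemma root_profile_inj a b : 0 <= a -> 0 <= b -> sig a 1 = 0 -> sig b 1 = 0 ->
  (forall r, 0 < r < 1 -> prof_u (sig a) r = prof_u (sig b) r) -> a = b.
Proof.
have half0 : 0 < (1 / 2 : R) by lra.
have half1 : (1 / 2 : R) < 1 by lra.
have h01 : 0 <= (1 / 2 : R) <= 1 by rewrite !ltW.
move=> a0 b0 ra rb uE.
have sE r : 0 < r < 1 -> sig a r = sig b r.
  move=> r01; have /andP[r0 _] := r01.
  have [_ e1] := is_derive_oo uE (fun x => root_is_derive b0 rb) r01.
  have [_ e2] := root_is_derive a0 ra r01.
  by move: e1; rewrite e2 => /oppr_inj/(mulfI (lt0r_neq0 r0)).
have sE1 r : 0 < r <= 1 -> sig a r = sig b r.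
  move=> /andP[r0]; rewrite le_eqVlt => /predU1P[->|r1]; first by rewrite ra rb.
  by apply: sE; rewrite r0.
have kE s : 0 <= s <= 1 -> vkernel (forcing f lam) a s (volterra_sol (forcing f lam) a s) =
    vkernel (forcing f lam) b s (volterra_sol (forcing f lam) b s).
  move=> s01; rewrite (vkernel_sig f_L1 f_ge0 lam_ge0 lam_small a0 ra s01).
  rewrite (vkernel_sig f_L1 f_ge0 lam_ge0 lam_small b0 rb s01).
  move: (sig a s) (sig b s) (sE1 s) s01 => x y xy /andP[].
  rewrite le_eqVlt => /predU1P[<- _|s0 s1]; first by rewrite exprS !mul0r.
  by rewrite xy // s0.
have DE : volterra_sol (forcing f lam) a (1 / 2) = volterra_sol (forcing f lam) b (1 / 2).
  rewrite (volterra_D f_L1 f_ge0 lam_ge0 lam_small a0 h01).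
  rewrite (volterra_D f_L1 f_ge0 lam_ge0 lam_small b0 h01).
  by apply: volterra_eq => s /andP[s0 s1]; apply: kE; rewrite s0 (le_trans s1) // ltW.
have : sig a (1 / 2) = sig b (1 / 2) by apply: sE; rewrite half0.
by rewrite /shoot DE => /addIr/addIr.
Qed.

End RootSolutions.

(** If [u] and [v] differed at one point, continuity would put an interval of positive length into a
    null set. *)
Lemma ae_eq_continuous_oo (R : realType) (u v : R -> R) (a b : R) :
  (forall x, a < x < b -> {for x, continuous u}) ->
  (forall x, a < x < b -> {for x, continuous v}) ->
  {ae @lebesgue_measure R, forall x, x \in `[a, b] -> u x = v x} ->
  forall x, a < x < b -> u x = v x.
Proof.
move=> cu cv [A [mA A0 subA]] x xab; apply/eqP; rewrite -subr_eq0; apply/negPn/negP => w0.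
have cw : u y - v y @[y --> x] --> u x - v x by apply: cvgB; [exact: cu|exact: cv].
have n1 : \forall y \near x, u y - v y != 0 by exact: cvgr_neq0 cw w0.
have : \forall y \near x, u y - v y != 0 /\ a < y < b.
  by apply: filterI n1 _; exact: near_oo.
move=> /nbhs_ballP[d /= d0 dP].
have sub : `[x - d / 2, x + d / 2]%classic `<=` A.
  move=> y /=; rewrite in_itv/= => /andP[y1 y2]; apply: subA => /= h.
  have [|/negP w] := dP y; first by rewrite /ball /= ltr_norml; apply/andP; split; lra.
  by move=> /andP[ay yb]; apply: w; rewrite subr_eq0; apply/eqP/h; rewrite in_itv/= !ltW.
have : (lebesgue_measure `[(x - d / 2)%R, (x + d / 2)%R]%classic <= lebesgue_measure A)%E.
  by apply: le_measure => //; rewrite inE //; exact: measurable_itv.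
rewrite A0 lebesgue_measure_itv /= lte_fin.
rewrite ifT; last by lra.
by rewrite -EFinD lee_fin; lra.
Qed.

Theorem theorem3p1 (R : realType) (f : R -> R)
    (f_L1 : lebesgue_measure.-integrable `[0, 1] (fun r : R => (f r * r)%:E))
    (f_ge0 : {ae lebesgue_measure, forall r : R, r \in `[0, 1] -> 0 <= f r}) :
  exists2 lambda_c : R, 0 < lambda_c &
    forall lambda : R, 0 < lambda < lambda_c ->
      exists u v : R -> R,
        [/\ solution lambda f u, solution lambda f v &
            ~ {ae lebesgue_measure, forall r : R, r \in `[0, 1] -> u r = v r}].
Proof.
have m0 : 0 <= mass f 1 by apply: mass_ge0 => //; rewrite ler01 lexx.
(* This gives [2 * (lam * mass f 1) <= 1]; the added 1 covers the case of zero mass. *)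
exists (2 * (mass f 1 + 1))^-1; first by rewrite invr_gt0 mulr_gt0 // ltr_wpDl.
move=> lam /andP[lam_gt0 lam_lt]; have lam0 := ltW lam_gt0.
have small : 2 * (lam * mass f 1) <= 1.
  have k0 : 0 < 2 * (mass f 1 + 1) by rewrite mulr_gt0 // ltr_wpDl.
  have := ltW lam_lt; rewrite -[_^-1]mul1r ler_pdivlMr //.
  by move: (mass f 1) m0 => m m0; have := mulr_ge0 lam0 m0; lra.
have [a [b [a0 ab ra rb]]] := shoot_roots (forcing_continuous (lam := lam) f_L1 f_ge0)
  (forcing_ge0 f_L1 f_ge0 lam0) (forcing_sqr_le f_L1 f_ge0 lam0 small)
  (forcing_nincr f_L1 f_ge0 lam0) (forcing1 f lam).
have b0 : 0 <= b by exact: le_trans (ltW ab).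
exists (prof_u (shoot (forcing f lam) a)), (prof_u (shoot (forcing f lam) b)); split.
- exact: root_solution.
- exact: root_solution.
move=> uE; suff e : a = b by rewrite e ltxx in ab.
apply: (root_profile_inj f_L1 f_ge0 lam0 small a0 b0 ra rb).
by apply: ae_eq_continuous_oo uE => x x01;
  [apply: isd_continuous (root_is_derive f_L1 f_ge0 lam0 small a0 ra x01)
  |apply: isd_continuous (root_is_derive f_L1 f_ge0 lam0 small b0 rb x01)].
Qed.
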